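(* Let $m\ge0$ and $q\in\mathscr{H}_{\kappa,m}$. (i) For a smooth function $f$ on a neighbourhood of $0\in\mathbb{R}^d$ and every integer $N\ge0$, \[ \frac{1}{\omega_{\kappa,d}}\int_{S^{d-1}} q(y)f(ry)h_\kappa^2(y)\,d\sigma(y)=\sum_{n=0}^{N}\frac{(q(\mathscr{D})\Delta_\kappa^n f)(0)}{n!\,(\lambda_\kappa+1)_{m+n}}\Big(\frac r2\Big)^{m+2n}+o(r^{m+2N})\quad (r\to+0). \] (ii) If $f$ is real analytic on the open ball of radius $1$ centred at $0$, then there is $\rho\in(0,1)$ such that for all $0<r<\rho$ \[ \frac{1}{\omega_{\kappa,d}}\int_{S^{d-1}} q(y)f(ry)h_\kappa^2(y)\,d\sigma(y)=\sum_{n=0}^{\infty}\frac{(q(\mathscr{D})\Delta_\kappa^n f)(0)}{n!\,(\lambda_\kappa+1)_{m+n}}\Big(\frac r2\Big)^{m+2n}. \]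
   Context: Let $d\ge1$, $\langle\cdot,\cdot\rangle$ the standard inner product on $\mathbb{R}^d$, $\|x\|=\langle x,x\rangle^{1/2}$. Let $R\subset\mathbb{R}^d$ be a reduced root system (not necessarily crystallographic) with a fixed positive system $R_+$, $r_\alpha$ the reflection in $\alpha^\perp$, and $G$ the finite reflection group generated by the $r_\alpha$. Let $\kappa:R\to\mathbb{R}_{\ge0}$, $\alpha\mapsto\kappa_\alpha$, be $G$-invariant (a multiplicity function). Put $\lambda_\kappa=\frac d2-1+\sum_{\alpha\in R_+}\kappa_\alpha$. For $\xi\in\mathbb{R}^d\setminus\{0\}$ the Dunkl operator is $\mathscr{D}_\xi f(x)=\partial_\xi f(x)+\sum_{\alpha\in R_+}\kappa_\alpha\langle\alpha,\xi\rangle\frac{f(x)-f(r_\alpha x)}{\langle\alpha,x\rangle}$, where $\partial_\xi$ is the directional derivative; these operators commute. With $e_1,\dots,e_d$ the standard basis, $\mathscr{D}_j=\mathscr{D}_{e_j}$, $\mathscr{D}=(\mathscr{D}_1,\dots,\mathscr{D}_d)$, and $\Delta_\kappa=\sum_j\mathscr{D}_j^2$ (Dunkl Laplacian). For a polynomial $q$, $q(\mathscr{D})$ is obtained by substituting $\mathscr{D}_j$ for $x_j$. $\mathscr{P}$ denotes real polynomials on $\mathbb{R}^d$, $\mathscr{P}_m$ the homogeneous ones of degree $m$, $\mathscr{H}_{\kappa,m}=\{p\in\mathscr{P}_m:\Delta_\kappa p=0\}$. The weight is $h_\kappa(x)=\prod_{\alpha\in R_+}|\langle\alpha,x\rangle|^{\kappa_\alpha}$,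 $d\sigma$ is surface measure on the unit sphere $S^{d-1}$, and $\omega_{\kappa,d}=\int_{S^{d-1}}h_\kappa^2\,d\sigma$. $(a)_0=1$, $(a)_n=a(a+1)\cdots(a+n-1)$. *)

(* Defs.v *)
From HB Require Import structures.
From mathcomp Require Import all_boot all_order all_algebra.
From mathcomp Require Import all_classical all_reals all_analysis.
From mathcomp Require mpoly.
Set Implicit Arguments. Unset Strict Implicit. Unset Printing Implicit Defensive.
Import Order.TTheory GRing.Theory Num.Theory.
Import numFieldNormedType.Exports.
Local Open Scope classical_set_scope.
Local Open Scope ring_scope.

Section Dunkl.
Variables (R : realType) (d : nat).
Local Notation V := 'rV[R]_d.

Definition dotp (u v : V) : R := \sum_(i < d) u 0 i * v 0 i.
Definition enorm (x : V) : R := Num.sqrt (dotp x x).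

Definition refl (a x : V) : V := x - ((2 * dotp a x) / dotp a a) *: a.

Definition root_system (Rs : seq V) : Prop :=
  [/\ uniq Rs,
      (forall a, a \in Rs -> a != 0),
      (forall a (c : R), a \in Rs -> (c *: a \in Rs <-> (c = 1 \/ c = -1))) &
      (forall a b, a \in Rs -> b \in Rs -> refl a b \in Rs)].

(* b0 is regular: it defines the positive system R_+ = {a in R | <a,b0> > 0};
   every positive system arises this way *)
Definition regular (Rs : seq V) (b0 : V) : Prop :=
  forall a, a \in Rs -> dotp a b0 != 0.
Definition pos_roots (Rs : seq V) (b0 : V) : seq V :=
  [seq a <- Rs | 0 < dotp a b0].

(* the action of the element r_{s_1} ... r_{s_k} of the reflection group G *)
Definition gact (s : seq V) (x : V) : V := foldr refl x s.

Definition multiplicity (Rs : seq V) (kappa : V -> R) : Prop :=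
  (forall a, a \in Rs -> 0 <= kappa a) /\
  (forall (s : seq V) a, all (fun b => b \in Rs) s -> a \in Rs ->
      kappa (gact s a) = kappa a).

(* difference quotient (f(x) - f(r_a x)) / <a,x>, extended by continuity
   (value 2/|a|^2 * d_a f(x)) on the hyperplane <a,x> = 0 *)
Definition dquot (a : V) (f : V -> R) (x : V) : R :=
  if dotp a x != 0 then (f x - f (refl a x)) / dotp a x
  else (2 / dotp a a) * 'D_a f x.

Definition dunkl (Rs : seq V) (b0 : V) (kappa : V -> R) (xi : V)
    (f : V -> R) : V -> R :=
  fun x => 'D_xi f x +
    \sum_(a <- pos_roots Rs b0) kappa a * dotp a xi * dquot a f x.

Definition ebasis (j : 'I_d) : V := delta_mx 0 j.

Definition dunklj Rs b0 kappa (j : 'I_d) := dunkl Rs b0 kappa (ebasis j).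

Definition dlap Rs b0 kappa (f : V -> R) : V -> R :=
  fun x => \sum_(j < d) dunklj Rs b0 kappa j (dunklj Rs b0 kappa j f) x.

Definition dmon Rs b0 kappa (m : mpoly.multinom d) (f : V -> R) : V -> R :=
  foldr (fun j g => iter (mpoly.fun_of_multinom m j) (dunklj Rs b0 kappa j) g)
        f (enum 'I_d).
Definition qD Rs b0 kappa (q : mpoly.mpoly d R) (f : V -> R) : V -> R :=
  fun x => \sum_(m <- mpoly.msupp q)
             mpoly.mcoeff m q * dmon Rs b0 kappa m f x.

Definition peval (q : mpoly.mpoly d R) (x : V) : R :=
  mpoly.meval (fun i => x 0 i) q.

Definition harmonic_homog Rs b0 kappa (deg : nat) (q : mpoly.mpoly d R) : Prop :=
  all (fun mm => mpoly.mdeg mm == deg) (mpoly.msupp q) /\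
  (forall x, dlap Rs b0 kappa (peval q) x = 0).

Definition hweight Rs b0 (kappa : V -> R) (x : V) : R :=
  \prod_(a <- pos_roots Rs b0) powR `|dotp a x| (kappa a).

Definition lambda Rs b0 (kappa : V -> R) : R :=
  d%:R / 2 - 1 + \sum_(a <- pos_roots Rs b0) kappa a.

Definition poch (a : R) (n : nat) : R := \prod_(i < n) (a + i%:R).

Definition iterD (vs : seq V) (f : V -> R) : V -> R :=
  foldr (fun v g => 'D_v g) f vs.
Definition smooth_on (U : set V) (f : V -> R) : Prop :=
  forall (vs : seq V) (v x : V), U x ->
    derivable (iterD vs f) x v /\ {for x, continuous (iterD vs f)}.

Definition pterm (k : nat) (c : ('I_d -> nat) -> R) (x0 x : V) : R :=
  \sum_(a : {ffun 'I_d -> 'I_k.+1} | (\sum_(i < d) val (a i))%N == k)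
     c (fun i => val (a i)) * \prod_(i < d) (x 0 i - x0 0 i) ^+ val (a i).
Definition pterm_abs (k : nat) (c : ('I_d -> nat) -> R) (x0 x : V) : R :=
  \sum_(a : {ffun 'I_d -> 'I_k.+1} | (\sum_(i < d) val (a i))%N == k)
     `|c (fun i => val (a i))| * \prod_(i < d) `|x 0 i - x0 0 i| ^+ val (a i).
Definition analytic_on_ball (f : V -> R) : Prop :=
  forall x0 : V, enorm x0 < 1 ->
    exists delta : R, 0 < delta /\
    exists c : ('I_d -> nat) -> R, forall x : V, enorm (x - x0) < delta ->
      cvg ((fun N => \sum_(k < N) pterm_abs k c x0 x) @ \oo) /\
      ((fun N => \sum_(k < N) pterm k c x0 x) @ \oo --> f x).

End Dunkl.

Fixpoint intRn (R : realType) (n : nat) : ('rV[R]_n -> R) -> R :=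
  match n return ('rV[R]_n -> R) -> R with
  | 0 => fun g => g 0
  | n'.+1 => fun g =>
      Rintegral (@lebesgue_measure R) setT
        (fun t : R => @intRn R n' (fun v => g (row_mx (const_mx t : 'rV[R]_1) v)))
  end.

(* integral over the unit sphere w.r.t. surface measure sigma, via
   sigma(A) = d * Lebesgue({t y : y in A, 0 < t < 1}) *)
Definition int_sphere (R : realType) (d : nat) (g : 'rV[R]_d -> R) : R :=
  d%:R * intRn (fun x => if enorm x < 1 then g ((enorm x)^-1 *: x) else 0).

Definition omega (R : realType) (d : nat) Rs b0 (kappa : 'rV[R]_d -> R) : R :=
  int_sphere (fun y => hweight Rs b0 kappa y ^+ 2).

Definition sph_mean (R : realType) (d : nat) Rs b0 (kappa : 'rV[R]_d -> R)
    (q : mpoly.mpoly d R) (f : 'rV[R]_d -> R) (r : R) : R :=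
  (omega Rs b0 kappa)^-1 *
  int_sphere (fun y => peval q y * f (r *: y) * hweight Rs b0 kappa y ^+ 2).

Definition exp_term (R : realType) (d : nat) Rs b0 (kappa : 'rV[R]_d -> R)
    (deg : nat) (q : mpoly.mpoly d R) (f : 'rV[R]_d -> R) (r : R) (n : nat) : R :=
  qD Rs b0 kappa q (iter n (dlap Rs b0 kappa) f) 0 /
    (n`!%:R * poch (lambda Rs b0 kappa + 1) (deg + n)) * (r / 2) ^+ (deg + 2 * n).

(* Main.v *)
(**
Let [L f] be the integral of [f h_kappa^2] over the sphere, with [h_kappa^2] renormalised by
constants, and let [E f = N_k L f] for [f] homogeneous of degree [k], with [N_k] the moments of a
Gaussian radial density, so that [E] is the Gaussian functional for the Dunkl weight. Integration
by parts is [E (D_j f) = E (x_j f)]. On the unweighted sphere this comes from integrating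
[d_j (P (1 - |x|^2)_+^2)]; the weight, which is not differentiable, is approximated on the sphere by
polynomials, namely truncated binomial series for [(1 - u)^kappa] with [u = 1 - <a,x>^2 / |a|^2].

Thus [x_j - D_j] is the adjoint of [D_j]. The commutator [D_i, D_j] is then skew, and it vanishes by
induction on the degree. Iterating the adjunction over the letters of a monomial [w] gives
[E (w(D) P) = E ((e^(-Delta/2) w) P)], hence [E (q(D) P) = E (q P)] for harmonic [q]; together with
[E (Delta r) = k E r] in degree [k] this is the expansion for homogeneous polynomials [P], where a
single term is nonzero.

A smooth [f] is a Taylor polynomial plus a remainder all of whose low order derivatives vanish at
[0]. Writing the difference quotient as an average of directional derivatives along the segment from
[x] to [r_a x] shows that a Dunkl operator preserves smoothness and lowers the order of vanishing by
one, so the remainder contributes only to the error. For analytic [f] the same applies to the tails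
of the power series at [0], and dominated convergence on the sphere gives the infinite expansion.
*)

(* The sphere integral is an iterated one-dimensional integral over a ball, so the changes of
   variables at hand are translations, dilations and the change of sign. Invariance under
   reflections is therefore obtained for polynomials, as a consequence of integration by parts, and
   everything before the limit in the weight is kept polynomial. For small [kappa] the weight has no
   derivative on the hyperplanes; the singular term in the derivative of an approximation is tamed
   by averaging over [x] and [r_a x], and this is exactly where the difference quotient of the Dunkl
   operator comes from. In Green's formula on the sphere the constant depends on the degree; the
   Gaussian moments absorb it, and the adjoint of [D_j] becomes one operator for all degrees.
   Commutativity is proved as well: the definition of [q(D)] fixes an order of the letters, whereas
   the mean formula has to move [Delta] past them. *)
Require Import Defs.
From HB Require Import structures.
From mathcomp Require Import all_boot all_order all_algebra.
From mathcomp Require Import all_classical all_reals all_analysis.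
From mathcomp Require Import measurable_realfun lebesgue_integral_under.
From mathcomp Require Import ring lra zify.
From mathcomp Require mpoly.
Set Implicit Arguments. Unset Strict Implicit. Unset Printing Implicit Defensive.
Import Order.TTheory GRing.Theory Num.Theory.
Import numFieldNormedType.Exports.
Local Open Scope classical_set_scope.
Local Open Scope ring_scope.

(** * Iterated integrals *)

Section RealLine.
Variable R : realType.
Implicit Types f : R -> R.
Notation mu := (@lebesgue_measure R).
Notation int1 f := (Rintegral mu setT f).

Definition bounded_supp (K M : R) f :=
  (forall t, `|f t| <= M) /\ (forall t, K < `|t| -> f t = 0).

Lemma bounded_supp_integrable K M f : measurable_fun setT f ->
  bounded_supp K M f -> mu.-integrable setT (EFin \o f).
Proof.
move=> mf [fM fK].
have -> : EFin \o f = (EFin \o f) \_ `[- K, K].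
  apply/funext => t; rewrite patchE; case: ifPn => //= tK.
  rewrite fK// ltNge; apply: contraNN tK => tK.
  by rewrite inE/= in_itv/= -ler_norml.
apply/(integrable_mkcond _ _).1 => //.
apply: measurable_bounded_integrable => //.
- exact/compact_finite_measure/segment_compact.
- exact: measurable_funTS.
- exists M; split; first exact: num_real.
  by move=> y My t _; apply: le_trans (fM t) (ltW My).
Qed.

Lemma int1_dct K M (g : nat -> R -> R) f :
  (forall k, measurable_fun setT (g k)) -> (forall k, bounded_supp K M (g k)) ->
  (forall t, g k t @[k --> \oo] --> f t) ->
  int1 (g k) @[k --> \oo] --> int1 f.
Proof.
move=> mg bg gf.
pose G : R -> R := fun t => M * \1_(`[- K, K] : set R) t.
have iG : mu.-integrable setT (EFin \o G).
  apply: (@bounded_supp_integrable K `|M|).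
    by apply: measurable_funM => //; exact: measurable_indic.
  split=> t; rewrite /G indicE.
    by case: (t \in _); rewrite ?mulr1 ?mulr0 ?normr0.
  move=> Kt; rewrite memNset ?mulr0//= in_itv/= => /andP[a b].
  by move: Kt; rewrite ltNge ler_norml a b.
have mf : measurable_fun setT f.
  by apply: (measurable_fun_cvg mg) => t _; exact: gf.
have gf' : {ae mu, forall t, setT t -> (g k t)%:E @[k --> \oo] --> (f t)%:E}.
  by apply: aeW => t _; apply: cvg_EFin; [exact: nearW|exact: gf].
have gG : {ae mu, forall t k, setT t -> (`|(g k t)%:E| <= (EFin \o G) t)%E}.
  apply: aeW => t k _; rewrite lee_fin /G indicE.
  have [tK|tK] := boolP (t \in _); first by rewrite mulr1; exact: (bg k).1.
  rewrite (bg k).2 ?normr0 ?mulr0// ltNge; apply: contraNN tK => tK.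
  by rewrite inE/= in_itv/= -ler_norml.
have [if_ _ cv] := @dominated_convergence _ _ _ mu setT measurableT
  (fun k t => (g k t)%:E) (fun t => (f t)%:E) (EFin \o G)
  (fun k => (measurable_EFinP _ _).2 (mg k)) ((measurable_EFinP _ _).2 mf)
  gf' iG gG.
by apply: fine_cvg; rewrite /Rintegral fineK//; exact: integrable_fin_num.
Qed.

(** By uniqueness of Lebesgue measure: [|c|] times the push-forward of [mu] under [t |-> c t + b]
    has the right value on half-open intervals, whatever the sign of [c]. *)
Lemma ge0_int1_affine (c b : R) f : c != 0 -> measurable_fun setT f ->
  (forall t, 0 <= f t) -> `|c| * int1 (fun t => f (c * t + b)) = int1 f.
Proof.
move=> c0 mf f0; pose phi : R -> R := fun t => c * t + b.
have mphi : measurable_fun setT (phi : measurableTypeR R -> measurableTypeR R).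
  by apply: measurable_funD => //; exact: measurable_funM.
have c_ge0 : 0 <= `|c| by [].
pose nu := mscale (NngNum c_ge0)
  (measure_function_pushforward__canonical__measure_function_Measure mu mphi).
have nuE A : measurable A -> mu A = nu A.
  apply: lebesgue_measure_unique => X [[x y] _ /= <-].
  suff : mu `]x, y]%classic = (`|c|%:E * mu (phi @^-1` `]x, y]%classic))%E by [].
  have [c1|c1] := ltP 0 c.
  - have -> : phi @^-1` `]x, y] = `](x - b) / c, (y - b) / c]%classic.
      apply/seteqP; split => t /=; rewrite !in_itv/= /phi;
      by rewrite ltr_pdivrMr// ler_pdivlMr// ltrBlDr lerBrDr mulrC.
    rewrite !lebesgue_measure_itv/= !lte_fin ltr_pM2r ?invr_gt0// ltrD2r.
    case: ifPn => _; last by rewrite mule0.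
    by rewrite gtr0_norm// -!EFinD -EFinM; congr EFin; field.
  - have {}c1 : c < 0 by rewrite lt_neqAle c0.
    have -> : phi @^-1` `]x, y] = `[(y - b) / c, (x - b) / c[%classic.
      apply/seteqP; split => t /=; rewrite !in_itv/= /phi;
      by rewrite ler_ndivrMr// ltr_ndivlMr// ltrBlDr lerBrDr mulrC andbC.
    rewrite !lebesgue_measure_itv/= !lte_fin ltr_nM2r ?invr_lt0// ltrD2r.
    case: ifPn => _; last by rewrite mule0.
    by rewrite ltr0_norm// -!EFinD -EFinM; congr EFin; field.
rewrite /Rintegral; apply/esym; rewrite (@eq_measure_integral _ _ _ _ nu mu); last first.
  by move=> A mA _; exact: nuE.
rewrite /nu ge0_integral_mscale//=; first last.
- by move=> ? _; rewrite lee_fin.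
- exact/measurable_EFinP.
rewrite ge0_integral_pushforward//=; first last.
- by move=> ? _; rewrite lee_fin.
- exact/measurable_EFinP.
apply/esym; rewrite preimage_setT muleC.
have : (0 <= \int[mu]_x (f (c * x + b))%:E)%E.
  by apply: integral_ge0 => t _; rewrite lee_fin.
(* If the integral is infinite, [fine] turns both sides into 0. *)
case: (\int[mu]_x _)%E => [r|_|//] /=; first by rewrite mulrC.
by rewrite mulyr gtr0_sg ?normr_gt0// mul1e /= mulr0.
Qed.

(** A signed function is the difference of the non-negative [f + |f|] and [|f|]; the bounded support
    makes both integrable. *)
Lemma int1_affine K M (c b : R) f : c != 0 -> measurable_fun setT f ->
  bounded_supp K M f -> `|c| * int1 (fun t => f (c * t + b)) = int1 f.
Proof.
move=> c0 mf bf; have [fM fK] := bf.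
have mn : measurable_fun setT (fun t => `|f t|) by exact: measurableT_comp.
have mh : measurable_fun setT (fun t => f t + `|f t|) by exact: measurable_funD.
have bn : bounded_supp K M (fun t => `|f t|).
  by split=> t; [rewrite normr_id|move=> /fK ->; rewrite normr0].
have bh : bounded_supp K (M + M) (fun t => f t + `|f t|).
  split=> t; last by move=> /fK ->; rewrite normr0 addr0.
  by rewrite (le_trans (ler_normD _ _))// normr_id lerD.
have fE : f = (fun t => (f t + `|f t|) - `|f t|).
  by apply/funext => t; rewrite addrK.
have sub (g : R -> R) : (exists K', bounded_supp K' M g) -> measurable_fun setT g ->
    int1 g = int1 (fun t => g t + `|g t|) - int1 (fun t => `|g t|).
  move=> [K' [gM gK]] mg.
  rewrite -RintegralB//; first by congr Rintegral; apply/funext => t /=; rewrite addrK.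
  - apply: (@bounded_supp_integrable K' (M + M)).
      by apply: measurable_funD => //; exact: measurableT_comp.
    split=> t; last by move=> /gK ->; rewrite normr0 addr0.
    by rewrite (le_trans (ler_normD _ _))// normr_id lerD.
  - apply: (@bounded_supp_integrable K' M); first exact: measurableT_comp.
    by split=> t; [rewrite normr_id|move=> /gK ->; rewrite normr0].
have mphi : measurable_fun setT (fun t => c * t + b).
  by apply: measurable_funD => //; exact: measurable_funM.
rewrite (sub f)//; last by exists K.
rewrite (sub (fun t => f (c * t + b))).
- rewrite mulrBr -(ge0_int1_affine b c0 mh); last first.
    by move=> t; have := ler_norm (- f t); rewrite normrN; lra.
  by rewrite -(ge0_int1_affine b c0 mn).
- exists ((K + `|b|) / `|c|); split=> t //.
  rewrite ltr_pdivrMr ?normr_gt0// => Kt; apply: fK.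
  rewrite -(ltrD2r `|b|) (lt_le_trans Kt)// -normrM mulrC.
  have := ler_normB (c * t + b) b; rewrite addrK; apply.
- exact: measurableT_comp.
Qed.

End RealLine.

Section RowVectors.
Variable R : realType.

Lemma rV_coord_le n (x : 'rV[R]_n) i : `|x 0 i| <= `|x|.
Proof.
rewrite [leRHS]/Num.Def.normr /= mx_normrE.
exact: (le_bigmax _ (fun i : 'I_1 * 'I_n => `|x i.1 i.2|) (0, i)).
Qed.

Lemma rV_norm_le n (x : 'rV[R]_n) c : 0 <= c -> (forall i, `|x 0 i| <= c) -> `|x| <= c.
Proof.
move=> c0 xc; rewrite [leLHS]/Num.Def.normr /= mx_normrE.
by apply: bigmax_le => // -[i j] _ /=; rewrite ord1.
Qed.

(** The shape in which [intRn] supplies the first coordinate to its integrand. *)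
Definition vcons n (t : R) (v : 'rV[R]_n) : 'rV[R]_n.+1 :=
  row_mx (const_mx t : 'rV_1) v.

Lemma vcons_head n t (v : 'rV[R]_n) : vcons t v 0 0 = t.
Proof.
transitivity (row_mx (const_mx t : 'rV_1) v 0 (lshift n 0)).
  by congr (row_mx _ _ _ _); exact: val_inj.
by rewrite row_mxEl mxE.
Qed.

Lemma vcons_tail n t (v : 'rV[R]_n) i : vcons t v 0 (lift 0 i) = v 0 i.
Proof.
transitivity (row_mx (const_mx t : 'rV_1) v 0 (rshift 1 i)).
  by congr (row_mx _ _ _ _); exact: val_inj.
by rewrite row_mxEr.
Qed.

Definition vtail n (x : 'rV[R]_n.+1) : 'rV[R]_n := \row_i x 0 (lift 0 i).

Lemma vconsK n (x : 'rV[R]_n.+1) : vcons (x 0 0) (vtail x) = x.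
Proof.
apply/rowP => i; case: (unliftP 0 i) => [j ->|->]; last by rewrite vcons_head.
by rewrite vcons_tail mxE.
Qed.

Lemma vcons_affine n c t (v : 'rV[R]_n) (w : 'rV[R]_n.+1) :
  c *: vcons t v + w = vcons (c * t + w 0 0) (c *: v + vtail w).
Proof.
apply/rowP => i; rewrite [LHS]mxE [X in X + _]mxE.
case: (unliftP 0 i) => [j ->|->]; last by rewrite !vcons_head.
by rewrite !vcons_tail [RHS]mxE; congr (_ + _); rewrite mxE.
Qed.

Lemma vcons_norm n t (v : 'rV[R]_n) : `|vcons t v| <= Num.max `|t| `|v|.
Proof.
apply: rV_norm_le => [|i]; first by rewrite le_max normr_ge0.
rewrite le_max; case: (unliftP 0 i) => [j ->|->].
  by rewrite vcons_tail rV_coord_le orbT.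
by rewrite vcons_head lexx.
Qed.

Lemma vconsB n t s (v w : 'rV[R]_n) : vcons t v - vcons s w = vcons (t - s) (v - w).
Proof.
rewrite -[- vcons _ _]scaleN1r addrC vcons_affine vcons_head; congr vcons.
  by rewrite addrC mulN1r.
rewrite addrC scaleN1r; congr (_ - _); apply/rowP => i.
by rewrite [LHS]mxE vcons_tail.
Qed.

Lemma continuous_vconsr n t : continuous (@vcons n t).
Proof.
move=> v; apply/(@cvgrPdist_lt _ _ _ _ (nbhs_filter v)) => e e0; near=> w.
rewrite vconsB (le_lt_trans (vcons_norm _ _))// subrr normr0 gt_max e0 /=.
by near: w; have /(@cvgrPdist_lt _ _ _ _ (nbhs_filter v)) := @cvg_id _ (nbhs v); apply.
Unshelve. all: by end_near. Qed.

Lemma continuous_vconsl n (v : 'rV[R]_n) : continuous (fun t => vcons t v).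
Proof.
move=> t; apply/cvgrPdist_lt => e e0; near=> s.
rewrite vconsB (le_lt_trans (vcons_norm _ _))// subrr normr0 gt_max e0 andbT.
by near: s; have /cvgrPdist_lt := @cvg_id _ (nbhs t); apply.
Unshelve. all: by end_near. Qed.

End RowVectors.

Section IteratedIntegral.
Variable R : realType.
Notation mu := (@lebesgue_measure R).
Notation int1 f := (Rintegral mu setT f).

Lemma intRnS n (g : 'rV[R]_n.+1 -> R) :
  intRn g = int1 (fun t => intRn (g \o vcons t)).
Proof. by []. Qed.

(** Exactly the measurability that the iterated integral consumes: that of every partial integral,
    with the preceding coordinates frozen. *)
Fixpoint slice_measurable n : ('rV[R]_n -> R) -> Prop :=
  match n with
  | 0 => fun _ => True
  | n'.+1 => fun g => (forall t, slice_measurable (g \o @vcons R n' t)) /\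
      measurable_fun setT (fun t => intRn (g \o @vcons R n' t))
  end.

(* The domain of the iterated integral: [intRn] is total but linear and continuous only here. *)
Definition nice (K M : R) n (g : 'rV[R]_n -> R) :=
  [/\ (forall x, `|g x| <= M), (forall (x : 'rV[R]_n) i, K < `|x 0 i| -> g x = 0) &
      slice_measurable g].

Lemma nice_slice K M n (g : 'rV[R]_n.+1 -> R) t : nice K M g -> nice K M (g \o vcons t).
Proof.
move=> [gM gK [sg mg]]; split => [x|x i xK|]; [exact: gM| |exact: sg].
by apply: (gK _ (lift 0 i)); rewrite vcons_tail.
Qed.

Lemma int1_indic (a b : R) : a <= b -> int1 (\1_(`[a, b] : set R)) = b - a.
Proof.
move=> ab; transitivity (fine (mu `[a, b]%classic)).
  by rewrite /Rintegral integral_indic// setIT.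
rewrite lebesgue_measure_itv/= lte_fin; case: ltP => [_ //|ba].
by apply/esym/eqP; rewrite subr_eq0 eq_le ab ba.
Qed.

Lemma int1_bound (K M : R) (f : R -> R) : 0 <= K -> measurable_fun setT f ->
  bounded_supp K M f -> `|int1 f| <= M * (2 * K).
Proof.
move=> K0 mf bf; have [fM fK] := bf.
have M0 : 0 <= M by apply: le_trans (normr_ge0 _) (fM 0).
pose G : R -> R := fun t => M * \1_(`[- K, K] : set R) t.
have mG : measurable_fun setT G.
  by apply: measurable_funM => //; exact: measurable_indic.
have bG : bounded_supp K M G.
  split=> t; rewrite /G indicE.
    by case: (t \in _); rewrite ?mulr1 ?mulr0 ?normr0 // ger0_norm.
  move=> Kt; rewrite memNset ?mulr0//= in_itv/= => /andP[a b].
  by move: Kt; rewrite ltNge ler_norml a b.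
have iE : int1 G = M * (2 * K).
  rewrite /G RintegralZl//; last first.
    exact: integrable_indic_itv.
  by congr (_ * _); rewrite int1_indic; lra.
rewrite -iE (le_trans (le_normr_Rintegral _ _))//.
  exact: bounded_supp_integrable bf.
apply: le_Rintegral => //.
- apply: (@bounded_supp_integrable _ K M); first exact: measurableT_comp.
  by split=> t; [rewrite normr_id|move=> /fK ->; rewrite normr0].
- exact: bounded_supp_integrable bG.
- move=> t _; rewrite /G indicE; have [tK|tK] := boolP (t \in _); first by rewrite mulr1.
  rewrite fK ?normr0 ?mulr0// ltNge; apply: contraNN tK => tK.
  by rewrite inE/= in_itv/= -ler_norml.
Qed.

Lemma intRn0 n : intRn (fun _ : 'rV[R]_n => 0) = 0.
Proof.
elim: n => // n IH; rewrite intRnS.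
rewrite (_ : (fun t => _) = cst 0) ?Rintegral_cst ?mul0r//.
by apply/funext => t; exact: IH.
Qed.

Lemma nice_bound (K M : R) n (g : 'rV[R]_n -> R) : 0 <= K -> nice K M g ->
  `|intRn g| <= M * (2 * K) ^+ n.
Proof.
move=> K0; elim: n g => [|n IH] g ng.
  by have [gM _ _] := ng; rewrite expr0 mulr1; exact: gM.
have [gM gK [sg mg]] := ng.
rewrite intRnS exprSr [leRHS]mulrA; apply: int1_bound => //; split => t.
  exact/IH/nice_slice.
move=> tK; rewrite (_ : _ \o _ = fun=> 0) ?intRn0//.
by apply/funext => v /=; apply: (gK _ 0); rewrite vcons_head.
Qed.

Lemma nice_slice_supp (K M : R) n (g : 'rV[R]_n.+1 -> R) : 0 <= K -> nice K M g ->
  bounded_supp K (M * (2 * K) ^+ n) (fun t => intRn (g \o vcons t)).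
Proof.
move=> K0 ng; split => t; first exact/nice_bound/nice_slice.
move=> tK; rewrite (_ : _ \o _ = fun=> 0) ?intRn0//.
by have [_ gK _] := ng; apply/funext => v /=; apply: (gK _ 0); rewrite vcons_head.
Qed.

(** Induction on the dimension: the partial integrals converge by the induction hypothesis, are
    uniformly bounded by [nice_slice_supp], and one-dimensional dominated convergence finishes.
    Niceness of the limit is proved along with it because the measurability of the partial integrals
    of [f] comes from that convergence. *)
Lemma nice_dct (K M : R) n (g : nat -> 'rV[R]_n -> R) f : 0 <= K ->
  (forall k, nice K M (g k)) -> (forall x, g k x @[k --> \oo] --> f x) ->
  nice K M f /\ intRn (g k) @[k --> \oo] --> intRn f.
Proof.
move=> K0; elim: n g f => [|n IH] g f ng gf.
  split; last exact: gf.
  split=> // [x|? []//].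
  apply: (cvgr_to_le (cvg_norm (gf x))); apply: nearW => k.
  by case: (ng k).
have IHt t := IH (fun k => g k \o vcons t) (f \o vcons t)
  (fun k => nice_slice t (ng k)) (fun v => gf _).
have mg k : measurable_fun setT (fun t => intRn (g k \o vcons t)).
  by case: (ng k) => _ _ [].
split; first split.
- move=> x; apply: (cvgr_to_le (cvg_norm (gf x))); apply: nearW => k.
  by case: (ng k).
- move=> x i xK; have := gf x; rewrite (_ : (fun k => _) = cst 0); last first.
    by apply/funext => k; case: (ng k) => _ /(_ x i xK).
  by move=> /cvg_lim <- //; rewrite lim_cst.
- split=> [t|]; first by case: (IHt t).1.
  by apply: (measurable_fun_cvg mg) => t _; exact: (IHt t).2.
rewrite intRnS; under eq_fun do rewrite intRnS.
apply: (int1_dct mg) => [k|t]; first exact: nice_slice_supp (ng k).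
exact: (IHt t).2.
Qed.

Lemma continuous_nice (K M : R) n (g : 'rV[R]_n -> R) : 0 <= K -> continuous g ->
  (forall x, `|g x| <= M) -> (forall (x : 'rV[R]_n) i, K < `|x 0 i| -> g x = 0) -> nice K M g.
Proof.
move=> K0; elim: n g => [|n IH] g cg gM gK; first by split.
have nt t : nice K M (g \o vcons t).
  apply: IH => [x|x|x i xK]; last by apply: (gK _ (lift 0 i)); rewrite vcons_tail.
    by apply: continuous_comp; [exact: continuous_vconsr|exact: cg].
  exact: gM.
split=> //; split=> [t|]; first by case: (nt t).
apply: continuous_measurable_fun => t.
(* Continuity of the partial integral is tested on sequences, where [nice_dct] applies to the
   slices. *)
apply/(@cvg_nbhsP R R^o) => u ut.
apply: (nice_dct K0 (fun k => nt (u k)) _).2 => v /=.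
apply: (@continuous_cvg _ _ _ _ _ u (fun t => g (vcons t v)) t _ ut).
by apply: (@continuous_comp _ _ _ (fun t => vcons t v) g); [exact: continuous_vconsl|exact: cg].
Qed.

Lemma nice_weaken K M K' M' n (g : 'rV[R]_n -> R) :
  K <= K' -> M <= M' -> nice K M g -> nice K' M' g.
Proof.
move=> KK MM [gM gK sg]; split=> // [x|x i xK].
  exact: le_trans (gM x) MM.
by apply: (gK x i); exact: le_lt_trans xK.
Qed.

Lemma nice_lin (K M M' : R) n (a : R) (f g : 'rV[R]_n -> R) : 0 <= K ->
  nice K M f -> nice K M' g ->
  nice K (`|a| * M + M') (fun x => a * f x + g x) /\
  intRn (fun x => a * f x + g x) = a * intRn f + intRn g.
Proof.
move=> K0; elim: n f g => [|n IH] f g nf ng.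
  split=> //; split=> // [x|? []//]; have [fM _ _] := nf; have [gM _ _] := ng.
  by rewrite (le_trans (ler_normD _ _))// normrM lerD// ler_wpM2l.
have IHt t := IH _ _ (nice_slice t nf) (nice_slice t ng).
have [fM fK [sf mf]] := nf; have [gM gK [sg mg]] := ng.
have E : (fun t => intRn ((fun x => a * f x + g x) \o vcons t)) =
   (fun t => a * intRn (f \o vcons t) + intRn (g \o vcons t)).
  by apply/funext => t; rewrite -(IHt t).2.
have i_f := bounded_supp_integrable mf (nice_slice_supp K0 nf).
have i_g := bounded_supp_integrable mg (nice_slice_supp K0 ng).
split; first split.
- by move=> x; rewrite (le_trans (ler_normD _ _))// normrM lerD// ler_wpM2l.
- by move=> x i xK; rewrite (fK x i xK) (gK x i xK) mulr0 addr0.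
- split=> [t|]; first by case: (IHt t).1.
  by rewrite E; apply: measurable_funD => //; exact: measurable_funM.
rewrite !intRnS E RintegralD//; last first.
  by rewrite (_ : EFin \o _ = fun t => (a%:E * (intRn (f \o vcons t))%:E)%E)//; exact: integrableZl.
by rewrite RintegralZl.
Qed.

Lemma intRn_ge0 n (g : 'rV[R]_n -> R) : (forall x, 0 <= g x) -> 0 <= intRn g.
Proof.
elim: n g => [|n IH] g g0; first exact: g0.
by apply: Rintegral_ge0 => t _; exact: IH.
Qed.

(** Change of variables one coordinate at a time; the new support radius comes from
    [|c x_i| <= |c x_i + w_i| + |w|]. *)
Lemma nice_affine (K M : R) n c w (g : 'rV[R]_n -> R) : 0 <= K -> c != 0 -> nice K M g ->
  nice ((K + `|w|) / `|c|) M (fun x => g (c *: x + w)) /\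
  `|c| ^+ n * intRn (fun x => g (c *: x + w)) = intRn g.
Proof.
move=> K0 c0; elim: n w g => [|n IH] w g ng.
  split; last by rewrite expr0 mul1r /=; congr g; apply/rowP => -[].
  by have [gM _ _] := ng; split=> // ? [].
have [gM gK [sg mg]] := ng.
have E t : (fun x => g (c *: x + w)) \o vcons t =
    fun v => (g \o vcons (c * t + w 0 0)) (c *: v + vtail w).
  by apply/funext => v /=; rewrite vcons_affine.
have IHt t := IH (vtail w) _ (nice_slice (c * t + w 0 0) ng).
have E2 : (fun t => intRn ((fun x => g (c *: x + w)) \o vcons t)) =
   (fun t => `|c| ^- n * intRn (g \o vcons (c * t + w 0 0))).
  apply/funext => t; rewrite -(IHt t).2 E mulKf//.
  by rewrite expf_neq0// normr_eq0.
split; first split => //.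
- move=> x i; rewrite ltr_pdivrMr ?normr_gt0// => xK; apply: (gK _ i).
  rewrite !mxE -(ltrD2r `|w|) (lt_le_trans xK)// mulrC -normrM.
  rewrite -{1}[c * _](addrK (w 0 i)) (le_trans (ler_normB _ _))// lerD2l.
  exact: rV_coord_le.
- split=> [t|].
    rewrite E; case: (IHt t).1 => _ _; apply.
  rewrite E2; apply: measurable_funM => //.
  apply: (measurableT_comp mg).
  by apply: measurable_funD => //; exact: measurable_funM.
rewrite !intRnS E2 -(int1_affine (w 0 0) c0 mg (nice_slice_supp K0 ng)).
rewrite RintegralZl//; last first.
  apply: (@bounded_supp_integrable _ ((K + `|w 0 0|) / `|c|) (M * (2 * K) ^+ n)).
    apply: (measurableT_comp mg).
    by apply: measurable_funD => //; exact: measurable_funM.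
  have [bM bK] := nice_slice_supp K0 ng; split=> t; first exact: bM.
  rewrite ltr_pdivrMr ?normr_gt0// => tK; apply: bK.
  rewrite -(ltrD2r `|w 0 0|) (lt_le_trans tK)// mulrC -normrM.
  by rewrite -{1}[c * _](addrK (w 0 0)) (le_trans (ler_normB _ _)).
by rewrite exprS -mulrA mulVKf// expf_neq0// normr_eq0.
Qed.

Lemma int1_gt0 K M (f : R -> R) t0 : measurable_fun setT f -> bounded_supp K M f ->
  (forall t, 0 <= f t) -> 0 < f t0 -> {for t0, continuous f} -> 0 < int1 f.
Proof.
move=> mf bf f0 ft0 cf.
have /cvgrPdist_lt/(_ _ (divr_gt0 ft0 (ltr0n _ 2)))/nbhs_ballP[e /= e0 He] := cf.
pose G : R -> R := fun t => (f t0 / 2) * \1_(`[t0 - e / 2, t0 + e / 2] : set R) t.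
have iI := integrable_indic_itv (t0 - e / 2) (t0 + e / 2) true false.
apply: (@lt_le_trans _ _ (int1 G)).
  rewrite /G RintegralZl//.
  by rewrite int1_indic ?mulr_gt0 ?divr_gt0//; lra.
apply: le_Rintegral => //.
- by rewrite (_ : EFin \o _ = fun t => ((f t0 / 2)%:E * (\1_(`[t0 - e / 2, t0 + e / 2] : set R) t)%:E)%E)//; exact: integrableZl.
- exact: bounded_supp_integrable bf.
move=> t _; rewrite /G indicE; have [tK|tK] := boolP (t \in _); last by rewrite mulr0.
move: tK; rewrite inE/= in_itv/= => /andP[t1 t2].
have /He : ball t0 e t by rewrite /ball/= distrC ltr_norml; lra.
by rewrite mulr1 /= ltr_norml; lra.
Qed.

Lemma intRn_gt0 (K M : R) n (g : 'rV[R]_n -> R) x0 : 0 <= K -> continuous g -> nice K M g ->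
  (forall x, 0 <= g x) -> 0 < g x0 -> 0 < intRn g.
Proof.
move=> K0; elim: n g x0 => [|n IH] g x0 cg ng g0 gx0.
  by rewrite /= (_ : 0 = x0)//; apply/rowP => -[].
have [gM gK [sg mg]] := ng.
have nt t := nice_slice t ng.
apply: (int1_gt0 mg (nice_slice_supp K0 ng) (t0 := x0 0 0)).
- by move=> t; apply: intRn_ge0 => v; exact: g0.
- apply: (IH (g \o vcons (x0 0 0)) (vtail x0)) => //=.
  + by move=> x; apply: continuous_comp; [exact: continuous_vconsr|exact: cg].
  + by rewrite /= vconsK.
apply/(@cvg_nbhsP R R^o) => u ut.
apply: (nice_dct K0 (fun k => nt (u k)) _).2 => v /=.
apply: (@continuous_cvg _ _ _ _ _ u (fun t => g (vcons t v)) (x0 0 0) _ ut).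
by apply: (@continuous_comp _ _ _ (fun t => vcons t v) g); [exact: continuous_vconsl|exact: cg].
Qed.

End IteratedIntegral.

(** * Directional derivatives and homogeneous polynomials *)

Section DirectionalDerivative.
Variables (R : realType) (V : normedModType R).
Implicit Types (f g : V -> R) (x v : V).

Lemma continuous_atP f x : {for x, continuous f} <->
  forall e, 0 < e -> exists2 r, 0 < r & forall y, `|y - x| < r -> `|f y - f x| < e.
Proof.
split=> [/cvgrPdist_lt cf e /cf /nbhs_ballP[r /= r0 H]|H].
  exists r => // y yx; rewrite distrC; apply: H.
  by rewrite -ball_normE /ball_/= distrC.
apply/cvgrPdist_lt => e /H[r r0 {}H]; apply/nbhs_ballP; exists r => //= y.
by rewrite -ball_normE /ball_/= => yx; rewrite distrC; apply: H; rewrite distrC.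
Qed.

Lemma is_deriveP f x v (L : R) : is_derive x v f L <->
  forall e, 0 < e -> exists2 r, 0 < r &
    forall h : R, `|h| < r -> `|f (h *: v + x) - f x - h * L| <= e * `|h|.
Proof.
have E (h e : R) : h != 0 -> 0 < e -> (`|L - h^-1 *: (f (h *: v + x) - f x)| <= e) =
    (`|f (h *: v + x) - f x - h * L| <= e * `|h|).
  move=> h0 e0; rewrite -ler_pdivrMr ?normr_gt0// -normf_div distrC.
  by congr (`|_| <= _); rewrite mulrBl [h * L]mulrC mulfK// mulrC.
split=> [[df dfE] e e0|H].
- have : h^-1 *: (f (h *: v + x) - f x) @[h --> 0^'] --> L.
    by rewrite -dfE; exact: df.
  move=> /cvgrPdist_le/(_ _ e0)/nbhs_ballP[r /= r0 H].
  exists r => // h hr; have [->|h0] := eqVneq h 0.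
    by rewrite scale0r add0r subrr mul0r subrr normr0 mulr0.
  by rewrite -E//; apply: H => //; rewrite /ball/= sub0r normrN.
- have dfL : h^-1 *: (f (h *: v + x) - f x) @[h --> 0^'] --> L.
    apply/cvgrPdist_le => e e0; have [r r0 {}H] := H _ e0.
    apply/nbhs_ballP; exists r => //= h; rewrite /ball/= sub0r normrN => hr h0.
    by rewrite E//; exact: H.
  apply: DeriveDef; first by apply/cvg_ex; exists L.
  exact/cvg_lim.
Qed.

(** The criterion for explicit formulas: a quadratic error bound is checked by algebra alone. *)
Lemma is_derive_quadratic f x v (L C r : R) : 0 < r ->
  (forall h : R, `|h| < r -> `|f (h *: v + x) - f x - h * L| <= C * `|h| ^+ 2) ->
  is_derive x v f L.
Proof.
move=> r0 H; apply/is_deriveP => e e0.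
have C0 : 0 < `|C| + 1 by rewrite ltr_wpDl.
exists (Num.min r (e / (`|C| + 1))); first by rewrite lt_min r0 divr_gt0.
move=> h; rewrite lt_min => /andP[hr he]; apply: le_trans (H h hr) _.
rewrite expr2 mulrA ler_wpM2r//.
rewrite ltr_pdivlMr// mulrC in he; apply: le_trans (ltW he).
by rewrite ler_wpM2r// (le_trans (ler_norm _))// lerDl.
Qed.

Lemma is_derive_near f g x v (L : R) : (\forall y \near x, f y = g y) ->
  is_derive x v f L -> is_derive x v g L.
Proof.
move=> /nbhs_ballP[s /= s0 fg] /is_deriveP H; apply/is_deriveP => e e0.
have [r r0 {}H] := H e e0.
have v0 : 0 < `|v| + 1 by rewrite ltr_wpDl.
exists (Num.min r (s / (`|v| + 1))); first by rewrite lt_min r0 divr_gt0.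
move=> h; rewrite lt_min => /andP[hr hs]; rewrite -!fg; first exact: H.
  exact: ballxx.
rewrite -ball_normE /ball_/= opprD addrCA subrr addr0 normrN normrZ.
rewrite ltr_pdivlMr// in hs; apply: le_lt_trans hs.
by rewrite ler_wpM2l// lerDl.
Qed.

Lemma derive_near f g x v : (\forall y \near x, f y = g y) -> 'D_v f x = 'D_v g x.
Proof.
move=> fg; rewrite /derive; congr (lim _); apply/seteqP.
have E (F G : V -> R) : (\forall y \near x, F y = G y) ->
    \forall h \near (0 : R)^', h^-1 *: (F (h *: v + x) - F x) = h^-1 *: (G (h *: v + x) - G x).
  move=> FG; have fgx := nbhs_singleton FG.
  have : h *: v + x @[h --> (0:R)^'] --> x.
    rewrite -[X in _ --> X](add0r x); apply: cvgD; last exact: cvg_cst.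
    rewrite -[X in _ --> X](scale0r v); apply: cvgZr_tmp; exact: cvg_within.
  move=> /(_ _ FG); rewrite /nbhs/=; apply: filterS => h /= ->.
  by rewrite fgx.
split; apply: near_eq_cvg; apply: E => //.
by apply: filterS fg => y ->.
Qed.

Lemma derivable_near f g x v : (\forall y \near x, f y = g y) ->
  derivable f x v -> derivable g x v.
Proof. by move=> fg /derivableP /(is_derive_near fg) []. Qed.

Lemma is_derive_line f x v (t L : R) : is_derive (t *: v + x) v f L <->
  is_derive t 1 (fun s : R => f (s *: v + x)) L.
Proof.
have E (h : R) : f (h *: v + (t *: v + x)) = f ((h *: (1 : R) + t) *: v + x).
  by rewrite [h *: 1]mulr1 scalerDl addrA.
split=> [/is_deriveP H|H].
- suff H' : h^-1 *: (f ((h *: (1 : R) + t) *: v + x) - f (t *: v + x)) @[h --> (0:R)^'] --> L.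
    by apply: DeriveDef; [apply/cvg_ex; exists L|exact/cvg_lim].
  have [df <-] : is_derive (t *: v + x) v f L by exact/is_deriveP.
  by under eq_fun do rewrite -E.
- suff H' : h^-1 *: (f (h *: v + (t *: v + x)) - f (t *: v + x)) @[h --> (0:R)^'] --> L.
    by apply: DeriveDef; [apply/cvg_ex; exists L|exact/cvg_lim].
  by case: H => df <-; under eq_fun do rewrite E.
Qed.

Lemma line_mvt f v x (r : R) : 0 <= r -> (forall t, 0 <= t <= r -> derivable f (t *: v + x) v) ->
  exists2 t, 0 <= t <= r & f (r *: v + x) - f x = 'D_v f (t *: v + x) * r.
Proof.
move=> r0 df.
have dphi t : 0 <= t <= r ->
    is_derive t 1 (fun s : R => f (s *: v + x)) ('D_v f (t *: v + x)).
  by move=> tr; apply/is_derive_line/derivableP/df.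
have [||c] := @MVT_segment R (fun s : R => f (s *: v + x)) (fun s => 'D_v f (s *: v + x)) 0 r r0.
- by move=> t; rewrite in_itv/= => /andP[t0 tr]; apply: dphi; rewrite !ltW.
- apply: derivable_within_continuous => t; rewrite in_itv/= => tr.
  by case: (dphi t tr).
by rewrite in_itv/= scale0r add0r subr0 => cr E; exists c.
Qed.

End DirectionalDerivative.

Section Geometry.
Variables (R : realType) (d : nat).
Local Notation V := 'rV[R]_d.
Implicit Types (x y a b v : V).

Lemma dotpC x y : dotp x y = dotp y x.
Proof. by apply: eq_bigr => i _; rewrite mulrC. Qed.

Lemma dotpDl x y v : dotp (x + y) v = dotp x v + dotp y v.
Proof. by rewrite /dotp -big_split/=; apply: eq_bigr => i _; rewrite mxE mulrDl. Qed.

Lemma dotpZl (c : R) x v : dotp (c *: x) v = c * dotp x v.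
Proof. by rewrite /dotp mulr_sumr; apply: eq_bigr => i _; rewrite mxE mulrA. Qed.

Lemma dotpDr x y v : dotp v (x + y) = dotp v x + dotp v y.
Proof. by rewrite dotpC dotpDl !(dotpC v). Qed.

Lemma dotpZr (c : R) x v : dotp v (c *: x) = c * dotp v x.
Proof. by rewrite dotpC dotpZl dotpC. Qed.

Lemma dotpNl x v : dotp (- x) v = - dotp x v.
Proof. by rewrite -scaleN1r dotpZl mulN1r. Qed.

Lemma dotpNr x v : dotp v (- x) = - dotp v x.
Proof. by rewrite dotpC dotpNl dotpC. Qed.

Lemma dotp0l v : dotp 0 v = 0.
Proof. by rewrite -(scale0r v) dotpZl mul0r. Qed.

Lemma dotp_ge0 x : 0 <= dotp x x.
Proof. by apply: sumr_ge0 => i _; rewrite -expr2 sqr_ge0. Qed.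

Lemma dotpxx_eq0 x : (dotp x x == 0) = (x == 0).
Proof.
apply/idP/eqP => [|->]; last by rewrite dotp0l.
rewrite psumr_eq0; last by move=> i _; rewrite -expr2 sqr_ge0.
move=> /allP H; apply/rowP => i; rewrite mxE.
by have := H i (mem_index_enum i); rewrite -expr2 sqrf_eq0 => /eqP.
Qed.

Lemma dotp_gt0 x : x != 0 -> 0 < dotp x x.
Proof. by move=> x0; rewrite lt_neqAle dotp_ge0 eq_sym dotpxx_eq0 x0. Qed.

Lemma enorm_sqr x : enorm x ^+ 2 = dotp x x.
Proof. by rewrite sqr_sqrtr ?dotp_ge0. Qed.

Lemma enorm_ge0 x : 0 <= enorm x.
Proof. exact: sqrtr_ge0. Qed.

Lemma enorm0 : enorm (0 : V) = 0.
Proof. by rewrite /enorm dotp0l sqrtr0. Qed.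

Lemma enormZ (c : R) x : enorm (c *: x) = `|c| * enorm x.
Proof. by rewrite /enorm dotpZl dotpZr mulrA -expr2 sqrtrM ?sqr_ge0// sqrtr_sqr. Qed.

Lemma enorm_eq0 x : (enorm x == 0) = (x == 0).
Proof. by rewrite -dotpxx_eq0 -enorm_sqr sqrf_eq0. Qed.

Lemma enorm_gt0 x : (0 < enorm x) = (x != 0).
Proof. by rewrite lt_neqAle enorm_ge0 andbT eq_sym enorm_eq0. Qed.

Lemma coord_le_enorm x i : `|x 0 i| <= enorm x.
Proof.
rewrite -(ler_pXn2r (n := 2))// ?nnegrE ?enorm_ge0// enorm_sqr real_normK ?num_real//.
rewrite /dotp (bigD1 i)//= -expr2 lerDl.
by apply: sumr_ge0 => j _; rewrite -expr2 sqr_ge0.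
Qed.

Lemma norm_le_enorm x : `|x| <= enorm x.
Proof. by apply: rV_norm_le => [|i]; [exact: enorm_ge0|exact: coord_le_enorm]. Qed.

Lemma enorm_le_norm x : enorm x <= d%:R * `|x|.
Proof.
rewrite -(ler_pXn2r (n := 2))// ?nnegrE ?enorm_ge0 ?mulr_ge0// enorm_sqr exprMn.
apply: (@le_trans _ _ (\sum_(i < d) `|x| ^+ 2)).
  apply: ler_sum => i _; rewrite -expr2 -[leLHS]real_normK ?num_real//.
  by rewrite ler_pXn2r ?nnegrE// rV_coord_le.
have -> : \sum_(i < d) `|x| ^+ 2 = d%:R * `|x| ^+ 2 by rewrite sumr_const card_ord mulr_natl.
apply: ler_wpM2r; first exact: sqr_ge0.
(* The crude [d <= d ^ 2] replaces the sharp constant, the square root of [d]. *)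
by rewrite -natrX ler_nat; case: (d) => // n; rewrite -{1}[n.+1]muln1 leq_mul.
Qed.

Lemma cauchy_schwarz x y : dotp x y ^+ 2 <= dotp x x * dotp y y.
Proof.
have [->|x0] := eqVneq x 0; first by rewrite !dotp0l mul0r expr0n.
have := dotp_ge0 (dotp x x *: y - dotp x y *: x).
rewrite !(dotpDl, dotpDr, dotpZl, dotpZr, dotpNl, dotpNr) (dotpC y x).
rewrite [X in 0 <= X](_ : _ = dotp x x * (dotp x x * dotp y y - dotp x y ^+ 2)); last by ring.
by rewrite pmulr_rge0 ?dotp_gt0// subr_ge0.
Qed.

(** Uses [|(1 - t) x + t y|^2 = (1 - t) |x|^2 + t |y|^2 - t (1 - t) |x - y|^2]. *)
Lemma enorm_convex x y (t : R) rho : 0 <= t <= 1 -> enorm x < rho -> enorm y < rho ->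
  enorm ((1 - t) *: x + t *: y) < rho.
Proof.
move=> /andP[t0 t1] xr yr.
have r0 : 0 < rho by apply: le_lt_trans (enorm_ge0 x) xr.
have sq (u : V) : (enorm u < rho) = (dotp u u < rho ^+ 2).
  by rewrite -enorm_sqr ltr_pXn2r ?nnegrE ?enorm_ge0// ltW.
move: xr yr; rewrite !sq => xr yr.
have := dotp_ge0 (x - y).
rewrite !(dotpDl, dotpDr, dotpZl, dotpZr, dotpNl, dotpNr) (dotpC y x) => xy.
have H : 0 <= t * (1 - t) * (dotp x x - dotp x y - (dotp x y - dotp y y)).
  by rewrite !mulr_ge0 ?subr_ge0//; lra.
have tx : (1 - t) * dotp x x <= (1 - t) * rho ^+ 2 by rewrite ler_wpM2l ?subr_ge0// ltW.
have ty : t * dotp y y <= t * rho ^+ 2 by rewrite ler_wpM2l// ltW.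
have [->|tn] := eqVneq t 0; first by rewrite subr0 !mul0r !mul1r !addr0.
have {}ty : t * dotp y y < t * rho ^+ 2 by rewrite ltr_pM2l// lt_neqAle eq_sym tn.
by nra.
Qed.

Lemma reflE a x i : refl a x 0 i = x 0 i - (2 * dotp a x / dotp a a) * a 0 i.
Proof. by rewrite !mxE. Qed.

Lemma dotp_refl_same a x : dotp a (refl a x) = - dotp a x.
Proof.
have [->|a0] := eqVneq a 0; first by rewrite !dotp0l oppr0.
rewrite dotpDr dotpNr dotpZr; field.
by rewrite dotpxx_eq0.
Qed.

Lemma dotp_refl a x y : dotp (refl a x) (refl a y) = dotp x y.
Proof.
have [->|a0] := eqVneq a 0.
  by rewrite /refl !scaler0 !subr0.
rewrite {2}/refl dotpDr dotpNr dotpZr (dotpC _ a) dotp_refl_same.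
rewrite {1}/refl dotpDl dotpNl dotpZl; field.
by rewrite dotpxx_eq0.
Qed.

Lemma reflD a x y : refl a (x + y) = refl a x + refl a y.
Proof.
apply/rowP => i; rewrite !(reflE, mxE) dotpDr.
by ring.
Qed.

Lemma reflZ a (c : R) x : refl a (c *: x) = c *: refl a x.
Proof. by apply/rowP => i; rewrite !(reflE, mxE) dotpZr; ring. Qed.

Lemma reflN a x : refl a (- x) = - refl a x.
Proof. by rewrite -scaleN1r reflZ scaleN1r. Qed.

Lemma reflK a : involutive (@refl R d a).
Proof.
move=> x; apply/rowP => i; rewrite !reflE dotp_refl_same.
by ring.
Qed.

Lemma refl_sym a x y : dotp (refl a x) y = dotp x (refl a y).
Proof. by rewrite -{1}[y](reflK a) dotp_refl. Qed.

Lemma enorm_refl a x : enorm (refl a x) = enorm x.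
Proof. by rewrite /enorm dotp_refl. Qed.

Lemma refl_opp a : @refl R d (- a) = refl a.
Proof.
apply/funext => x; apply/rowP => i; rewrite !reflE mxE !(dotpNl, dotpNr) opprK.
by ring.
Qed.

Lemma refl_self a : refl a a = - a.
Proof.
have [->|a0] := eqVneq a 0; first by rewrite /refl scaler0 subr0 oppr0.
apply/rowP => i; rewrite reflE mxE; field.
by rewrite dotpxx_eq0.
Qed.

Lemma refl_fix a x : dotp a x = 0 -> refl a x = x.
Proof. by move=> ax; rewrite /refl ax mulr0 mul0r scale0r subr0. Qed.

Lemma refl_conj a b x : refl a (refl b x) = refl (refl a b) (refl a x).
Proof.
rewrite {2}/refl reflD reflN reflZ [in RHS]/refl.
by rewrite !dotp_refl.
Qed.

Lemma dotp_delta x i : dotp (delta_mx 0 i) x = x 0 i.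
Proof.
rewrite /dotp (bigD1 i)//= mxE !eqxx mul1r big1 ?addr0// => j ji.
by rewrite mxE (negbTE ji) mul0r.
Qed.

Lemma rV_sum_delta x : x = \sum_i x 0 i *: delta_mx 0 i.
Proof. exact: row_sum_delta. Qed.

End Geometry.

(** * Homogeneous polynomials as functions, with coefficient bounds *)

Section HomogeneousPolynomials.
Variables (R : realType) (d : nat).
Local Notation V := 'rV[R]_d.
Implicit Types (f g : V -> R) (x v a : V).

(* [M] bounds the sum of the absolute values of the coefficients. *)
Inductive hpb : nat -> R -> (V -> R) -> Prop :=
| hpb_const c : hpb 0 `|c| (fun=> c)
| hpb_mulx k M i f : hpb k M f -> hpb k.+1 M (fun x => x 0 i * f x)
| hpb_add k M N f g : hpb k M f -> hpb k N g -> hpb k (M + N) (fun x => f x + g x)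
| hpb_zero k : hpb k 0 (fun=> 0)
| hpb_weaken k M N f : M <= N -> hpb k M f -> hpb k N f.

Lemma hpb_ge0 k M f : hpb k M f -> 0 <= M.
Proof.
elim=> // [k' M' N f' g _ M0 _ N0|k' M' N f' MN _ M0]; first exact: addr_ge0.
exact: le_trans M0 MN.
Qed.

Lemma hpb_le k M f x : hpb k M f -> `|f x| <= M * `|x| ^+ k.
Proof.
elim=> {k M f}.
- by move=> c; rewrite expr0 mulr1.
- move=> k M i f hf IH; rewrite normrM exprS mulrCA ler_pM//.
  exact: rV_coord_le.
- move=> k M N f g _ If _ Ig; rewrite mulrDl.
  by rewrite (le_trans (ler_normD _ _))// lerD.
- by move=> k; rewrite normr0 mul0r.
- by move=> k M N f MN _ /le_trans; apply; rewrite ler_wpM2r// exprn_ge0.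
Qed.

Lemma hpb_scale k M f (c : R) : hpb k M f -> hpb k (`|c| * M) (fun x => c * f x).
Proof.
elim=> {k M f}.
- by move=> b; rewrite -normrM; exact: hpb_const.
- move=> k M i f _ IH; rewrite (_ : (fun _ => _) = (fun x => x 0 i * (c * f x))).
    exact: hpb_mulx.
  by apply/funext => x; rewrite mulrCA.
- move=> k M N f g _ If _ Ig; rewrite mulrDr.
  rewrite (_ : (fun _ => _) = (fun x => c * f x + c * g x)); first exact: hpb_add.
  by apply/funext => x; rewrite mulrDr.
- move=> k; rewrite mulr0 (_ : (fun _ => _) = (fun _ => 0)); first exact: hpb_zero.
  by apply/funext => x; rewrite mulr0.
- move=> k M N f MN _; apply: hpb_weaken.
  by rewrite ler_wpM2l.
Qed.

Definition hp k f := exists M, hpb k M f.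

Lemma hp_const c : hp 0 (fun=> c). Proof. by exists `|c|; exact: hpb_const. Qed.
Lemma hp_zero k : hp k (fun=> 0). Proof. by exists 0; exact: hpb_zero. Qed.
Lemma hp_mulx k i f : hp k f -> hp k.+1 (fun x => x 0 i * f x).
Proof. by move=> [M hf]; exists M; exact: hpb_mulx. Qed.
Lemma hp_add k f g : hp k f -> hp k g -> hp k (fun x => f x + g x).
Proof. by move=> [M hf] [N hg]; exists (M + N); exact: hpb_add. Qed.
Lemma hp_scale k (c : R) f : hp k f -> hp k (fun x => c * f x).
Proof. by move=> [M hf]; exists (`|c| * M); exact: hpb_scale. Qed.

(** The coefficient bound is forgotten here, so the weakening rule leaves no case. *)
Lemma hp_induction (P : nat -> (V -> R) -> Prop) :
  (forall c, P 0%N (fun=> c)) ->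
  (forall k i f, hp k f -> P k f -> P k.+1 (fun x => x 0 i * f x)) ->
  (forall k f g, hp k f -> P k f -> hp k g -> P k g -> P k (fun x => f x + g x)) ->
  (forall k, P k (fun=> 0)) ->
  forall k f, hp k f -> P k f.
Proof.
move=> Pc Pm Pa Pz k f [M]; elim=> {k M f} //.
- by move=> k M i f hf; apply: Pm; exists M.
- by move=> k M N f g hf Pf hg Pg; apply: Pa => //; [exists M|exists N].
Qed.

Lemma hp_sub k f g : hp k f -> hp k g -> hp k (fun x => f x - g x).
Proof.
move=> hf /(hp_scale (-1)) hg; rewrite (_ : (fun _ => _) = (fun x => f x + -1 * g x)).
  exact: hp_add.
by apply/funext => x; rewrite mulN1r.
Qed.

Lemma hp_sum k (I : Type) (r : seq I) (F : I -> V -> R) : (forall i, hp k (F i)) ->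
  hp k (fun x => \sum_(i <- r) F i x).
Proof.
move=> hF; elim: r => [|i r IH].
  by rewrite (_ : (fun _ => _) = (fun=> 0)); [exact: hp_zero|apply/funext => x; rewrite big_nil].
rewrite (_ : (fun _ => _) = (fun x => F i x + \sum_(j <- r) F j x)); first exact: hp_add.
by apply/funext => x; rewrite big_cons.
Qed.

Lemma hp_mul k l f g : hp k f -> hp l g -> hp (k + l) (fun x => f x * g x).
Proof.
move=> hf hg; elim/hp_induction: hf => {k f} [c|k i f _ IH|k f f' _ I1 _ I2|k].
- exact: hp_scale.
- rewrite addSn (_ : (fun _ => _) = (fun x => x 0 i * (f x * g x))); first exact: hp_mulx.
  by apply/funext => x; rewrite mulrA.
- rewrite (_ : (fun _ => _) = (fun x => f x * g x + f' x * g x)); first exact: hp_add.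
  by apply/funext => x; rewrite mulrDl.
- rewrite (_ : (fun _ => _) = (fun x => 0)); first exact: hp_zero.
  by apply/funext => x; rewrite mul0r.
Qed.

Lemma hp_coord i : hp 1 (fun x => x 0 i).
Proof.
rewrite (_ : (fun _ => _) = (fun x => x 0 i * 1)); first exact/hp_mulx/hp_const.
by apply/funext => x; rewrite mulr1.
Qed.

Lemma hp_dotp a : hp 1 (dotp a).
Proof. by apply: hp_sum => i; apply: hp_scale; exact: hp_coord. Qed.

Lemma hp_dotpxx : hp 2 (fun x => dotp x x).
Proof. by apply: hp_sum => i; apply: (@hp_mul 1 1); exact: hp_coord. Qed.

Lemma hp_comp k f (A : V -> V) : (forall i, hp 1 (fun x => A x 0 i)) -> hp k f ->
  hp k (f \o A).
Proof.
move=> hA; elim/hp_induction => {k f} [c|k i f _ IH|k f f' _ I1 _ I2|k].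
- exact: hp_const.
- exact: (@hp_mul 1).
- exact: hp_add I1 I2.
- exact: hp_zero.
Qed.

Lemma hp_refl k f a : hp k f -> hp k (f \o refl a).
Proof.
apply: hp_comp => i.
rewrite (_ : (fun _ => _) = (fun x => x 0 i - (2 / dotp a a * a 0 i) * dotp a x)).
  by apply: hp_sub; [exact: hp_coord|apply: hp_scale; exact: hp_dotp].
by apply/funext => x; rewrite reflE; ring.
Qed.

Lemma hp_hom k f (c : R) x : hp k f -> f (c *: x) = c ^+ k * f x.
Proof.
elim/hp_induction => {k f} [b|k i f _ IH|k f f' _ I1 _ I2|k].
- by rewrite expr0 mul1r.
- by rewrite mxE IH exprS; ring.
- by rewrite I1 I2 mulrDr.
- by rewrite mulr0.
Qed.

Lemma hp_continuous k f : hp k f -> continuous f.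
Proof.
elim/hp_induction => {k f} [b|k i f _ IH|k f f' _ I1 _ I2|k] x.
- exact: (@cst_continuous 'rV[R]_d).
- by apply: (@continuousM R 'rV[R]_d); [exact: coord_continuous|exact: IH].
- by apply: (@continuousD R R 'rV[R]_d); [exact: I1|exact: I2].
- exact: (@cst_continuous 'rV[R]_d).
Qed.

Lemma is_derive_coord x v i : is_derive x v (fun y : V => y 0 i) (v 0 i).
Proof.
apply: (@is_derive_quadratic _ _ _ _ _ _ 0 1) => // h _.
by rewrite !mxE addrK subrr normr0 mul0r.
Qed.

Lemma is_derive_mul f g x v (df dg : R) : is_derive x v f df -> is_derive x v g dg ->
  is_derive x v (fun y => f y * g y) (f x * dg + g x * df).
Proof. by move=> Hf Hg; have := is_deriveM Hf Hg. Qed.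

Lemma is_derive_add f g x v (df dg : R) : is_derive x v f df -> is_derive x v g dg ->
  is_derive x v (fun y => f y + g y) (df + dg).
Proof. by move=> Hf Hg; have := is_deriveD Hf Hg. Qed.

Lemma is_derive_const x v (c : R) : is_derive x v (fun _ : V => c) 0.
Proof. exact: is_derive_cst. Qed.

(* degree [k - 1], with the convention that degree [-1] only contains [0] *)
Definition hppb k M f := if k is k'.+1 then hpb k' M f else f = fun=> 0.

(** The product rule adds [|v_i| M <= |v| M] for each coordinate factor, hence the [k] in the bound.
    Keeping it explicit is what later allows power series to be differentiated term by term. *)
Lemma hpb_derive k M f v : hpb k M f ->
  (forall x, derivable f x v) /\ hppb k (k%:R * `|v| * M) (fun x => 'D_v f x).
Proof.
elim=> {k M f}.
- move=> c; split=> [x|]; first by case: (is_derive_const x v c).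
  by apply/funext => x; case: (is_derive_const x v c).
- move=> k M i f hf [df hDf].
  have D x : is_derive x v (fun x => x 0 i * f x) (x 0 i * 'D_v f x + f x * v 0 i).
    by apply: is_derive_mul; [exact: is_derive_coord|exact/derivableP].
  split=> [x|]; first by case: (D x).
  rewrite (_ : (fun _ => _) = (fun x => x 0 i * 'D_v f x + v 0 i * f x)); last first.
    by apply/funext => x; case: (D x) => _ ->; rewrite [f x * _]mulrC.
  apply: (@hpb_weaken _ (k%:R * `|v| * M + `|v 0 i| * M)).
    rewrite -[k.+1]addn1 natrD !mulrDl mul1r lerD2l ler_wpM2r ?(hpb_ge0 hf)//.
    exact: rV_coord_le.
  apply: hpb_add; last exact: hpb_scale.
  case: k hf hDf => [|k] hf /= hDf; last exact: hpb_mulx.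
  rewrite !mul0r (_ : (fun _ => _) = (fun=> 0)); first exact: hpb_zero.
  apply/funext => x; rewrite (_ : 'D_v f x = 0) ?mulr0//.
  by have := congr1 (fun F => F x) hDf.
- move=> k M N f g hf [df hDf] hg [dg hDg].
  have D x : is_derive x v (fun x => f x + g x) ('D_v f x + 'D_v g x).
    by apply: is_derive_add; exact/derivableP.
  split=> [x|]; first by case: (D x).
  rewrite (_ : (fun _ => _) = (fun x => 'D_v f x + 'D_v g x)); last first.
    by apply/funext => x; case: (D x) => _ ->.
  rewrite mulrDr; case: k hf hDf hg hDg => [|k] hf /= hDf hg hDg; last exact: hpb_add.
  apply/funext => x.
  have -> : 'D_v f x = 0 by have := congr1 (fun F => F x) hDf.
  have -> : 'D_v g x = 0 by have := congr1 (fun F => F x) hDg.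
  by rewrite addr0.
- move=> k; split=> [x|]; first by case: (is_derive_const x v 0).
  rewrite (_ : (fun _ => _) = (fun=> 0)); last first.
    by apply/funext => x; case: (is_derive_const x v 0).
  by case: k => [|k] //=; rewrite mulr0; exact: hpb_zero.
- move=> k M N f MN hf [df hDf]; split => //.
  case: k hf hDf => [|k] hf //=; apply: hpb_weaken.
  by rewrite ler_wpM2l ?mulr_ge0.
Qed.

(** Integer degrees let every derivative and Dunkl operator lower the degree by exactly one; in
    negative degree only the zero function is left, which disposes of the boundary cases. *)
Definition hpz (k : int) f := if k is Posz n then hp n f else f = fun=> 0.

Lemma hpz_zero k : hpz k (fun=> 0).
Proof. by case: k => // n; exact: hp_zero. Qed.

Lemma hppb_hpz k M f : hppb k M f -> hpz (k%:Z - 1) f.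
Proof.
case: k => [|k] hf; first exact: hf.
have -> : k.+1%:Z - 1 = k%:Z by rewrite intS; ring.
by exists M.
Qed.

Lemma hpzP k f : hpz k f -> (exists2 n, k = Posz n & hp n f) \/ f = fun=> 0.
Proof. by case: k => n hf; [left; exists n|right]. Qed.

Lemma hpz_derivable k f x v : hpz k f -> derivable f x v.
Proof.
move=> /hpzP[[n _ [M /(hpb_derive v)[]]] //|->].
by case: (is_derive_const x v 0).
Qed.

Lemma derive_zero v : (fun x => 'D_v (fun _ : V => 0 : R) x) = fun=> 0.
Proof. by apply/funext => x; case: (is_derive_const x v 0). Qed.

Lemma hpz_derive k f v : hpz k f -> hpz (k - 1) (fun x => 'D_v f x).
Proof.
move=> /hpzP[[n -> [M /(hpb_derive v)[_ /hppb_hpz]]] //|->].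
by rewrite derive_zero; exact: hpz_zero.
Qed.

Lemma hpz_mulx k i f : hpz k f -> hpz (k + 1) (fun x => x 0 i * f x).
Proof.
move=> /hpzP[[n -> hf]|->].
  by rewrite -PoszD addn1; exact: hp_mulx.
rewrite (_ : (fun _ => _) = (fun=> 0)); first exact: hpz_zero.
by apply/funext => x; rewrite mulr0.
Qed.

Lemma hpz_add k f g : hpz k f -> hpz k g -> hpz k (fun x => f x + g x).
Proof.
case: k => [n|n] /=; first exact: hp_add.
by move=> -> ->; apply/funext => x; rewrite addr0.
Qed.

Lemma hpz_scale k (c : R) f : hpz k f -> hpz k (fun x => c * f x).
Proof.
case: k => [n|n] /=; first exact: hp_scale.
by move=> ->; apply/funext => x; rewrite mulr0.
Qed.

Lemma hpz_sub k f g : hpz k f -> hpz k g -> hpz k (fun x => f x - g x).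
Proof.
case: k => [n|n] /=; first exact: hp_sub.
by move=> -> ->; apply/funext => x; rewrite subr0.
Qed.

Lemma hpz_sum k (I : Type) (r : seq I) (F : I -> V -> R) : (forall i, hpz k (F i)) ->
  hpz k (fun x => \sum_(i <- r) F i x).
Proof.
move=> hF; elim: r => [|i r IH].
  by rewrite (_ : (fun _ => _) = (fun=> 0)); [exact: hpz_zero|apply/funext => x; rewrite big_nil].
rewrite (_ : (fun _ => _) = (fun x => F i x + \sum_(j <- r) F j x)); first exact: hpz_add.
by apply/funext => x; rewrite big_cons.
Qed.

Lemma hpz_mul k l f g : hpz k f -> hpz l g -> hpz (k + l) (fun x => f x * g x).
Proof.
move=> /hpzP[[n -> hf]|->]; last first.
  move=> _; rewrite (_ : (fun _ => _) = (fun=> 0)); first exact: hpz_zero.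
  by apply/funext => x; rewrite mul0r.
move=> /hpzP[[m -> hg]|->]; first by rewrite -PoszD; exact: hp_mul.
rewrite (_ : (fun _ => _) = (fun=> 0)); first exact: hpz_zero.
by apply/funext => x; rewrite mulr0.
Qed.

Lemma hpz_refl k f a : hpz k f -> hpz k (f \o refl a).
Proof.
move=> /hpzP[[n -> hf]|->]; first exact: hp_refl.
exact: hpz_zero.
Qed.

Lemma hpz_continuous k f : hpz k f -> continuous f.
Proof. by move=> /hpzP[[n _ /hp_continuous //]|->] x; exact: (@cst_continuous 'rV[R]_d). Qed.

Lemma hpz_is_derive k f x v : hpz k f -> is_derive x v f ('D_v f x).
Proof. by move=> /hpz_derivable hf; exact/derivableP. Qed.

Lemma hpz_derive_mulx k i f x v : hpz k f ->
  'D_v (fun x => x 0 i * f x) x = v 0 i * f x + x 0 i * 'D_v f x.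
Proof.
move=> hf; rewrite (derive_val (is_derive := is_derive_mul (is_derive_coord x v i) (hpz_is_derive x v hf))).
by ring.
Qed.

Lemma hpz_deriveD k l f g x v : hpz k f -> hpz l g ->
  'D_v (fun x => f x + g x) x = 'D_v f x + 'D_v g x.
Proof.
move=> hf hg.
by rewrite (derive_val (is_derive := is_derive_add (hpz_is_derive x v hf) (hpz_is_derive x v hg))).
Qed.

Lemma hpz_deriveM k l f g x v : hpz k f -> hpz l g ->
  'D_v (fun x => f x * g x) x = f x * 'D_v g x + g x * 'D_v f x.
Proof.
move=> hf hg.
by rewrite (derive_val (is_derive := is_derive_mul (hpz_is_derive x v hf) (hpz_is_derive x v hg))).
Qed.

Lemma hp_derive_lin k f x u v (c : R) : hp k f ->
  'D_(c *: u + v) f x = c * 'D_u f x + 'D_v f x.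
Proof.
elim/hp_induction => {k f} [b|k i f hf IH|k f f' hf I1 hg I2|k].
- have := derive_val (is_derive := is_derive_const x _ b) => E.
  by rewrite !E mulr0 addr0.
- by rewrite !(@hpz_derive_mulx k)// IH !mxE; ring.
- by rewrite !(@hpz_deriveD k k)// I1 I2; ring.
- have := derive_val (is_derive := is_derive_const x _ 0) => E.
  by rewrite !E mulr0 addr0.
Qed.

Lemma hp_euler k f x : hp k f -> 'D_x f x = k%:R * f x.
Proof.
elim/hp_induction => {k f} [b|k i f hf IH|k f f' hf I1 hg I2|k].
- by rewrite (derive_val (is_derive := is_derive_const x _ b)) mul0r.
- by rewrite !(@hpz_derive_mulx k)// IH -[k.+1]addn1 natrD; ring.
- by rewrite !(@hpz_deriveD k k)// I1 I2; ring.
- by rewrite (derive_val (is_derive := is_derive_const x _ 0)) mulr0.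
Qed.

End HomogeneousPolynomials.

(** * Integration on the sphere *)

Section ContinuityTools.
Variables (R : realType) (V : normedModType R).
Implicit Types (f g h : V -> R) (x : V).

Lemma continuous_near f g x : (\forall y \near x, f y = g y) ->
  {for x, continuous f} -> {for x, continuous g}.
Proof.
move=> fg cf; rewrite /prop_for /continuous_at -(nbhs_singleton fg).
by apply: cvg_trans cf; apply: near_eq_cvg; apply: filterS fg => y ->.
Qed.

Lemma continuous_squeeze f h x : (forall y, `|f y| <= h y) -> h x = 0 ->
  {for x, continuous h} -> {for x, continuous f}.
Proof.
move=> fh hx /continuous_atP ch; apply/continuous_atP => e /ch[r r0 H].
exists r => // y /H; apply: le_lt_trans; rewrite hx subr0.
have -> : f x = 0 by apply/eqP; rewrite -normr_le0 -hx.
by rewrite subr0 (le_trans (fh y))// ler_norm.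
Qed.

Lemma cfD f g x : {for x, continuous f} -> {for x, continuous g} ->
  {for x, continuous (fun y => f y + g y)}.
Proof. exact: (@continuousD R R V). Qed.

Lemma cfM f g x : {for x, continuous f} -> {for x, continuous g} ->
  {for x, continuous (fun y => f y * g y)}.
Proof. exact: (@continuousM R V). Qed.

Lemma cfN f x : {for x, continuous f} -> {for x, continuous (fun y => - f y)}.
Proof. exact: (@continuousN R R V). Qed.

Lemma cfC (c : R) x : {for x, continuous (fun _ : V => c)}.
Proof. exact: (@cst_continuous V). Qed.

Lemma cfX f x n : {for x, continuous f} -> {for x, continuous (fun y => f y ^+ n)}.
Proof.
move=> cf; elim: n => [|n IH]; first exact: cfC.
by rewrite (_ : (fun _ => _) = fun y => f y * f y ^+ n); [exact: cfM|apply/funext => y; rewrite exprS].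
Qed.

Lemma cfV f x : f x != 0 -> {for x, continuous f} -> {for x, continuous (fun y => (f y)^-1)}.
Proof. exact: (@continuousV R V). Qed.

Lemma cf_norm f x : {for x, continuous f} -> {for x, continuous (fun y => `|f y|)}.
Proof. by move=> cf; apply: cvg_norm cf. Qed.

End ContinuityTools.

Section Cutoff.
Variable R : realType.

(* increases to the indicator of [0 < s] when [c] goes to infinity *)
Definition ramp (c s : R) := c * s / (1 + c * s).

Lemma ramp_ge0 (c s : R) : 0 <= c -> 0 <= s -> 0 <= ramp c s.
Proof. by move=> c0 s0; rewrite /ramp divr_ge0 ?addr_ge0 ?mulr_ge0. Qed.

Lemma ramp_le1 (c s : R) : 0 <= c -> 0 <= s -> ramp c s <= 1.
Proof.
move=> c0 s0; have cs : 0 <= c * s by rewrite mulr_ge0.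
by rewrite /ramp ler_pdivrMr ?mul1r; lra.
Qed.

Lemma ramp_le (c s : R) : 0 <= c -> 0 <= s -> ramp c s <= c * s.
Proof.
move=> c0 s0; have cs : 0 <= c * s by rewrite mulr_ge0.
by rewrite /ramp ler_pdivrMr; [nra|lra].
Qed.

Lemma ramp0 c : ramp c 0 = 0.
Proof. by rewrite /ramp mulr0 mul0r. Qed.

Lemma cvg_ramp (s : R) : 0 < s -> ramp k.+1%:R s @[k --> \oo] --> (1 : R).
Proof.
move=> s0; rewrite -[X in _ --> X](subr0 1).
rewrite (_ : (fun k => _) = (fun k => 1 - (1 + k.+1%:R * s)^-1)); last first.
  apply/funext => k; have ks : 0 < k.+1%:R * s by rewrite mulr_gt0.
  by rewrite /ramp; field; rewrite gt_eqF//; lra.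
apply: cvgB; first exact: cvg_cst.
apply: (@squeeze_cvgr _ _ _ _ (fun=> 0) (fun k => s^-1 * harmonic k)).
- apply: nearW => k; have ks : 0 < k.+1%:R * s by rewrite mulr_gt0.
  rewrite invr_ge0 addr_ge0 ?(ltW ks)//= /harmonic -invfM mulrC.
  by rewrite lef_pV2 ?posrE ?addr_gt0//; lra.
- exact: cvg_cst.
- rewrite -[X in _ --> X](mulr0 s^-1); apply: cvgMr; exact: cvg_harmonic.
Qed.

Lemma continuous_ramp (V : normedModType R) (c : R) (h : V -> R) x : 0 <= c -> 0 <= h x ->
  {for x, continuous h} -> {for x, continuous (fun y => ramp c (h y))}.
Proof.
move=> c0 hx ch; have chx : 0 <= c * h x by rewrite mulr_ge0.
rewrite /ramp; apply: cfM; first by apply: cfM => //; exact: cfC.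
apply: cfV; first by rewrite gt_eqF//; lra.
by apply: cfD; [exact: cfC|apply: cfM => //; exact: cfC].
Qed.

End Cutoff.

Section Sphere.
Variables (R : realType) (d : nat).
Hypothesis d_gt0 : (0 < d)%N.
Local Notation V := 'rV[R]_d.
Implicit Types (u v : V -> R) (x y : V).

(** Continuity in the ambient space, asked at the points of the sphere: the origin, where
    normalization breaks down, is left out. *)
Definition sphere_continuous u := forall y, enorm y = 1 -> {for y, continuous u}.

Lemma continuous_enorm : continuous (@enorm R d).
Proof.
move=> x; apply: (@continuous_comp _ _ _ (fun x : V => dotp x x) Num.sqrt).
  exact: hp_continuous (hp_dotpxx _ _) _.
exact: sqrt_continuous.
Qed.

Lemma compact_sphere : compact [set y : V | enorm y = 1].
Proof.
apply: bounded_closed_compact.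
  exists 1; split; first exact: num_real.
  by move=> M M1 y /= y1; rewrite (le_trans (norm_le_enorm y))// y1 ltW.
rewrite (_ : [set y | _] = @enorm R d @^-1` [set 1])//.
apply: closed_comp; last exact: closed_eq.
by move=> y _; exact: continuous_enorm.
Qed.

Lemma sphere_bounded u : sphere_continuous u ->
  exists M, forall y, enorm y = 1 -> `|u y| <= M.
Proof.
move=> cu; have : compact (u @` [set y : V | enorm y = 1]).
  apply: continuous_compact; last exact: compact_sphere.
  by apply: continuous_in_subspaceT => y /set_mem /cu.
move=> /compact_bounded[M [_ H]]; exists (M + 1) => y y1.
by apply: (H (M + 1)); [rewrite ltrDl|exists y].
Qed.

Definition posp (s : R) := (s + `|s|) / 2.

Lemma nice_ball (g : V -> R) (t M : R) : 0 < t -> (forall x, `|g x| <= M) ->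
  (forall x, t <= enorm x -> g x = 0) ->
  (forall x, 0 < enorm x -> enorm x < t -> {for x, continuous g}) -> nice t M g.
Proof.
move=> t0 gM gt cg.
have pge0 (s : R) : 0 <= posp s.
  by rewrite /posp divr_ge0//; have := ler_norm (- s); rewrite normrN; lra.
have p0 (s : R) : s <= 0 -> posp s = 0 by move=> s0; rewrite /posp ler0_norm// subrr mul0r.
have pE (s : R) : 0 <= s -> posp s = s by move=> s0; rewrite /posp ger0_norm//; lra.
have cp x : {for x, continuous (fun y : V => posp (t - enorm y))}.
  have ct : {for x, continuous (fun y : V => t - enorm y)}.
    by apply: cfD; [exact: cfC|apply: cfN; exact: continuous_enorm].
  by apply: cfM; [apply: cfD => //; exact: cf_norm|exact: cfC].
(* The term with [g 0] gives the limit the value of [g] at the origin too, so that the convergence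
   is pointwise everywhere. *)
pose gk (k : nat) x := (g x * ramp k.+1%:R (enorm x) + g 0 * (1 - ramp k.+1%:R (enorm x))) *
  ramp k.+1%:R (posp (t - enorm x)).
have r01 (k : nat) (s : R) : 0 <= s -> 0 <= ramp k.+1%:R s <= 1.
  by move=> s0; rewrite ramp_ge0// ramp_le1.
have gkM0 k x : `|gk k x| <= M * ramp k.+1%:R (posp (t - enorm x)).
  have /andP[a0 a1] := r01 k (enorm x) (enorm_ge0 x).
  have /andP[b0 b1] := r01 k _ (pge0 (t - enorm x)).
  rewrite /gk normrM (ger0_norm b0) ler_wpM2r//.
  rewrite (le_trans (ler_normD _ _))// [`|g x * _|]normrM [`|g 0 * _|]normrM (ger0_norm a0).
  rewrite (ger0_norm (_ : 0 <= 1 - _)) ?subr_ge0//.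
  have := gM x; have := gM 0; nra.
have M0 : 0 <= M by apply: le_trans (normr_ge0 _) (gM 0).
have gkM k x : `|gk k x| <= M.
  have /andP[b0 b1] := r01 k _ (pge0 (t - enorm x)).
  by apply: le_trans (gkM0 k x) _; rewrite ler_piMr.
have cgk k x : {for x, continuous (gk k)}.
  have [xt|xt] := leP t (enorm x).
    apply: (continuous_squeeze (gkM0 k)).
      by rewrite p0 ?ramp0 ?mulr0// subr_le0.
    by apply: cfM; [exact: cfC|apply: continuous_ramp].
  have cr : {for x, continuous (fun y : V => ramp k.+1%:R (enorm y))}.
    by apply: continuous_ramp => //; [exact: enorm_ge0|exact: continuous_enorm].
  rewrite /gk; apply: cfM; last by apply: continuous_ramp.
  apply: cfD; last by apply: cfM; [exact: cfC|apply: cfD; [exact: cfC|exact: cfN]].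
  have [x0|x0] := ltP 0 (enorm x); first by apply: cfM => //; exact: cg.
  have {}x0 : enorm x = 0 by apply/eqP; rewrite eq_le x0 enorm_ge0.
  apply: (@continuous_squeeze _ _ _ (fun y => M * (k.+1%:R * enorm y))).
  - move=> y; have /andP[a0 a1] := r01 k (enorm y) (enorm_ge0 y).
    rewrite normrM (ger0_norm a0) ler_pM// ramp_le//; exact: enorm_ge0.
  - by rewrite x0 !mulr0.
  - by apply: cfM; [exact: cfC|apply: cfM; [exact: cfC|exact: continuous_enorm]].
have ngk k : nice t M (gk k).
  apply: continuous_nice => //; [exact: ltW|by move=> x; exact: cgk|].
  move=> x i xt; have {}xt : t < enorm x := lt_le_trans xt (coord_le_enorm x i).
  by rewrite /gk p0 ?ramp0 ?mulr0// subr_le0 ltW.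
apply: (nice_dct (ltW t0) ngk _).1 => x.
have [xt|xt] := leP t (enorm x).
  rewrite gt// (_ : (fun k => _) = fun=> 0); first exact: cvg_cst.
  by apply/funext => k; rewrite /gk p0 ?ramp0 ?mulr0// subr_le0.
have cp1 : ramp k.+1%:R (posp (t - enorm x)) @[k --> \oo] --> (1 : R).
  by apply: cvg_ramp; rewrite pE ?subr_gt0// ltW// subr_gt0.
rewrite -[X in _ --> X]mulr1; apply: cvgM => //.
have [->|x0] := eqVneq x 0.
  rewrite enorm0; under eq_fun do rewrite ramp0 mulr0 add0r subr0 mulr1.
  exact: cvg_cst.
have cr : ramp k.+1%:R (enorm x) @[k --> \oo] --> (1 : R).
  by apply: cvg_ramp; rewrite enorm_gt0.
rewrite -[X in _ --> X]addr0 -{2}[g x]mulr1 -(mulr0 (g 0)) -(subrr 1).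
apply: cvgD; first by apply: cvgM => //; exact: cvg_cst.
by apply: cvgM; [exact: cvg_cst|apply: cvgB => //; exact: cvg_cst].
Qed.

(** Homogeneous extension of degree [l] from the sphere, cut off at radius [t]; for [l = 0] and
    [t = 1] it is the integrand of [int_sphere]. *)
Definition ball_ext (l : nat) (t : R) u x :=
  if enorm x < t then enorm x ^+ l * u ((enorm x)^-1 *: x) else 0.

Lemma enorm_normalize x : x != 0 -> enorm ((enorm x)^-1 *: x) = 1.
Proof. by move=> x0; rewrite enormZ gtr0_norm ?invr_gt0 ?enorm_gt0// mulVf// enorm_eq0. Qed.

Lemma ball_ext_bound l (t : R) u (B : R) : 0 < t -> (forall y, enorm y = 1 -> `|u y| <= B) ->
  forall x, `|ball_ext l t u x| <= t ^+ l * (`|B| + `|u 0|).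
Proof.
move=> t0 uB x; rewrite /ball_ext; case: ltP => xt; last first.
  by rewrite normr0 mulr_ge0 ?addr_ge0// exprn_ge0// ltW.
rewrite normrM ger0_norm ?exprn_ge0 ?enorm_ge0// ler_pM ?exprn_ge0 ?enorm_ge0//.
  by apply: lerXn2r; rewrite ?nnegrE ?enorm_ge0 ?ltW.
have [->|x0] := eqVneq x 0; first by rewrite scaler0 lerDr.
by rewrite (le_trans (uB _ (enorm_normalize x0)))// (le_trans (ler_norm _))// lerDl.
Qed.

Lemma nice_ball_ext l (t : R) u : 0 < t -> sphere_continuous u ->
  exists M, nice t M (ball_ext l t u).
Proof.
move=> t0 cu; have [B uB] := sphere_bounded cu.
exists (t ^+ l * (`|B| + `|u 0|)); apply: nice_ball => //.
- exact: ball_ext_bound.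
- by move=> x xt; rewrite /ball_ext ltNge xt.
move=> x x0 xt; apply: (@continuous_near _ _ (fun y => enorm y ^+ l * u ((enorm y)^-1 *: y))).
  have /cvgr_lt/(_ _ xt) : enorm y @[y --> x] --> enorm x by exact: continuous_enorm.
  by apply: filterS => y yt; rewrite /ball_ext yt.
apply: cfM; first by apply: cfX; exact: continuous_enorm.
apply: (@continuous_comp _ _ _ (fun y : V => (enorm y)^-1 *: y) u).
  apply: (@continuousZ R V V) => //.
  by apply: cfV; [rewrite gt_eqF|exact: continuous_enorm].
by apply: cu; rewrite enorm_normalize// -enorm_gt0.
Qed.

Lemma intRn_scale (K M c : R) (g : V -> R) : 0 <= K -> nice K M g ->
  intRn (fun x => c * g x) = c * intRn g.
Proof.
move=> K0 ng; have n0 : nice K 0 (fun _ : V => 0).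
  by apply: continuous_nice => // [x|x]; [exact: cfC|rewrite normr0].
have [_] := nice_lin c K0 ng n0; rewrite intRn0 addr0 => <-.
by congr intRn; apply/funext => x; rewrite addr0.
Qed.

Lemma intRn_sub (K M N : R) (f g : V -> R) : 0 <= K -> nice K M f -> nice K N g ->
  intRn (fun x => f x - g x) = intRn f - intRn g.
Proof.
move=> K0 nf ng; have [_] := nice_lin (-1) K0 ng nf.
rewrite mulN1r addrC => <-.
by congr intRn; apply/funext => x; rewrite mulN1r addrC.
Qed.

Lemma nice_sub (K M N : R) (f g : V -> R) : 0 <= K -> nice K M f -> nice K N g ->
  nice K (N + M) (fun x => f x - g x).
Proof.
move=> K0 nf ng; have [H _] := nice_lin (-1) K0 ng nf.
move: H; rewrite normrN1 mul1r; congr nice.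
by apply/funext => x; rewrite mulN1r addrC.
Qed.

Lemma intRn_le (K M N : R) (f g : V -> R) : 0 <= K -> nice K M f -> nice K N g ->
  (forall x, f x <= g x) -> intRn f <= intRn g.
Proof.
move=> K0 nf ng fg; rewrite -subr_ge0 -(intRn_sub K0 ng nf).
by apply: intRn_ge0 => x; rewrite subr_ge0.
Qed.

Lemma intRn_ball_ext l (t : R) u : 0 < t -> sphere_continuous u ->
  intRn (ball_ext l t u) = t ^+ (l + d) * intRn (ball_ext l 1 u).
Proof.
move=> t0 cu; have [M nM] := nice_ball_ext l ltr01 cu.
have [M' nM'] := nice_ball_ext l t0 cu.
have ti : t^-1 != 0 by rewrite invr_eq0 gt_eqF.
have [_ <-] := nice_affine 0 ler01 ti nM.
rewrite (_ : (fun x => _) = (fun x => t ^- l * ball_ext l t u x)).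
  rewrite (intRn_scale _ (ltW t0) nM') gtr0_norm ?invr_gt0// exprD exprVn.
  by field; rewrite !expf_neq0 ?gt_eqF.
apply/funext => x; rewrite addr0 /ball_ext enormZ gtr0_norm ?invr_gt0//.
rewrite ltr_pdivrMl// mulr1; case: ifP => _; last by rewrite mulr0.
rewrite exprMn exprVn mulrA; congr (_ * u _).
by rewrite scalerA invfM invrK mulrAC divff ?mul1r ?gt_eqF.
Qed.

(** Radial integration by comparison. On the shell [1 <= |x| < t] the extensions of degrees 0 and
    [l] differ by a factor between 1 and [t ^ l]; dilation evaluates the shell integrals, and after
    division by [t - 1] the two bounds meet as [t] tends to 1. *)
Lemma ge0_polar l u : sphere_continuous u -> (forall y, enorm y = 1 -> 0 <= u y) ->
  (l + d)%:R * intRn (ball_ext l 1 u) = d%:R * intRn (ball_ext 0 1 u).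
Proof.
move=> cu u0.
set Jl := intRn (ball_ext l 1 u); set J0 := intRn (ball_ext 0 1 u).
have shell (t : R) : 1 < t -> (t ^+ d - 1) * J0 <= (t ^+ (l + d) - 1) * Jl <= t ^+ l * ((t ^+ d - 1) * J0).
  move=> t1; have t0 : 0 < t by lra.
  have E k : exists M, nice t M (fun x => ball_ext k t u x - ball_ext k 1 u x) /\
      intRn (fun x => ball_ext k t u x - ball_ext k 1 u x) = (t ^+ (k + d) - 1) * intRn (ball_ext k 1 u).
    have [M nM] := nice_ball_ext k ltr01 cu; have [N nN] := nice_ball_ext k t0 cu.
    have nM' := nice_weaken (ltW t1) (lexx _) nM.
    exists (M + N); split; first exact: nice_sub (ltW t0) nN nM'.
    by rewrite (intRn_sub (ltW t0) nN nM') intRn_ball_ext// mulrBl mul1r.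
  have [M0 [n0 E0]] := E 0; have [Ml [nl El]] := E l.
  rewrite add0n in E0; rewrite -E0 -El -(intRn_scale _ (ltW t0) n0).
  have nt0 : nice t (t ^+ l * M0) (fun x => t ^+ l * (ball_ext 0 t u x - ball_ext 0 1 u x)).
    have nz : nice t 0 (fun _ : V => 0).
      apply: continuous_nice => // [|x|x]; [exact: ltW|exact: cfC|by rewrite normr0].
    have [+ _] := nice_lin (t ^+ l) (ltW t0) n0 nz.
    rewrite addr0 ger0_norm ?exprn_ge0 ?(ltW t0)//; congr nice.
    by apply/funext => x; rewrite addr0.
  have H x : ball_ext 0 t u x - ball_ext 0 1 u x <= ball_ext l t u x - ball_ext l 1 u x
      <= t ^+ l * (ball_ext 0 t u x - ball_ext 0 1 u x).
    rewrite /ball_ext expr0 mul1r; have [x1|x1] := ltP (enorm x) 1.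
      by rewrite (lt_trans x1 t1) !subrr mulr0 lexx.
    rewrite !subr0; case: ltP => [xt|_]; last by rewrite mulr0 lexx.
    have x0 : x != 0 by rewrite -enorm_gt0; lra.
    have ux := u0 _ (enorm_normalize x0).
    rewrite ler_peMl ?exprn_ege1//= ler_wpM2r//.
    by apply: lerXn2r; rewrite ?nnegrE ?enorm_ge0 ?ltW// ltW.
  by rewrite (intRn_le (ltW t0) n0 nl)/= ?(intRn_le (ltW t0) nl nt0)// => x; case/andP: (H x).
(* [t ^ n - 1 = (t - 1) S n t] with [S n 1 = n]: this is the origin of the factors [d] and
   [l + d]. *)
pose S n t : R := \sum_(i < n) t ^+ i.
have SE n (t : R) : t ^+ n - 1 = (t - 1) * S n t by rewrite subrX1.
have S1 n : S n 1 = n%:R.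
  rewrite /S (eq_bigr (fun=> 1)) ?sumr_const ?card_ord//.
  by move=> i _; rewrite expr1n.
have cS n : {for 1, continuous (S n)}.
  have -> : S n = horner (\sum_(i < n) 'X^i).
    by apply/funext => t; rewrite horner_sum; apply: eq_bigr => i _; rewrite hornerXn.
  exact: continuous_horner.
have cSr n : S n t @[t --> (1:R)^'+] --> (n%:R : R).
  by rewrite -(S1 n); apply: cvg_at_right_filter; exact: cS.
have near1 : \forall t \near (1:R)^'+, 1 < t by exact: nbhs_right_gt.
have cX : t ^+ l @[t --> (1:R)^'+] --> (1:R).
  rewrite -[X in _ --> X](expr1n _ l); apply: cvg_at_right_filter.
  exact: exprn_continuous.
apply/eqP; rewrite eq_le; apply/andP; split.
- rewrite -[leRHS]mul1r; apply: (@ler_cvg_to _ (1:R)^'+ _ _ (fun t => S (l + d)%N t * Jl) (fun t => t ^+ l * (S d t * J0))).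
  + by apply: cvgM => //; exact: cvg_cst.
  + by apply: cvgM => //; apply: cvgM => //; exact: cvg_cst.
  apply: filterS near1 => t t1; have /andP[_] := shell t t1.
  by rewrite !SE -!mulrA [leRHS]mulrCA ler_pM2l ?subr_gt0.
- apply: (@ler_cvg_to _ (1:R)^'+ _ _ (fun t => S d t * J0) (fun t => S (l + d)%N t * Jl)).
  + by apply: cvgM => //; exact: cvg_cst.
  + by apply: cvgM => //; exact: cvg_cst.
  apply: filterS near1 => t t1; have /andP[+ _] := shell t t1.
  by rewrite !SE -!mulrA ler_pM2l ?subr_gt0.
Qed.

End Sphere.

(** * The functional on the unweighted sphere, its Green formula and reflection invariance *)

Section SphereFunctional.
Variables (R : realType) (d : nat).
Hypothesis d_gt0 : (0 < d)%N.
Local Notation V := 'rV[R]_d.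
Implicit Types (u v : V -> R) (x y : V).

Lemma sphere_continuousC (c : R) : @sphere_continuous R d (fun=> c).
Proof. by move=> y _; exact: cfC. Qed.
Arguments sphere_continuousC c : clear implicits.

Lemma sphere_continuousD u v : sphere_continuous u -> sphere_continuous v ->
  sphere_continuous (fun x => u x + v x).
Proof. by move=> cu cv y y1; apply: cfD; [exact: cu|exact: cv]. Qed.

Lemma sphere_continuousM u v : sphere_continuous u -> sphere_continuous v ->
  sphere_continuous (fun x => u x * v x).
Proof. by move=> cu cv y y1; apply: cfM; [exact: cu|exact: cv]. Qed.

Lemma continuous_sphere u : continuous u -> sphere_continuous u.
Proof. by move=> cu y _; exact: cu. Qed.

Lemma hp_sphere k u : hp k u -> sphere_continuous u.
Proof. by move=> /hp_continuous/continuous_sphere. Qed.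

Definition Nice (g : V -> R) := exists M, nice 1 M g.

Lemma Nice_lin (a : R) (f g : V -> R) : Nice f -> Nice g ->
  Nice (fun x => a * f x + g x) /\ intRn (fun x => a * f x + g x) = a * intRn f + intRn g.
Proof.
move=> [M nf] [N ng]; have [H ->] := nice_lin a ler01 nf ng.
by split=> //; exists (`|a| * M + N).
Qed.

Lemma Nice_ball_ext l u : sphere_continuous u -> Nice (ball_ext l 1 u).
Proof. by move=> cu; exact: nice_ball_ext. Qed.

Lemma ball_ext_lin l (t a : R) u v : ball_ext l t (fun x => a * u x + v x) =
  (fun x => a * ball_ext l t u x + ball_ext l t v x).
Proof.
apply/funext => x; rewrite /ball_ext; case: ifP => _; last by rewrite mulr0 addr0.
by rewrite mulrDr; congr (_ + _); ring.
Qed.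

Lemma int_sphere_ball_ext u : int_sphere u = d%:R * intRn (ball_ext 0 1 u).
Proof.
congr (_ * intRn _); apply/funext => x.
by rewrite /ball_ext expr0 mul1r.
Qed.

(** Reduces to [ge0_polar] for [u + B] and for [B], with [B] a bound of [|u|] on the sphere. *)
Lemma polar l u : sphere_continuous u ->
  (l + d)%:R * intRn (ball_ext l 1 u) = int_sphere u.
Proof.
move=> cu; have [B uB] := sphere_bounded cu.
have cB := sphere_continuousC B.
have cu' : sphere_continuous (fun x => 1 * u x + B).
  by apply: sphere_continuousD => //; apply: sphere_continuousM => //; exact: sphere_continuousC.
have B0 y : enorm y = 1 -> 0 <= B by move=> /uB; apply: le_trans.
have E1 := ge0_polar l cB B0.
have E2 : (l + d)%:R * intRn (ball_ext l 1 (fun x => 1 * u x + B)) =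
    d%:R * intRn (ball_ext 0 1 (fun x => 1 * u x + B)).
  apply: ge0_polar => // y /uB; rewrite ler_norml => /andP[]; lra.
rewrite int_sphere_ball_ext.
move: E2; rewrite !ball_ext_lin.
rewrite (Nice_lin 1 (Nice_ball_ext l cu) (Nice_ball_ext l cB)).2.
rewrite (Nice_lin 1 (Nice_ball_ext 0 cu) (Nice_ball_ext 0 cB)).2.
lra.
Qed.

(* [ball_ext 1 1 u] does not depend on the junk value of [u] at [0] *)
Lemma int_sphereE u : sphere_continuous u ->
  int_sphere u = (1 + d)%:R * intRn (ball_ext 1 1 u).
Proof. by move=> cu; rewrite polar. Qed.

Lemma ball_ext1_eq u v (t : R) : (forall y, enorm y = 1 -> u y = v y) ->
  ball_ext 1 t u = ball_ext 1 t v.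
Proof.
move=> uv; apply/funext => x; rewrite /ball_ext; case: ifP => // _.
have [->|x0] := eqVneq x 0; first by rewrite enorm0 expr1 !mul0r.
by rewrite uv// enorm_normalize.
Qed.

Lemma int_sphere_eq u v : sphere_continuous u -> sphere_continuous v ->
  (forall y, enorm y = 1 -> u y = v y) -> int_sphere u = int_sphere v.
Proof. by move=> cu cv uv; rewrite !int_sphereE// (ball_ext1_eq _ uv). Qed.

Lemma int_sphere_lin (a : R) u v : sphere_continuous u -> sphere_continuous v ->
  int_sphere (fun x => a * u x + v x) = a * int_sphere u + int_sphere v.
Proof.
move=> cu cv; rewrite !int_sphere_ball_ext ball_ext_lin.
rewrite (Nice_lin a (Nice_ball_ext 0 cu) (Nice_ball_ext 0 cv)).2; ring.
Qed.

Lemma int_sphere0 : int_sphere (fun _ : V => 0) = 0.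
Proof.
have := int_sphere_lin 1 (sphere_continuousC 0) (sphere_continuousC 0).
rewrite (_ : (fun _ => _) = fun=> 0); last by apply/funext => x; rewrite mulr0 addr0.
lra.
Qed.

Lemma int_sphereZ (a : R) u : sphere_continuous u ->
  int_sphere (fun x => a * u x) = a * int_sphere u.
Proof.
move=> cu; have := int_sphere_lin a cu (sphere_continuousC 0).
rewrite int_sphere0 addr0 => <-; congr int_sphere.
by apply/funext => x; rewrite addr0.
Qed.

Lemma int_sphereD u v : sphere_continuous u -> sphere_continuous v ->
  int_sphere (fun x => u x + v x) = int_sphere u + int_sphere v.
Proof.
move=> cu cv; have := int_sphere_lin 1 cu cv; rewrite mul1r => <-.
by congr int_sphere; apply/funext => x; rewrite mul1r.
Qed.

Lemma int_sphereB u v : sphere_continuous u -> sphere_continuous v ->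
  int_sphere (fun x => u x - v x) = int_sphere u - int_sphere v.
Proof.
move=> cu cv; have := int_sphere_lin (-1) cv cu; rewrite mulN1r addrC => <-.
by congr int_sphere; apply/funext => x; rewrite mulN1r addrC.
Qed.

Lemma int_sphere_ge0 u : sphere_continuous u -> (forall y, enorm y = 1 -> 0 <= u y) ->
  0 <= int_sphere u.
Proof.
move=> cu u0; rewrite int_sphereE// mulr_ge0// intRn_ge0// => x.
rewrite /ball_ext; case: ifP => // _; rewrite expr1.
have [->|x0] := eqVneq x 0; first by rewrite enorm0 mul0r.
by rewrite mulr_ge0 ?enorm_ge0// u0// enorm_normalize.
Qed.

Lemma int_sphere_le u v : sphere_continuous u -> sphere_continuous v ->
  (forall y, enorm y = 1 -> u y <= v y) -> int_sphere u <= int_sphere v.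
Proof.
move=> cu cv uv; rewrite -subr_ge0 -int_sphereB// int_sphere_ge0//.
  by move=> y y1; apply: cfD; [exact: cv|apply: cfN; exact: cu].
by move=> y y1; rewrite subr_ge0 uv.
Qed.

Lemma int_sphere_bound u (M : R) : sphere_continuous u ->
  (forall y, enorm y = 1 -> `|u y| <= M) -> `|int_sphere u| <= M * int_sphere (fun _ : V => 1).
Proof.
move=> cu uM; have cc (c : R) : int_sphere (fun _ : V => c) = c * int_sphere (fun _ : V => 1).
  rewrite -int_sphereZ; last exact: sphere_continuousC.
  by congr int_sphere; apply/funext => x; rewrite mulr1.
rewrite ler_norml -mulNr -!cc; apply/andP; split; apply: int_sphere_le => //;
  try exact: sphere_continuousC; by move=> y /uM; rewrite ler_norml => /andP[].
Qed.

Lemma int_sphere_dct (M : R) (u : nat -> V -> R) v :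
  (forall k, sphere_continuous (u k)) -> sphere_continuous v ->
  (forall k y, enorm y = 1 -> `|u k y| <= M) ->
  (forall y, enorm y = 1 -> u k y @[k --> \oo] --> v y) ->
  int_sphere (u k) @[k --> \oo] --> int_sphere v.
Proof.
move=> cu cv uM uv; under eq_fun do rewrite int_sphereE//.
rewrite int_sphereE//; apply: cvgM; first exact: cvg_cst.
have B k x : `|ball_ext 1 1 (u k) x| <= `|M|.
  rewrite /ball_ext; case: ifP => x1; last by rewrite normr0.
  rewrite expr1; have [->|x0] := eqVneq x 0; first by rewrite enorm0 mul0r normr0.
  rewrite normrM (ger0_norm (enorm_ge0 x)).
  have := uM k _ (enorm_normalize x0); have := ler_norm M; have := enorm_ge0 x.
  have := normr_ge0 (u k ((enorm x)^-1 *: x)); nra.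
have nk k : nice 1 `|M| (ball_ext 1 1 (u k)).
  by have [N [_ H1 H2]] := nice_ball_ext 1 ltr01 (cu k); split => // x; exact: B.
apply: (nice_dct ler01 nk _).2 => x; rewrite /ball_ext.
case: ifP => _; last exact: cvg_cst.
rewrite expr1; have [->|x0] := eqVneq x 0.
  by under eq_fun do rewrite enorm0 mul0r; rewrite enorm0 mul0r; exact: cvg_cst.
by apply: cvgM; [exact: cvg_cst|apply: uv; rewrite enorm_normalize].
Qed.

(** Positivity of [intRn] is available for continuous integrands, and the extension jumps at the
    boundary of the ball. It dominates its product with the positive part of [1 - |x|], which is
    continuous and positive at [y / 2]. *)
Lemma int_sphere_gt0 u y : sphere_continuous u ->
  (forall y, enorm y = 1 -> 0 <= u y) -> enorm y = 1 -> 0 < u y -> 0 < int_sphere u.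
Proof.
move=> cu u0 y1 uy; rewrite int_sphereE// mulr_gt0//.
have pE (s : R) : 0 <= s -> posp s = s by move=> s0; rewrite /posp ger0_norm//; lra.
have p0 (s : R) : s <= 0 -> posp s = 0 by move=> s0; rewrite /posp ler0_norm// subrr mul0r.
have ct x : {for x, continuous (fun y : V => posp (1 - enorm y))}.
  have ct : {for x, continuous (fun y : V => 1 - enorm y)}.
    by apply: cfD; [exact: cfC|apply: cfN; exact: continuous_enorm].
  by apply: cfM; [apply: cfD => //; exact: cf_norm|exact: cfC].
pose g x := ball_ext 1 1 u x * posp (1 - enorm x).
have [B uB] := sphere_bounded cu.
have bB := ball_ext_bound 1 ltr01 uB; rewrite expr1n mul1r in bB.
have cg x : {for x, continuous g}.
  have [x1|x1] := leP 1 (enorm x).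
    apply: (@continuous_squeeze _ _ _ (fun x => (`|B| + `|u 0|) * posp (1 - enorm x))).
    - move=> z; rewrite normrM ler_pM//.
      by case: (leP (enorm z) 1) => z1; [rewrite pE ?subr_ge0// ger0_norm// subr_ge0|rewrite p0 ?normr0// subr_le0 ltW].
    - by rewrite p0 ?mulr0// subr_le0.
    - by apply: cfM; [exact: cfC|exact: ct].
  apply: cfM => //.
  have [->|x0] := eqVneq x 0.
    apply: (@continuous_squeeze _ _ _ (fun z => `|B| * enorm z)).
    - move=> z; rewrite /ball_ext; case: ifP => _; last by rewrite normr0 mulr_ge0 ?enorm_ge0.
      rewrite expr1; have [->|z0] := eqVneq z 0; first by rewrite enorm0 mul0r normr0 mulr0.
      rewrite normrM (ger0_norm (enorm_ge0 z)) [leRHS]mulrC ler_wpM2l ?enorm_ge0//.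
      by rewrite (le_trans (uB _ (enorm_normalize z0)))// ler_norm.
    - by rewrite enorm0 mulr0.
    - by apply: cfM; [exact: cfC|exact: continuous_enorm].
  apply: (@continuous_near _ _ (fun y => enorm y ^+ 1 * u ((enorm y)^-1 *: y))).
    have /cvgr_lt/(_ _ x1) : enorm y @[y --> x] --> enorm x by exact: continuous_enorm.
    by apply: filterS => z zt; rewrite /ball_ext zt.
  apply: cfM; first by apply: cfX; exact: continuous_enorm.
  apply: (@continuous_comp _ _ _ (fun y : V => (enorm y)^-1 *: y) u).
    apply: (@continuousZ R V V) => //.
    by apply: cfV; [rewrite gt_eqF// enorm_gt0|exact: continuous_enorm].
  by apply: cu; rewrite enorm_normalize.
have b0 x : 0 <= ball_ext 1 1 u x.
  rewrite /ball_ext; case: ifP => // _; rewrite expr1.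
  have [->|x0] := eqVneq x 0; first by rewrite enorm0 mul0r.
  by rewrite mulr_ge0 ?enorm_ge0// u0// enorm_normalize.
have g01 x : 0 <= g x <= ball_ext 1 1 u x.
  rewrite /g; have := b0 x; have := enorm_ge0 x; case: (leP (enorm x) 1) => x1.
    by rewrite pE ?subr_ge0//; nra.
  by rewrite p0 ?mulr0 ?subr_le0 ?(ltW x1)// => _ ->; rewrite lexx.
have ng : nice 1 (`|B| + `|u 0|) g.
  apply: continuous_nice => // [x|x i xi].
    by apply: le_trans (bB x); have /andP[g0 g1] := g01 x; rewrite (ger0_norm g0) (ger0_norm (b0 x)).
  by rewrite /g p0 ?mulr0// subr_le0 ltW// (lt_le_trans xi)// coord_le_enorm.
have [M nu] := nice_ball_ext 1 ltr01 cu.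
apply: lt_le_trans (intRn_le ler01 ng nu _); last by move=> x; case/andP: (g01 x).
apply: (intRn_gt0 (x0 := 2^-1 *: y) ler01 _ ng) => // [x|].
  by case/andP: (g01 x).
have h0 : (0 : R) < 2^-1 by rewrite invr_gt0.
have e2 : enorm (2^-1 *: y) = 2^-1 by rewrite enormZ y1 mulr1 gtr0_norm.
rewrite /g /ball_ext e2 ifT; last by lra.
rewrite expr1 pE; last by lra.
rewrite scalerA invrK mulfV ?pnatr_eq0// scale1r !mulr_gt0//; lra.
Qed.

Lemma int_sphere_opp u : sphere_continuous u ->
  int_sphere (fun x => u (- x)) = int_sphere u.
Proof.
move=> cu; rewrite !int_sphere_ball_ext; congr (_ * _).
have [M nM] := nice_ball_ext 0 ltr01 cu.
have N1 : (-1 : R) != 0 by rewrite oppr_eq0 oner_eq0.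
have [_ <-] := nice_affine 0 ler01 N1 nM.
rewrite normrN1 expr1n mul1r; congr intRn; apply/funext => x.
rewrite addr0 /ball_ext enormZ normrN1 mul1r; case: ifP => // _.
by rewrite scalerA mulrN1 scaleNr.
Qed.

Lemma int_sphere_odd k (f : V -> R) : hp k f -> odd k -> int_sphere f = 0.
Proof.
move=> hf ok; have := int_sphere_opp (hp_sphere hf).
rewrite (_ : (fun x => f (- x)) = (fun x => -1 * f x)).
  by rewrite int_sphereZ; [lra|exact: hp_sphere hf].
apply/funext => x; rewrite -scaleN1r (hp_hom _ _ hf) -signr_odd ok.
by rewrite expr1.
Qed.

(** Translates have equal integrals, so each difference quotient integrates to 0; the mean value
    theorem bounds the quotients by [C], and dominated convergence passes to the derivative. *)
Lemma intRn_derive0 (K M C : R) (G : V -> R) (v : V) : 0 <= K -> nice K M G ->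
  (forall x, derivable G x v) -> (forall x, `|'D_v G x| <= C) ->
  intRn (fun x => 'D_v G x) = 0.
Proof.
move=> K0 nG dG DC.
pose h (k : nat) : R := k.+1%:R^-1.
have h0 k : 0 < h k by rewrite invr_gt0.
have h1 k : h k <= 1 by rewrite invf_le1// ler1n.
pose q k x := k.+1%:R * (G (h k *: v + x) - G x).
have K0' : 0 <= K + `|v| by rewrite addr_ge0.
have nG' : nice (K + `|v|) M G by apply: nice_weaken nG; rewrite ?lerDl.
have sh k : nice (K + `|v|) M (fun x => G (h k *: v + x)) /\
    intRn (fun x => G (h k *: v + x)) = intRn G.
  have [n1 n2] := nice_affine (h k *: v) K0 (oner_neq0 R) nG.
  rewrite normr1 expr1n divr1 mul1r in n1 n2.
  have E : (fun x => G (1 *: x + h k *: v)) = (fun x => G (h k *: v + x)).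
    by apply/funext => x; rewrite scale1r addrC.
  rewrite E in n1 n2; split=> //; apply: nice_weaken n1 => //.
  by rewrite lerD2l normrZ gtr0_norm// ler_piMl.
have nd k := nice_sub K0' (sh k).1 nG'.
have nq k : nice (K + `|v|) C (q k).
  have nz : nice (K + `|v|) 0 (fun _ : V => 0).
    by apply: continuous_nice => // [x|x]; [exact: cfC|rewrite normr0].
  have [n1 _] := nice_lin k.+1%:R K0' (nd k) nz.
  have E : (fun x => k.+1%:R * (G (h k *: v + x) - G x) + 0) = q k.
    by apply/funext => x; rewrite addr0.
  rewrite E in n1; have [_ H1 H2] := n1; split; [move=> x|exact: H1|exact: H2].
  rewrite /q; have [t _ ->] := @line_mvt R V G v x (h k) (ltW (h0 k)) (fun t _ => dG _).
  by rewrite mulrCA mulfV ?mulr1// pnatr_eq0.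
have iq j : intRn (q j) = 0.
  by rewrite (intRn_scale _ K0' (nd j)) (intRn_sub K0' (sh j).1 nG') (sh j).2 subrr mulr0.
have cq : forall x, q k x @[k --> \oo] --> 'D_v G x.
  move=> x; apply/cvgrPdist_le => e e0.
  have /is_deriveP/(_ e e0)[r r0 H] := derivableP (dG x).
  have /cvgr_lt/(_ _ r0) := @cvg_harmonic R; apply: filterS => k hr.
  have := H (h k); rewrite (gtr0_norm (h0 k)) => /(_ hr) H'.
  rewrite (_ : _ - q k x = - ((G (h k *: v + x) - G x - h k * 'D_v G x) / h k)).
    by rewrite normrN normf_div (gtr0_norm (h0 k)) ler_pdivrMr.
  by rewrite /q /h; field; rewrite nat1r pnatr_eq0.
have [_] := nice_dct K0' nq cq.
rewrite (_ : (fun k => _) = fun=> 0); last by apply/funext.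
by move=> /cvg_lim <- //; rewrite lim_cst.
Qed.

(** First order expansion of the squared positive part, whose derivative [2 posp b] is Lipschitz
    with constant 2. *)
Lemma posp_sqr_diff (b c : R) :
  `|posp c ^+ 2 - posp b ^+ 2 - 2 * posp b * (c - b)| <= (c - b) ^+ 2.
Proof.
have b2 := sqr_ge0 b; have c2 := sqr_ge0 c; have bc2 := sqr_ge0 (c - b).
rewrite /posp ler_norml.
case: (lerP 0 b) => b0; case: (lerP 0 c) => c0;
  rewrite ?(ger0_norm b0) ?(ger0_norm c0) ?(ltr0_norm b0) ?(ltr0_norm c0).
- by rewrite !expr2 in bc2 *; apply/andP; split; lra.
- have : 0 <= b * - c by rewrite mulr_ge0// oppr_ge0 ltW.
  by rewrite !expr2 in b2 c2 bc2 *; move=> ?; apply/andP; split; lra.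
- have : 0 <= - b * c by rewrite mulr_ge0// oppr_ge0 ltW.
  by rewrite !expr2 in b2 c2 bc2 *; move=> ?; apply/andP; split; lra.
- by rewrite !expr2 in bc2 *; apply/andP; split; lra.
Qed.

Lemma is_derive_posp_sqr x (v : V) : is_derive x v (fun x => posp (1 - dotp x x) ^+ 2)
  (- 4 * posp (1 - dotp x x) * dotp v x).
Proof.
set b := 1 - dotp x x.
apply: (@is_derive_quadratic _ _ _ _ _ _
  ((2 * `|dotp v x| + dotp v v) ^+ 2 + 2 * `|posp b| * dotp v v) 1) => // h h1.
set c := 1 - dotp (h *: v + x) (h *: v + x).
have cb : c - b = - (2 * h * dotp v x + h ^+ 2 * dotp v v).
  by rewrite /c /b !(dotpDl, dotpDr, dotpZl, dotpZr) (dotpC x v); ring.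
have -> : posp c ^+ 2 - posp b ^+ 2 - h * (- 4 * posp b * dotp v x) =
  (posp c ^+ 2 - posp b ^+ 2 - 2 * posp b * (c - b)) - 2 * posp b * (h ^+ 2 * dotp v v).
  by rewrite cb; ring.
rewrite (le_trans (ler_normB _ _))// [leRHS]mulrDl lerD//.
  apply: le_trans (posp_sqr_diff _ _) _; rewrite cb sqrrN -exprMn.
  rewrite -[leLHS]real_normK ?num_real// ler_pXn2r ?nnegrE ?mulr_ge0 ?addr_ge0 ?dotp_ge0//.
  rewrite (le_trans (ler_normD _ _))// [leRHS]mulrDl lerD//.
    by rewrite !normrM (ger0_norm (_ : (0 : R) <= 2))// mulrAC.
  rewrite normrM normrX (ger0_norm (dotp_ge0 v)) mulrC ler_wpM2l ?dotp_ge0//.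
  by rewrite expr2 ler_piMl// ltW.
have -> : 2 * posp b * (h ^+ 2 * dotp v v) = (2 * dotp v v * h ^+ 2) * posp b by ring.
have p : 0 <= 2 * dotp v v * h ^+ 2.
  by apply: mulr_ge0; [apply: mulr_ge0; [exact: ler0n|exact: dotp_ge0]|exact: sqr_ge0].
rewrite normrM (ger0_norm p) real_normK ?num_real//.
by rewrite le_eqVlt; apply/orP; left; apply/eqP; ring.
Qed.

Lemma ball_ext_hp k j (f : V -> R) x : hp k f ->
  ball_ext (k + j) 1 f x = if enorm x < 1 then enorm x ^+ j * f x else 0.
Proof.
move=> hf; rewrite /ball_ext; case: ifP => // _.
rewrite addnC exprD -mulrA -(hp_hom _ _ hf) scalerA.
have [->|x0] := eqVneq x 0; first by rewrite !scaler0.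
by rewrite mulfV ?scale1r// enorm_eq0.
Qed.

(** Squaring the cut-off makes it differentiable across the sphere. Inside the ball the derivative
    of [P (1 - |x|^2)^2] is a sum of five homogeneous terms; by [polar] each integral is a spherical
    integral divided by [d] plus the degree, and the vanishing of their sum is the claim. *)
Lemma sphere_green k (P : V -> R) (v : V) : hp k.+1 P ->
  int_sphere (fun x => 'D_v P x) = (k + d)%:R * int_sphere (fun x => dotp v x * P x).
Proof.
move=> hP; set A := (fun x => 'D_v P x); set Q := (fun x => dotp v x * P x).
have hA : hp k A by have [M /(hpb_derive v)[_ H]] := hP; exists (k.+1%:R * `|v| * M).
have hQ : hp k.+2 Q by exact: (hp_mul (hp_dotp v) hP).
have cA := hp_sphere hA; have cQ := hp_sphere hQ.
have pE (s : R) : 0 <= s -> posp s = s by move=> s0; rewrite /posp ger0_norm//; lra.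
have p0 (s : R) : s <= 0 -> posp s = 0 by move=> s0; rewrite /posp ler0_norm// subrr mul0r.
pose G x := P x * posp (1 - dotp x x) ^+ 2.
have DG x : is_derive x v G (P x * (- 4 * posp (1 - dotp x x) * dotp v x) +
   posp (1 - dotp x x) ^+ 2 * A x).
  apply: is_derive_mul; last exact: is_derive_posp_sqr.
  exact: (@hpz_is_derive _ _ k.+1).
have n1 x : (enorm x < 1) = (dotp x x < 1).
  by rewrite -enorm_sqr -[in RHS](expr1n _ 2) ltr_pXn2r ?nnegrE ?enorm_ge0.
have nA j := Nice_ball_ext (k + j) cA; have nQ j := Nice_ball_ext (k.+2 + j) cQ.
(* The coefficients are those of [(1 - s)^2 A - 4 (1 - s) Q] with [s = |x|^2], assembled from the
   inside out; the zero extension only starts the chain. *)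
have N5 := Nice_lin 4 (nQ 2%N) (Nice_ball_ext 0%N (sphere_continuousC 0)).
have N4 := Nice_lin (-4) (nQ 0%N) N5.1.
have N3 := Nice_lin 1 (nA 4%N) N4.1.
have N2 := Nice_lin (-2) (nA 2%N) N3.1.
have N1 := Nice_lin 1 (nA 0%N) N2.1.
have E : (fun x => 'D_v G x) = (fun x => 1 * ball_ext (k + 0)%N 1 A x + (-2 * ball_ext (k + 2)%N 1 A x +
   (1 * ball_ext (k + 4)%N 1 A x + (-4 * ball_ext (k.+2 + 0)%N 1 Q x +
   (4 * ball_ext (k.+2 + 2)%N 1 Q x + ball_ext 0 1 (fun=> 0) x))))).
  apply/funext => x; rewrite (derive_val (is_derive := DG x)) !ball_ext_hp//.
  rewrite [ball_ext 0 1 _ x]/ball_ext mulr0 if_same !addr0.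
  case: ifPn => [x1|]; last first.
    by rewrite n1 -leNgt => x1; rewrite p0 ?subr_le0//; ring.
  have e4 : enorm x ^+ 4 = dotp x x ^+ 2 by rewrite -enorm_sqr -exprM.
  rewrite e4 enorm_sqr pE /Q; last by rewrite subr_ge0 ltW// -n1.
  by ring.
have [M0 MG] : exists M, forall x, `|'D_v G x| <= M.
  have [M [H _ _]] := N1.1; exists M => x.
  by rewrite (congr1 (fun F => F x) E); exact: H.
have nG : Nice G.
  have [M hM] := hP; exists M; apply: nice_ball => //.
  - move=> x; case: (ltP (enorm x) 1) => x1.
      rewrite /G normrM -[leRHS]mulr1 ler_pM//.
        rewrite (le_trans (hpb_le _ hM))// ler_piMr ?(hpb_ge0 hM)// exprn_ile1//.
        by rewrite ltW// (le_lt_trans (norm_le_enorm x)).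
      have x1' : dotp x x < 1 by rewrite -n1.
      rewrite pE ?subr_ge0 ?(ltW x1')// ger0_norm ?sqr_ge0//.
      by rewrite exprn_ile1// ?subr_ge0 ?(ltW x1')// lerBlDr lerDl dotp_ge0.
    rewrite /G p0 ?expr0n ?mulr0 ?normr0 ?(hpb_ge0 hM)//.
    by rewrite subr_le0 leNgt -n1 -leNgt.
  - by move=> x x1; rewrite /G p0 ?expr0n ?mulr0// subr_le0 leNgt -n1 -leNgt.
  - move=> x _ _; apply: cfM; first exact: hp_continuous hP _.
    have cb : {for x, continuous (fun x : V => 1 - dotp x x)}.
      by apply: cfD; [exact: cfC|apply: cfN; exact: hp_continuous (hp_dotpxx _ _) _].
    by apply: cfX; apply: cfM; [apply: cfD => //; exact: cf_norm|exact: cfC].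
have [MG' nG'] := nG.
have I0 := intRn_derive0 ler01 nG' (fun x => ex_derive (is_derive := DG x)) MG.
rewrite E in I0; have := etrans (esym N1.2) I0; rewrite N2.2 N3.2 N4.2 N5.2.
have -> : intRn (ball_ext 0 1 (fun _ : V => 0)) = 0.
  rewrite (_ : ball_ext _ _ _ = fun=> 0) ?intRn0//.
  by apply/funext => x; rewrite /ball_ext mulr0 if_same.
have PA j := polar (k + j) cA; have PQ j := polar (k.+2 + j) cQ.
have := PA 0%N; have := PA 2%N; have := PA 4%N; have := PQ 0%N; have := PQ 2%N.
rewrite !addn0.
set I5 := intRn _; set I4 := intRn _; set I3 := intRn _; set I2 := intRn _; set I1 := intRn _.
have n0 : (0 : R) < (k + d)%:R by rewrite ltr0n addn_gt0 d_gt0 orbT.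
have -> : (k.+2 + 2 + d)%N%:R = (k + d)%:R + 4 :> R by rewrite -natrD; congr _%:R; lia.
have -> : (k.+2 + d)%:R = (k + d)%:R + 2 :> R by rewrite -natrD; congr _%:R; lia.
have -> : (k + 4 + d)%N%:R = (k + d)%:R + 4 :> R by rewrite -natrD; congr _%:R; lia.
have -> : (k + 2 + d)%N%:R = (k + d)%:R + 2 :> R by rewrite -natrD; congr _%:R; lia.
move: n0; set n := (k + d)%:R; set LA := int_sphere A; set LQ := int_sphere Q => n0 e1 e2 e3 e4 e5 H.
clearbody n; have [n1' n2' n4'] : [/\ n != 0, n + 2 != 0 & n + 4 != 0] by split; rewrite gt_eqF//; lra.
have E1 : I1 = LA / n by rewrite -e5 mulrC mulKf.
have E2 : I2 = LA / (n + 2) by rewrite -e4 mulrC mulKf.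
have E3 : I3 = LA / (n + 4) by rewrite -e3 mulrC mulKf.
have E4 : I4 = LQ / (n + 2) by rewrite -e2 mulrC mulKf.
have E5 : I5 = LQ / (n + 4) by rewrite -e1 mulrC mulKf.
(* Indeed [1/n - 2/(n+2) + 1/(n+4) = 8/(n (n+2) (n+4))] and
   [4/(n+4) - 4/(n+2) = - 8/((n+2) (n+4))]. *)
apply/eqP; rewrite -subr_eq0.
have -> : LA - n * LQ = n * (n + 2) * (n + 4) / 8 *
    (1 * I1 + (-2 * I2 + (1 * I3 + (-4 * I4 + (4 * I5 + 0))))).
  by rewrite E1 E2 E3 E4 E5; field; rewrite ?n1' ?n2' ?n4'.
by rewrite H mulr0.
Qed.

Lemma derive_refl (a v : V) (f : V -> R) x : 'D_v (f \o refl a) x = 'D_(refl a v) f (refl a x).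
Proof.
rewrite /derive.
have -> // : (fun h => h^-1 *: (((f \o refl a) \o shift x) (h *: v) - (f \o refl a) x)) =
  (fun h => h^-1 *: ((f \o shift (refl a x)) (h *: refl a v) - f (refl a x))).
by apply/funext => h /=; rewrite reflD reflZ.
Qed.

Lemma hp0_cst (f : V -> R) x : hp 0 f -> f x = f 0.
Proof. by move=> hf; have := hp_hom 0 x hf; rewrite scale0r expr0 mul1r. Qed.

(** Integration by parts trades a factor [x_i] for a derivative, which lowers the degree by 2, and
    derivatives transform under [r_a] by the chain rule. Degree 0 is constant, and degree 1
    integrates to 0 by parity. *)
Lemma int_sphere_refl_hp (a : V) k (f : V -> R) : hp k f -> int_sphere (f \o refl a) = int_sphere f.
Proof.
(* All degrees up to [K] are treated together, since degree [k + 2] falls back on degree [k]. *)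
suff H K : forall k f, hp k f -> (k <= K)%N -> int_sphere (f \o refl a) = int_sphere f.
  by move=> hf; exact: (H k k f hf (leqnn k)).
elim: K => [|K IH] {}k {}f.
  move=> hf; rewrite leqn0 => /eqP k0; rewrite k0 in hf.
  by congr int_sphere; apply/funext => x /=; rewrite hp0_cst// [RHS]hp0_cst.
elim/hp_induction => {k f} [b|k i f hf _|k f g hf I1 hg I2|k] kK.
- by [].
- case: k kK hf => [|k] kK hf.
    rewrite (@int_sphere_odd 1 (fun x => x 0 i * f x)); [|exact: hp_mulx|by []].
    by rewrite (@int_sphere_odd 1 (_ \o _))//; apply: hp_refl; exact: hp_mulx.
  have n0 : ((k + d)%:R : R) != 0 by rewrite pnatr_eq0 addn_eq0 negb_and -!lt0n d_gt0 orbT.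
  apply: (mulfI n0).
  have -> : (fun x => x 0 i * f x) \o refl a =
      (fun x => dotp (refl a (delta_mx 0 i)) x * (f \o refl a) x).
    by apply/funext => x /=; rewrite refl_sym dotp_delta.
  have -> : (fun x => x 0 i * f x) = (fun x => dotp (delta_mx 0 i) x * f x).
    by apply/funext => x /=; rewrite dotp_delta.
  rewrite -!sphere_green//; last exact: hp_refl.
  have hD : hp k (fun x => 'D_(delta_mx 0 i) f x).
    by have [M /(hpb_derive (delta_mx 0 i))[_ H]] := hf; exists (k.+1%:R * `|delta_mx 0 i : V| * M).
  rewrite -(IH k _ hD (ltnW (kK : (k < K)%N))).
  by congr int_sphere; apply/funext => x; rewrite derive_refl reflK.
- rewrite int_sphereD; [|exact: hp_sphere hf|exact: hp_sphere hg].
  rewrite -I1// -I2// -int_sphereD//.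
    by apply: hp_sphere; apply: hp_refl; exact: hf.
  by apply: hp_sphere; apply: hp_refl; exact: hg.
- by [].
Qed.

End SphereFunctional.

(** * Binomial series *)

Section BinomialSeries.
Variable R : realType.
Variable k : R.
Hypothesis k0 : 0 <= k.

(** Coefficient of [u ^ n] in the expansion of [(1 - u) ^ k]. *)
Definition binc (n : nat) : R := \prod_(i < n) ((i%:R - k) / i.+1%:R).
Definition binpoly (n : nat) : {poly R} := \sum_(i < n.+1) binc i *: 'X^i.

Lemma binc0 : binc 0 = 1. Proof. by rewrite /binc big_ord0. Qed.

Lemma bincS n : binc n.+1 = binc n * ((n%:R - k) / n.+1%:R).
Proof. by rewrite /binc big_ord_recr. Qed.

Lemma binpoly0 u : (binpoly 0).[u] = 1.
Proof. by rewrite /binpoly big_ord_recr big_ord0 /= add0r hornerZ hornerXn binc0 expr0 mulr1. Qed.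

Lemma binpolyS n u : (binpoly n.+1).[u] = (binpoly n).[u] + binc n.+1 * u ^+ n.+1.
Proof. by rewrite /binpoly big_ord_recr /= hornerD hornerZ hornerXn. Qed.

Lemma binc_binpoly n : n.+1%:R * binc n.+1 = - k * (binpoly n).[1].
Proof.
elim: n => [|n IH]; first by rewrite bincS binc0 binpoly0 sub0r divr1 !mul1r mulr1.
rewrite binpolyS expr1n mulr1 mulrDr -IH [in LHS]bincS.
rewrite [LHS]mulrCA [n.+2%:R * _]mulrC divfK ?pnatr_eq0//.
by ring.
Qed.

(** This product form of the partial sums at 1 drives both the summability of the coefficients and
    the limit at the endpoint. *)
Lemma binpoly1S n : (binpoly n.+1).[1] = (binpoly n).[1] * (1 - k / n.+1%:R).
Proof.
rewrite binpolyS expr1n mulr1.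
have : binc n.+1 = n.+1%:R^-1 * (- k * (binpoly n).[1]).
  by rewrite -binc_binpoly mulKf// pnatr_eq0.
by move=> ->; ring.
Qed.

Lemma deriv_binpolyS n u : ((binpoly n.+1)^`()).[u] =
  ((binpoly n)^`()).[u] + n.+1%:R * binc n.+1 * u ^+ n.
Proof.
rewrite /binpoly big_ord_recr /= derivD derivZ derivXn hornerD hornerZ hornerMn hornerXn /=.
by rewrite -mulr_natl; ring.
Qed.

(* [(1 - u) ^ k] solves [(1 - u) y' = - k y]; the truncated series does up to its last term. *)
Lemma binpoly_ode n u : (1 - u) * ((binpoly n)^`()).[u] =
  - (k * ((binpoly n).[u] - (binpoly n).[1] * u ^+ n)).
Proof.
elim: n => [|n IH].
  rewrite !binpoly0 expr0 mulr1 subrr mulr0 oppr0.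
  by rewrite /binpoly big_ord_recr big_ord0 /= add0r derivZ derivXn mulr0n scaler0 horner0 mulr0.
rewrite deriv_binpolyS mulrDr IH binc_binpoly !binpolyS expr1n mulr1 exprS.
by ring.
Qed.

(** Let [S_n] be the partial sum at 1. From the index [N >= k] on, [|binc (n+1)| = (k / (n+1)) |S_n|
    = |S_n| - |S_(n+1)|], so the absolute series telescopes. *)
Lemma binc_summable : exists C : R, forall n, \sum_(i < n.+1) `|binc i| <= C.
Proof.
have [N kN] : exists N : nat, k <= N%:R.
  by exists (Num.bound k); rewrite ltW// archi_boundP.
exists (\sum_(i < N.+1) `|binc i| + `|(binpoly N).[1]|) => n.
have tel j : \sum_(i < (N + j).+1) `|binc i| + `|(binpoly (N + j)).[1]| =
    \sum_(i < N.+1) `|binc i| + `|(binpoly N).[1]|.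
  elim: j => [|j <-]; first by rewrite addn0.
  rewrite addnS big_ord_recr /= -addrA; congr (_ + _).
  have n1 : (0 : R) < (N + j).+1%:R by rewrite ltr0n.
  have kn : k / (N + j).+1%:R <= 1.
    by rewrite ler_pdivrMr// mul1r (le_trans kN)// ler_nat -addnS leq_addr.
  have -> : binc (N + j).+1 = - (k / (N + j).+1%:R * (binpoly (N + j)).[1]).
    apply: (mulfI (lt0r_neq0 n1)); rewrite binc_binpoly.
    by rewrite mulrN mulrA [_ * (k / _)]mulrC divfK ?gt_eqF// mulNr.
  rewrite normrN normrM (ger0_norm (_ : 0 <= k / _)) ?divr_ge0// binpoly1S normrM.
  by rewrite (ger0_norm (_ : 0 <= 1 - _)) ?subr_ge0//; ring.
have [nN|Nn] := leqP n N; last first.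
  by rewrite -(tel (n - N)%N) subnKC ?lerDl// ltnW.
rewrite -[leLHS]addr0 lerD// -(subnKC nN).
elim: (N - n)%N => [|j IH]; first by rewrite addn0.
by rewrite addnS [leRHS]big_ord_recr /= (le_trans IH)// lerDl.
Qed.

Lemma binpoly_le (C : R) n u : (forall n, \sum_(i < n.+1) `|binc i| <= C) -> 0 <= u <= 1 ->
  `|(binpoly n).[u]| <= C.
Proof.
move=> HC /andP[u0 u1]; apply: le_trans (HC n).
rewrite horner_sum (le_trans (ler_norm_sum _ _ _))//; apply: ler_sum => i _.
rewrite hornerZ hornerXn normrM (ger0_norm (exprn_ge0 _ u0)).
by rewrite ler_piMr// exprn_ile1.
Qed.

Lemma cvg_binpoly1 : 0 < k -> (binpoly n).[1] @[n --> \oo] --> (0 : R).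
Proof.
move=> kgt.
have [N kN] : exists N : nat, k <= N%:R.
  by exists (Num.bound k); rewrite ltW// archi_boundP.
pose S := @series R harmonic.
have SS n : S n.+1 = S n + n.+1%:R^-1 by rewrite /S /series /= big_nat_recr.
(* By [(1 - q) (1 + s + q) <= 1 + s] for [q, s >= 0], the product of the factors [1 - k / i] decays
   at least like the inverse of 1 plus [k] times a harmonic sum, which diverges. *)
have decay j : `|(binpoly (N + j)).[1]| * (1 + k * (S (N + j)%N - S N)) <= `|(binpoly N).[1]|.
  elim: j => [|j IH]; first by rewrite addn0 subrr mulr0 addr0 mulr1.
  apply: le_trans IH; rewrite addnS SS binpoly1S normrM -mulrA ler_wpM2l//.
  have n1 : (0 : R) < (N + j).+1%:R by rewrite ltr0n.
  have kn : k / (N + j).+1%:R <= 1.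
    by rewrite ler_pdivrMr// mul1r (le_trans kN)// ler_nat -addnS leq_addr.
  have kn0 : 0 <= k / (N + j).+1%:R by rewrite divr_ge0.
  rewrite ger0_norm ?subr_ge0//.
  have Smon : 0 <= S (N + j)%N - S N.
    rewrite subr_ge0; elim: j {n1 kn kn0} => [|j IH]; first by rewrite addn0.
    by rewrite addnS SS (le_trans IH)// lerDl.
  have kS : 0 <= k * (S (N + j)%N - S N) by rewrite mulr_ge0.
  set s := S (N + j)%N - S N in kS *; set q := k / _ in kn kn0 *.
  have -> : 1 + k * (S (N + j)%N + (N + j).+1%:R^-1 - S N) = 1 + k * s + q by rewrite /s /q; ring.
  have : 0 <= q * (k * s) by rewrite mulr_ge0.
  have : 0 <= q * q by rewrite mulr_ge0.
  lra.
have Soo : S n @[n --> \oo] --> +oo.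
  apply: nondecreasing_dvgn_lt; last exact: dvg_harmonic.
  by apply/nondecreasing_seqP => n; rewrite SS lerDl.
apply/cvgrPdist_le => e e0.
have /cvgryPge/(_ (`|(binpoly N).[1]| / (e * k) + S N))[m _ H] := Soo.
exists (maxn N m) => // n /=; rewrite geq_max => /andP[Nn mn].
rewrite sub0r normrN.
have := decay (n - N)%N; rewrite subnKC//; have := H _ mn => /=.
rewrite -lerBrDr ler_pdivrMr ?mulr_gt0// => H1 H2.
have := normr_ge0 (binpoly n).[1]; set p := `|(binpoly n).[1]| in H2 *; move=> p0.
have [//|pe] := leP p e.
set s := S n - S N in H1 H2.
have H3 : p * (k * s) <= s * (e * k) by nra.
have [s0|s0] := ltP 0 s; last first.
  have b0 := normr_ge0 (binpoly N).[1].
  have : s * (e * k) <= 0 by rewrite mulr_le0_ge0// mulr_ge0// ltW.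
  have : e * k > 0 by rewrite mulr_gt0.
  nra.
have : (p - e) * (k * s) > 0 by rewrite !mulr_gt0// subr_gt0.
lra.
Qed.

(** Division by [(1 - u) ^ k] leaves in the derivative only the defect of the differential equation,
    the term with [u ^ n]. *)
Lemma is_derive_binpoly_quotient n (u : R) : u < 1 ->
  is_derive u 1 (fun v => (binpoly n).[v] * expR (- k * ln (1 - v)))
    (k * (binpoly n).[1] * u ^+ n * expR (- k * ln (1 - u)) / (1 - u)).
Proof.
move=> u1; have u1' : 0 < 1 - u by rewrite subr_gt0.
have d1 : is_derive u (1:R) (fun v : R => 1 - v) (-1).
  apply: (@is_derive_quadratic _ _ _ _ _ _ 0 1) => // h _.
  by rewrite [h *: 1]mulr1 mul0r normr_le0; apply/eqP; ring.
have dl := is_derive1_ln u1'.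
have d2 : is_derive u (1:R) (fun v : R => ln (1 - v)) ((1 - u)^-1 * -1) :=
  @is_derive1_comp _ (@ln R) (fun v => 1 - v) u _ _ dl d1.
have d3 : is_derive u (1:R) (fun v : R => - k * ln (1 - v)) (- k * ((1 - u)^-1 * -1)) :=
  is_deriveZ (- k) d2.
have d4 : is_derive u (1:R) (fun v : R => expR (- k * ln (1 - v)))
    (expR (- k * ln (1 - u)) * (- k * ((1 - u)^-1 * -1))) :=
  @is_derive1_comp _ expR (fun v => - k * ln (1 - v)) u _ _ (is_derive_expR _) d3.
have d5 : is_derive u (1:R) (fun v => (binpoly n).[v] * expR (- k * ln (1 - v)))
    ((binpoly n).[u] * (expR (- k * ln (1 - u)) * (- k * ((1 - u)^-1 * -1))) +
     expR (- k * ln (1 - u)) * ((binpoly n)^`()).[u]) :=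
  is_deriveM (is_derive_poly (binpoly n) u) d4.
apply: (is_derive_eq d5).
have := binpoly_ode n u; set D := _^`().[u] => E.
have -> : D = - (k * ((binpoly n).[u] - (binpoly n).[1] * u ^+ n)) / (1 - u).
  by rewrite -E mulrC mulKf// gt_eqF.
by ring.
Qed.

(** The quotient of the truncated series by [(1 - u) ^ k] is 1 at 0 and has derivative [O(u ^ n)] on
    the segment, so the mean value theorem gives geometric convergence. *)
Lemma cvg_binpoly (u : R) : 0 <= u -> u < 1 -> (binpoly n).[u] @[n --> \oo] --> (1 - u) `^ k.
Proof.
move=> u0 u1; have u1' : 0 < 1 - u by rewrite subr_gt0.
have [C HC] := binc_summable.
pose g v := expR (- k * ln (1 - v)).
have g0 v : 0 < g v by exact: expR_gt0.
pose G := k * C * (g u / (1 - u)) * u.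
have C0 : 0 <= C by apply: le_trans (HC 0%N); rewrite sumr_ge0.
have H (n : nat) : `|(binpoly n).[u] * g u - 1| <= G * u ^+ n.
  have [||c /andP[]] := @MVT_segment R (fun v => (binpoly n).[v] * g v)
    (fun v => k * (binpoly n).[1] * v ^+ n * g v / (1 - v)) 0 u u0.
  - move=> v; rewrite in_itv/= => /andP[v0 vu].
    by apply: is_derive_binpoly_quotient; apply: lt_trans vu u1.
  - apply: derivable_within_continuous => v; rewrite in_itv/= => /andP[v0 vu].
    by case: (is_derive_binpoly_quotient n (le_lt_trans vu u1)).
  rewrite !bnd_simp => c0 cu.
  have -> : (binpoly n).[0] * g 0 = 1.
    rewrite /g subr0 ln1 mulr0 expR0 mulr1.
    elim: (n) => [|m IH]; first exact: binpoly0.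
    by rewrite binpolyS IH expr0n mulr0 addr0.
  move=> ->; rewrite subr0.
  have c1 : 0 < 1 - c by lra.
  have cn : 0 <= c ^+ n by rewrite exprn_ge0.
  rewrite normrM (ger0_norm u0) /G [leRHS]mulrAC ler_wpM2r//.
  have Cn := binpoly_le n HC (_ : 0 <= 1 <= 1); rewrite ler01 lexx in Cn.
  rewrite !normrM normfV (ger0_norm k0) (ger0_norm cn) (gtr0_norm (g0 c)) (gtr0_norm c1).
  have -> : k * C * (g u / (1 - u)) * u ^+ n = k * C * u ^+ n * g u / (1 - u) by ring.
  apply: ler_pM; rewrite ?invr_ge0 ?mulr_ge0 ?(ltW (g0 _)) ?(ltW c1)//.
    apply: ler_pM; rewrite ?mulr_ge0 ?(ltW (g0 _))//.
      apply: ler_pM; rewrite ?mulr_ge0//.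
        by rewrite ler_wpM2l// Cn.
      by apply: lerXn2r; rewrite ?nnegrE.
    rewrite ler_expR !mulNr lerN2 ler_wpM2l// ler_ln ?posrE//; lra.
  by rewrite lef_pV2 ?posrE//; lra.
have cG : G * u ^+ n @[n --> \oo] --> (0 : R).
  rewrite -[X in _ --> X](mulr0 G); apply: cvgMr; apply: cvg_expr.
  by rewrite ger0_norm.
have c1 : (binpoly n).[u] * g u @[n --> \oo] --> (1 : R).
  apply/cvgrPdist_le => e e0.
  have /cvgrPdist_le/(_ _ e0) := cG; apply: filterS => n; rewrite sub0r normrN distrC.
  by move=> He; apply: le_trans (H n) (le_trans (ler_norm _) He).
have -> : (1 - u) `^ k = 1 * (g u)^-1.
  by rewrite /powR gt_eqF// /g mulNr expRN invrK mul1r.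
rewrite (_ : (fun n => _) = (fun n => (binpoly n).[u] * g u * (g u)^-1)).
  by apply: cvgM => //; exact: cvg_cst.
by apply/funext => n; rewrite mulfK// gt_eqF.
Qed.

(** By [binpoly_ode] this is [- (1 - u)] times the derivative of the truncated series. Unlike that
    derivative it stays bounded and convergent on all of [[0, 1]]. *)
Definition binrem n u := k * ((binpoly n).[u] - (binpoly n).[1] * u ^+ n).

Lemma binomial_approximation : exists C : R, forall u : R, 0 <= u <= 1 ->
  [/\ forall n, `|(binpoly n).[u]| <= C, forall n, `|binrem n u| <= C,
      (binpoly n).[u] @[n --> \oo] --> (1 - u) `^ k &
      binrem n u @[n --> \oo] --> k * (1 - u) `^ k].
Proof.
have [C HC] := binc_summable.
have C0 : 0 <= C by apply: le_trans (HC 0%N); rewrite sumr_ge0.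
exists (C + k * (C + C)) => u /andP[u0 u1].
have u01 : 0 <= u <= 1 by rewrite u0.
have o01 : 0 <= (1 : R) <= 1 by rewrite ler01 lexx.
have bu n := binpoly_le n HC u01; have b1 n := binpoly_le n HC o01.
have kCC : 0 <= k * (C + C) by rewrite mulr_ge0 ?addr_ge0.
have un n : 0 <= u ^+ n <= 1 by rewrite exprn_ge0//= exprn_ile1.
split.
- by move=> n; rewrite (le_trans (bu n))// lerDl.
- move=> n; rewrite /binrem normrM (ger0_norm k0).
  apply: le_trans (_ : k * (C + C) <= _); last by rewrite lerDr.
  rewrite ler_wpM2l// (le_trans (ler_normB _ _))// lerD// normrM.
  have /andP[a b] := un n; rewrite (ger0_norm a).
  by rewrite (le_trans _ (b1 n))// ler_piMr.
- have [ult|ule] := ltP u 1; first exact: cvg_binpoly.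
  (* The endpoint corresponds to a reflecting hyperplane. There [(1 - u) ^ k] is 0 for [k > 0] but 1
     for [k = 0], by the convention of [powR]. *)
  have -> : u = 1 by apply/eqP; rewrite eq_le u1.
  rewrite subrr; have [kgt|kle] := ltP 0 k.
    by rewrite powR0 ?gt_eqF//; exact: cvg_binpoly1.
  have kz : k = 0 by apply/eqP; rewrite eq_le kle.
  rewrite kz powRr0 (_ : (fun n => _) = fun=> 1); first exact: cvg_cst.
  apply/funext; elim=> [|n IH]; first exact: binpoly0.
  by rewrite binpoly1S IH kz mul0r subr0 mulr1.
- have [ult|ule] := ltP u 1.
    apply: cvgMr; rewrite -[X in _ --> X]subr0; apply: cvgB; first exact: cvg_binpoly.
    apply/cvgrPdist_le => e e0.
    have cC : C * u ^+ n @[n --> \oo] --> (0 : R).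
      rewrite -[X in _ --> X](mulr0 C); apply: cvgMr; apply: cvg_expr.
      by rewrite ger0_norm.
    have /cvgrPdist_le/(_ _ e0) := cC; apply: filterS => n; rewrite !sub0r !normrN.
    apply: le_trans; rewrite normrM [leRHS]normrM ler_pM//.
    by rewrite (le_trans (b1 n))// ler_norm.
  have -> : u = 1 by apply/eqP; rewrite eq_le u1.
  rewrite subrr (_ : (fun n => _) = fun=> 0).
    have [kgt|kle] := ltP 0 k; first by rewrite powR0 ?gt_eqF// mulr0; exact: cvg_cst.
    have kz : k = 0 by apply/eqP; rewrite eq_le kle.
    by rewrite kz mul0r; exact: cvg_cst.
  by apply/funext => n; rewrite /binrem expr1n mulr1 subrr mulr0.
Qed.

End BinomialSeries.

(** * Dunkl operators on polynomials *)

Section DifferenceQuotients.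
Variables (R : realType) (d : nat).
Local Notation V := 'rV[R]_d.
Implicit Types (f g : V -> R) (x y a b v : V).

Lemma derive_oppv f x v : derivable f x v -> is_derive x (- v) f (- 'D_v f x).
Proof.
move=> /derivableP/is_deriveP H; apply/is_deriveP => e /H[r r0 {}H]; exists r => // h hr.
have := H (- h); rewrite normrN => /(_ hr).
by rewrite scalerN -scaleNr mulNr mulrN.
Qed.

Lemma dquot_eq a f x : a != 0 -> f x - f (refl a x) = dotp a x * dquot a f x.
Proof.
move=> a0; rewrite /dquot; case: ifPn => [ax|]; first by rewrite mulrC divfK.
by rewrite negbK => /eqP ax; rewrite refl_fix// subrr ax mul0r.
Qed.

Lemma dquot_refl a b f x : dquot b (f \o refl a) x = dquot (refl a b) f (refl a x).
Proof. by rewrite /dquot !dotp_refl derive_refl /= refl_conj. Qed.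

Lemma dquot_opp a f x : derivable f x a -> dquot (- a) f x = - dquot a f x.
Proof.
move=> df; rewrite /dquot dotpNl oppr_eq0 refl_opp !(dotpNl, dotpNr) opprK.
case: ifP => _; first by rewrite invrN mulrN.
by rewrite (derive_val (is_derive := derive_oppv df)) mulrN.
Qed.

Lemma dquotM a f g x : a != 0 -> derivable f x a -> derivable g x a ->
  dquot a (fun y => f y * g y) x =
  f x * dquot a g x + g x * dquot a f x - dotp a x * dquot a f x * dquot a g x.
Proof.
move=> a0 df dg; rewrite /dquot; case: ifPn => [ax|].
  by field.
rewrite negbK => /eqP ax.
rewrite (derive_val (is_derive := is_derive_mul (derivableP df) (derivableP dg))) ax; ring.
Qed.

Lemma dquotD a f g x : derivable f x a -> derivable g x a ->
  dquot a (fun y => f y + g y) x = dquot a f x + dquot a g x.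
Proof.
move=> df dg; rewrite /dquot; case: ifP => _; first by ring.
by rewrite (derive_val (is_derive := is_derive_add (derivableP df) (derivableP dg))) mulrDr.
Qed.

Lemma dquot_cst a (c : R) x : dquot a (fun=> c) x = 0.
Proof.
rewrite /dquot subrr mul0r (derive_val (is_derive := is_derive_const x a c)) mulr0.
by case: ifP.
Qed.

Lemma dquot_coord a x i : a != 0 -> dquot a (fun y => y 0 i) x = 2 * a 0 i / dotp a a.
Proof.
move=> a0; rewrite /dquot reflE (derive_val (is_derive := is_derive_coord x a i)).
case: ifPn => [ax|_]; last by ring.
by field; rewrite ?ax ?dotpxx_eq0 ?a0.
Qed.

Lemma dquot_mulx a f x i : a != 0 -> derivable f x a ->
  dquot a (fun y => y 0 i * f y) x = x 0 i * dquot a f x + 2 * a 0 i / dotp a a * f (refl a x).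
Proof.
move=> a0 df.
have dx : derivable (fun y : V => y 0 i) x a by case: (is_derive_coord x a i).
rewrite (dquotM a0 dx df) dquot_coord//.
have -> : f (refl a x) = f x - dotp a x * dquot a f x by rewrite -dquot_eq// subKr.
by ring.
Qed.

(** The division by [<a, x>] is exact: [dquot_mulx] expresses the quotient of [x_i f] through that
    of [f] and [f \o refl a], with no denominator in [x]. *)
Lemma hpz_dquot a k f : a != 0 -> hpz k f -> hpz (k - 1) (dquot a f).
Proof.
move=> a0 /hpzP[[n -> ]|->]; last first.
  by rewrite (_ : dquot a _ = fun=> 0); [exact: hpz_zero|apply/funext => x; rewrite dquot_cst].
elim/hp_induction => {n f} [b|n i f hf IH|n f g hf If hg Ig|n].
- by rewrite (_ : dquot a _ = fun=> 0); [exact: hpz_zero|apply/funext => x; rewrite dquot_cst].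
- rewrite (_ : dquot a _ = fun x => x 0 i * dquot a f x + 2 * a 0 i / dotp a a * (f \o refl a) x).
    have -> : n.+1%:Z - 1 = n%:Z by rewrite intS; ring.
    apply: hpz_add; first by have := hpz_mulx i IH; rewrite subrK.
    by apply: hpz_scale; apply: hpz_refl.
  by apply/funext => x; rewrite dquot_mulx//; exact: (@hpz_derivable _ _ n).
- rewrite (_ : dquot a _ = fun x => dquot a f x + dquot a g x); first exact: hpz_add.
  by apply/funext => x; rewrite dquotD//; exact: (@hpz_derivable _ _ n).
- by rewrite (_ : dquot a _ = fun=> 0); [exact: hpz_zero|apply/funext => x; rewrite dquot_cst].
Qed.

End DifferenceQuotients.

(** * Root systems and the algebra of Dunkl operators on polynomials *)

Section RootSystem.
Variables (R : realType) (d : nat).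
Local Notation V := 'rV[R]_d.
Variables (Rs : seq V) (b0 : V) (kappa : V -> R).
Hypotheses (rs : root_system Rs) (reg : regular Rs b0) (mult : multiplicity Rs kappa).
Implicit Types (f g : V -> R) (x y a b v : V).

Local Notation pos := (pos_roots Rs b0).

Lemma root_neq0 a : a \in Rs -> a != 0.
Proof. by case: rs => _ H _ _; exact: H. Qed.

Lemma pos_root a : a \in pos -> a \in Rs.
Proof. by rewrite mem_filter => /andP[]. Qed.

Lemma pos_neq0 a : a \in pos -> a != 0.
Proof. by move=> /pos_root/root_neq0. Qed.

Lemma root_opp a : a \in Rs -> - a \in Rs.
Proof.
move=> aR; case: rs => _ _ H _; rewrite -scaleN1r.
by apply/(H a (-1) aR); right.
Qed.

Lemma root_refl a b : a \in Rs -> b \in Rs -> refl a b \in Rs.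
Proof. by case: rs => _ _ _; apply. Qed.

Lemma kappa_ge0 a : a \in Rs -> 0 <= kappa a.
Proof. by case: mult => H _; exact: H. Qed.

Lemma kappa_refl a b : a \in Rs -> b \in Rs -> kappa (refl a b) = kappa b.
Proof. by move=> aR bR; case: mult => _ /(_ [:: a] b); rewrite /= andbT; apply. Qed.

Lemma kappa_opp a : a \in Rs -> kappa (- a) = kappa a.
Proof. by move=> aR; rewrite -[LHS](kappa_refl aR) ?root_opp// reflN refl_self opprK. Qed.

Lemma uniq_pos : uniq pos.
Proof. by apply: filter_uniq; case: rs. Qed.

(** [r_a] permutes the root system but not [R_+]; of the two roots on the line of [r_a b] the
    positive one is taken. *)
Let pos_refl a b := if 0 < dotp (refl a b) b0 then refl a b else - refl a b.

Lemma pos_refl_pos a b : a \in Rs -> b \in pos -> pos_refl a b \in pos.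
Proof.
move=> aR bP; have rR := root_refl aR (pos_root bP).
rewrite /pos_refl; case: ifPn => H; first by rewrite mem_filter H.
by rewrite mem_filter root_opp// andbT dotpNl oppr_gt0 lt_neqAle reg// leNgt.
Qed.

Lemma pos_reflK a b : b \in pos -> pos_refl a (pos_refl a b) = b.
Proof.
rewrite mem_filter => /andP[bp _].
rewrite {2}/pos_refl; case: ifP => _; rewrite /pos_refl ?reflN reflK ?bp//.
by rewrite dotpNl oppr_gt0 ltNge ltW//= opprK.
Qed.

Lemma perm_pos_refl a : a \in Rs -> perm_eq (map (pos_refl a) pos) pos.
Proof.
move=> aR; have um : uniq (map (pos_refl a) pos).
  by rewrite map_inj_in_uniq ?uniq_pos// => b c bp cp E; rewrite -(pos_reflK a bp) E pos_reflK.
apply: uniq_perm => //; first exact: uniq_pos.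
apply: (uniq_min_size um _ _).2; last by rewrite size_map.
by move=> _ /mapP[b bp ->]; exact: pos_refl_pos.
Qed.

(** Even functions of the root do not see the sign corrections in [pos_refl], and [pos_refl] is a
    permutation of [R_+]. *)
Lemma big_pos_refl (S : Type) (idx : S) (op : Monoid.com_law idx) (P : pred V) (T : V -> S) a :
  a \in Rs -> (forall b, b \in Rs -> T (- b) = T b) -> (forall b, b \in Rs -> P (- b) = P b) ->
  \big[op/idx]_(b <- pos | P (refl a b)) T (refl a b) = \big[op/idx]_(b <- pos | P b) T b.
Proof.
move=> aR TN PN; rewrite -[RHS](perm_big _ (perm_pos_refl aR)) big_map.
rewrite big_seq_cond [RHS]big_seq_cond; apply: eq_big => b.
  rewrite /pos_refl; case: ifP => // _.
  by case: (boolP (b \in pos)) => //= bp; rewrite PN// root_refl// pos_root.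
move=> /andP[bp _]; rewrite /pos_refl; case: ifP => // _.
by rewrite TN// root_refl// pos_root.
Qed.

Local Notation D := (dunkl Rs b0 kappa).

Lemma hpz_dunkl xi k f : hpz k f -> hpz (k - 1) (D xi f).
Proof.
move=> hf; apply: hpz_add; first exact: hpz_derive.
rewrite (_ : (fun x => _) = (fun x => \sum_(a <- pos) if a == 0 then 0 else kappa a * dotp a xi * dquot a f x)).
  apply: hpz_sum => a; case: eqVneq => [_|a0]; first exact: hpz_zero.
  by apply: hpz_scale; exact: hpz_dquot.
apply/funext => x; rewrite big_seq [RHS]big_seq; apply: eq_bigr => a /pos_neq0/negbTE ->.
by [].
Qed.

Lemma dunklD xi k l f g : hpz k f -> hpz l g ->
  D xi (fun x => f x + g x) = (fun x => D xi f x + D xi g x).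
Proof.
move=> hf hg; apply/funext => x; rewrite /dunkl (hpz_deriveD _ _ hf hg).
rewrite addrACA; congr (_ + _); rewrite -big_split/=; apply: eq_bigr => a _.
by rewrite dquotD ?mulrDr//; [exact: hpz_derivable hf|exact: hpz_derivable hg].
Qed.

Lemma dunkl_cst xi (c : R) : D xi (fun=> c) = fun=> 0.
Proof.
apply/funext => x; rewrite /dunkl (derive_val (is_derive := is_derive_const x xi c)) add0r.
by rewrite big1// => a _; rewrite dquot_cst mulr0.
Qed.

Lemma dunklZ xi k (c : R) f : hpz k f -> D xi (fun x => c * f x) = (fun x => c * D xi f x).
Proof.
move=> hf; have hc : hpz 0 (fun _ : V => c) by exact: hp_const.
apply/funext => x; rewrite /dunkl (hpz_deriveM _ _ hc hf).
rewrite (derive_val (is_derive := is_derive_const x xi c)) mulr0 addr0 mulrDr; congr (_ + _).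
rewrite mulr_sumr big_seq [RHS]big_seq; apply: eq_bigr => a /pos_neq0 a0.
rewrite (dquotM a0) ?dquot_cst; [|by case: (is_derive_const x a c)|exact: hpz_derivable hf].
by ring.
Qed.

(* the symmetric matrix of reflection operators in [D_xi x_i - x_i D_xi] *)
Definition dunkl_shift xi eta f x := dotp xi eta * f x +
  \sum_(a <- pos) kappa a * (2 * dotp a xi * dotp a eta / dotp a a) * f (refl a x).

Lemma dunkl_mulx xi i k f : hpz k f ->
  D xi (fun x => x 0 i * f x) = (fun x => x 0 i * D xi f x + dunkl_shift xi (delta_mx 0 i) f x).
Proof.
move=> hf; apply/funext => x; rewrite /dunkl /dunkl_shift (hpz_derive_mulx i x xi hf).
rewrite mulrDr [xi 0 i * _ + _]addrC -!addrA; congr (_ + _).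
rewrite addrCA dotpC dotp_delta; congr (_ + _).
rewrite mulr_sumr -big_split/= big_seq [RHS]big_seq; apply: eq_bigr => a /pos_neq0 a0.
rewrite dquot_mulx//; last exact: hpz_derivable hf.
by rewrite [dotp a (delta_mx 0 i)]dotpC dotp_delta; ring.
Qed.

(** The correction to the Leibniz rule is a sum of terms odd under the respective [r_a], so it will
    disappear under a reflection invariant integral. *)
Lemma dunklM xi k l f g : hpz k f -> hpz l g ->
  D xi (fun x => f x * g x) = (fun x => D xi f x * g x + f x * D xi g x -
    \sum_(a <- pos) kappa a * dotp a xi * (dotp a x * dquot a f x * dquot a g x)).
Proof.
move=> hf hg; apply/funext => x; rewrite /dunkl (hpz_deriveM _ _ hf hg).
rewrite [RHS](_ : _ = f x * 'D_xi g x + g x * 'D_xi f x +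
  ((\sum_(a <- pos) kappa a * dotp a xi * dquot a f x) * g x +
   f x * (\sum_(a <- pos) kappa a * dotp a xi * dquot a g x) -
   \sum_(a <- pos) kappa a * dotp a xi * (dotp a x * dquot a f x * dquot a g x))); last by ring.
congr (_ + _); rewrite mulr_suml mulr_sumr -big_split/= -sumrB big_seq [RHS]big_seq.
apply: eq_bigr => a /pos_neq0 a0.
rewrite (dquotM a0); [|exact: hpz_derivable hf|exact: hpz_derivable hg].
by ring.
Qed.

Lemma dunkl_refl xi a k f : a \in Rs -> hpz k f ->
  D xi (f \o refl a) = D (refl a xi) f \o refl a.
Proof.
move=> aR hf; apply/funext => x; rewrite /dunkl /= derive_refl; congr (_ + _).
pose T b := kappa b * dotp b (refl a xi) * dquot b f (refl a x).
have TN b : b \in Rs -> T (- b) = T b.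
  move=> bR; rewrite /T (kappa_opp bR) dotpNl dquot_opp; last exact: hpz_derivable hf.
  by rewrite !mulrN mulNr opprK.
transitivity (\sum_(b <- pos) T (refl a b)).
  rewrite big_seq [RHS]big_seq; apply: eq_bigr => b bp.
  by rewrite /T (kappa_refl aR (pos_root bp)) dotp_refl dquot_refl.
exact: (big_pos_refl _ (P := xpredT) aR TN (fun _ _ => erefl)).
Qed.

Lemma dunkl_linv (c : R) xi eta k f x : hp k f ->
  D (c *: xi + eta) f x = c * D xi f x + D eta f x.
Proof.
move=> hf; rewrite /dunkl (hp_derive_lin _ _ _ _ hf) mulrDr addrACA; congr (_ + _).
rewrite mulr_sumr -big_split/=; apply: eq_bigr => a _.
by rewrite dotpDr dotpZr; ring.
Qed.

Lemma dunkl_sum_delta k f x (v : V) : hp k f ->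
  \sum_j v 0 j * dunklj Rs b0 kappa j f x = D v f x.
Proof.
move=> hf; rewrite [in RHS](rV_sum_delta v) /dunklj /ebasis.
have D0 : D 0 f x = 0.
  have := dunkl_linv 1 0 0 x hf; rewrite scale1r addr0 mul1r => E.
  by apply: (addrI (D 0 f x)); rewrite addr0 -E.
elim/big_rec2: _ => [|j u r _ ->]; first by rewrite D0.
by rewrite (dunkl_linv _ _ _ _ hf).
Qed.

Lemma dunkl_euler k f x : hp k f ->
  \sum_j x 0 j * dunklj Rs b0 kappa j f x =
  k%:R * f x + \sum_(a <- pos) kappa a * (f x - f (refl a x)).
Proof.
move=> hf; rewrite (dunkl_sum_delta x x hf) /dunkl (hp_euler _ hf); congr (_ + _).
rewrite big_seq [RHS]big_seq; apply: eq_bigr => a /pos_neq0 a0.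
by rewrite dquot_eq// mulrA.
Qed.

End RootSystem.

(** * Integration by parts with the weight *)

Section PowerContinuity.
Variables (R : realType) (V : normedModType R).

Lemma continuous_powR_comp (h : V -> R) (k : R) x : 0 <= k -> (forall y, 0 <= h y) ->
  {for x, continuous h} -> {for x, continuous (fun y => h y `^ k)}.
Proof.
move=> k0 h0 ch; have [kgt|kle] := ltP 0 k; last first.
  have -> : k = 0 by apply/eqP; rewrite eq_le kle.
  rewrite (_ : (fun _ => _) = fun=> 1); first exact: cfC.
  by apply/funext => y; rewrite powRr0.
have [hx|hx] := ltP 0 (h x).
  apply: (@continuous_comp _ _ _ h (fun t => t `^ k)) => //.
  apply: differentiable_continuous; apply/derivable1_diffP.
  by apply: derivable_powR; rewrite in_itv/= hx.
have {}hx : h x = 0 by apply/eqP; rewrite eq_le hx h0.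
apply/continuous_atP => e e0.
have e1 : 0 < e `^ k^-1 by rewrite powR_gt0.
have /continuous_atP/(_ _ e1)[r r0 H] := ch; exists r => // y /H.
rewrite hx subr0 powR0 ?gt_eqF// subr0 (ger0_norm (h0 y)) (ger0_norm (powR_ge0 _ _)) => hy.
have := gt0_ltr_powR kgt (h0 y) (ltW e1) hy.
by rewrite -powRrM mulVf ?gt_eqF// powRr1// ltW.
Qed.

End PowerContinuity.

Section WeightedSphere.
Variables (R : realType) (d : nat).
Hypothesis d_gt0 : (0 < d)%N.
Local Notation V := 'rV[R]_d.
Variables (Rs : seq V) (b0 : V) (kappa : V -> R).
Hypotheses (rs : root_system Rs) (reg : regular Rs b0) (mult : multiplicity Rs kappa).
Implicit Types (f g P : V -> R) (x y a b v : V).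

Local Notation pos := (pos_roots Rs b0).
Local Notation D := (dunkl Rs b0 kappa).

Lemma hp_exp k f n : hp k f -> hp (k * n) (fun x => f x ^+ n).
Proof.
move=> hf; elim: n => [|n IH].
  rewrite muln0 (_ : (fun _ => _) = fun=> 1); first exact: hp_const.
  by apply/funext => x; rewrite expr0.
rewrite mulnS (_ : (fun _ => _) = fun x => f x * f x ^+ n); first exact: hp_mul.
by apply/funext => x; rewrite exprS.
Qed.

Lemma hp_prod m (s : seq V) (F : V -> V -> R) : (forall b, hp m (F b)) ->
  hp (size s * m) (fun x => \prod_(b <- s) F b x).
Proof.
move=> hF; elim: s => [|c s IH] /=.
  rewrite mul0n (_ : (fun _ => _) = fun=> 1); first exact: hp_const.
  by apply/funext => x; rewrite big_nil.
rewrite mulSn (_ : (fun _ => _) = fun x => F c x * \prod_(b <- s) F b x); first exact: hp_mul.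
by apply/funext => x; rewrite big_cons.
Qed.

Lemma is_derive_prod (s : seq V) (F : V -> V -> R) x v : uniq s ->
  (forall b, derivable (F b) x v) ->
  is_derive x v (fun y => \prod_(b <- s) F b y)
    (\sum_(a <- s) 'D_v (F a) x * \prod_(b <- s | b != a) F b x).
Proof.
move=> + dF; elim: s => [_|c s IH /= /andP[cs us]].
  rewrite big_nil (_ : (fun _ => _) = fun=> 1); first exact: is_derive_const.
  by apply/funext => y; rewrite big_nil.
rewrite (_ : (fun _ => _) = fun y => F c y * \prod_(b <- s) F b y); last first.
  by apply/funext => y; rewrite big_cons.
apply: (is_derive_eq (is_derive_mul (derivableP (dF c)) (IH us))).
rewrite big_cons big_cons eqxx /= addrC; congr (_ + _).
  rewrite mulrC; congr (_ * _); rewrite big_seq [RHS]big_seq_cond.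
  by apply: eq_bigl => b; case: (boolP (b \in s)) => //= bs; rewrite (memPn cs).
rewrite mulr_sumr big_seq [RHS]big_seq; apply: eq_bigr => a as_.
by rewrite big_cons eq_sym (memPn cs)// mulrCA.
Qed.

(** Squared length of the component of [x] orthogonal to [a]. On the sphere it is the variable [u]
    of the binomial series, with [1 - u = <a, x>^2 / |a|^2]. *)
Definition polar_sq a x : R := dotp x x - dotp a x ^+ 2 / dotp a a.

Lemma hp_polar_sq a : hp 2 (polar_sq a).
Proof.
apply: hp_sub; first exact: hp_dotpxx.
rewrite (_ : (fun _ => _) = fun x => (dotp a a)^-1 * dotp a x ^+ 2).
  by apply: hp_scale; apply: (@hp_exp 1 _ 2); exact: hp_dotp.
by apply/funext => x; rewrite mulrC.
Qed.

(* Homogenized truncated binomial series: on the unit sphere it approximates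
   [(<a, x>^2 / |a|^2) ^ k]. *)
Fixpoint wpoly (k : R) a n : V -> R :=
  if n is n'.+1 then fun x => wpoly k a n' x * dotp x x + binc k n'.+1 * polar_sq a x ^+ n'.+1
  else fun=> 1.

(** The derivative of the truncated series, homogenized in the same way to degree [2 n - 2]. *)
Fixpoint wpoly_deriv (k : R) a n : V -> R :=
  if n is n'.+1 then fun x => wpoly_deriv k a n' x * dotp x x +
    n'.+1%:R * binc k n'.+1 * polar_sq a x ^+ n'
  else fun=> 0.

Lemma hp_wpoly k a n : hp (2 * n) (wpoly k a n).
Proof.
elim: n => [|n IH]; first exact: hp_const.
apply: hp_add; last by apply: hp_scale; apply: hp_exp; exact: hp_polar_sq.
by rewrite mulnS addnC; apply: hp_mul => //; exact: hp_dotpxx.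
Qed.

Lemma hpz_wpoly_deriv k a n : hpz ((2 * n)%N%:Z - 2) (wpoly_deriv k a n).
Proof.
elim: n => [|n IH]; first exact: hpz_zero.
have -> : (2 * n.+1)%N%:Z - 2 = (2 * n)%N by rewrite mulnS PoszD; ring.
apply: hpz_add.
  by have := hpz_mul IH (hp_dotpxx R d : hpz 2 _); rewrite subrK.
by apply: hpz_scale; apply: (@hp_exp 2); exact: hp_polar_sq.
Qed.

Lemma wpoly_sphere k a n y : dotp y y = 1 -> wpoly k a n y = (binpoly k n).[polar_sq a y].
Proof.
move=> y1; elim: n => [|n IH] /=; first by rewrite binpoly0.
by rewrite binpolyS IH y1 mulr1.
Qed.

Lemma wpoly_deriv_sphere k a n y : dotp y y = 1 ->
  wpoly_deriv k a n y = ((binpoly k n)^`()).[polar_sq a y].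
Proof.
move=> y1; elim: n => [|n IH] /=.
  by rewrite /binpoly big_ord_recr big_ord0 /= add0r derivZ derivXn mulr0n scaler0 horner0.
by rewrite deriv_binpolyS IH y1 mulr1.
Qed.

Lemma is_derive_dotp a x v : is_derive x v (dotp a) (dotp a v).
Proof.
apply: (@is_derive_quadratic _ _ _ _ _ _ 0 1) => // h _.
by rewrite dotpDr dotpZr addrK subrr normr0 mul0r.
Qed.

Lemma is_derive_dotpxx x v : is_derive x v (fun x => dotp x x) (2 * dotp x v).
Proof.
apply: (@is_derive_quadratic _ _ _ _ _ _ (dotp v v) 1) => // h _.
rewrite !(dotpDl, dotpDr, dotpZl, dotpZr) (dotpC v x).
rewrite [X in `|X|](_ : _ = dotp v v * h ^+ 2); last by ring.
by rewrite normrM normrX (ger0_norm (dotp_ge0 v)).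
Qed.

Lemma is_derive_exp f x v (df : R) n : is_derive x v f df ->
  is_derive x v (fun x => f x ^+ n.+1) (n.+1%:R * f x ^+ n * df).
Proof.
move=> Hf; elim: n => [|n IH].
  by rewrite expr0 !mul1r; apply: (is_derive_eq Hf).
rewrite (_ : (fun x => _) = fun x => f x * f x ^+ n.+1); last first.
  by apply/funext => z; rewrite exprS.
apply: (is_derive_eq (is_derive_mul Hf IH)).
by rewrite -[n.+2]addn1 natrD [f x ^+ n.+1]exprS; ring.
Qed.

Lemma is_derive_polar_sq a x v :
  is_derive x v (polar_sq a) (2 * dotp x v - 2 * dotp a x * dotp a v / dotp a a).
Proof.
have H := is_derive_mul (is_derive_const x v (- (dotp a a)^-1)) (is_derive_exp 1 (is_derive_dotp a x v)).
have := is_derive_add (is_derive_dotpxx x v) H.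
rewrite (_ : (fun y => _) = polar_sq a); last first.
  by apply/funext => y; rewrite /polar_sq mulNr mulrC.
by move=> {}H; apply: (is_derive_eq H); rewrite expr1; ring.
Qed.

(** The part along [y] meets the differential equation and yields the bounded [binrem]. The part
    along [a] keeps [wpoly_deriv], which has no uniform bound in general and is left for
    symmetrization. The last term comes from the homogenization. *)
Lemma derive_wpoly k a n y v : a != 0 -> dotp y y = 1 ->
  'D_v (wpoly k a n) y = - 2 * binrem k n (polar_sq a y) * dotp v y
    - 2 * (dotp a v / dotp a a) * (wpoly_deriv k a n y * dotp a y)
    + (2 * n)%:R * dotp v y * wpoly k a n y.
Proof.
move=> a0 y1; set u := polar_sq a y.
have -> : 'D_v (wpoly k a n) y = wpoly_deriv k a n y *
    ((1 - u) * (2 * dotp v y) - 2 * dotp a y * dotp a v / dotp a a) + n%:R * wpoly k a n y * (2 * dotp v y).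
  elim: n => [|n IH].
    by rewrite (derive_val (is_derive := is_derive_const y v 1)) /= !mul0r addr0.
  have dw : derivable (wpoly k a n) y v.
    by apply: (@hpz_derivable _ _ (2 * n)%N); exact: hp_wpoly.
  have H1 := is_derive_mul (derivableP dw) (is_derive_dotpxx y v).
  have H2 := is_derive_mul (is_derive_const y v (binc k n.+1)) (is_derive_exp n (is_derive_polar_sq a y v)).
  rewrite /= (derive_val (is_derive := is_derive_add H1 H2)) IH y1 -/u (dotpC y v).
  by rewrite -[n.+1]addn1 natrD [u ^+ (n + 1)]exprD expr1; ring.
have E := binpoly_ode k n u; rewrite -wpoly_deriv_sphere// -/(binrem k n u) in E.
rewrite mulrBr [wpoly_deriv k a n y * ((1 - u) * _)]mulrCA mulrA E natrM.
by ring.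
Qed.

Lemma polar_sq_refl a b x : polar_sq b (refl a x) = polar_sq (refl a b) x.
Proof. by rewrite /polar_sq !dotp_refl -refl_sym. Qed.

Lemma polar_sq_opp b x : polar_sq (- b) x = polar_sq b x.
Proof. by rewrite /polar_sq !(dotpNl, dotpNr) opprK sqrrN. Qed.

Lemma wpoly_refl k a b n x : wpoly k b n (refl a x) = wpoly k (refl a b) n x.
Proof. by elim: n => //= n ->; rewrite polar_sq_refl dotp_refl. Qed.

Lemma wpoly_opp k b n : wpoly k (- b) n = wpoly k b n.
Proof. by elim: n => //= n ->; apply/funext => x; rewrite polar_sq_opp. Qed.

Lemma polar_sq_self a x : polar_sq a (refl a x) = polar_sq a x.
Proof. by rewrite polar_sq_refl refl_self polar_sq_opp. Qed.

Lemma wpoly_deriv_self k a n x : wpoly_deriv k a n (refl a x) = wpoly_deriv k a n x.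
Proof. by elim: n => //= n ->; rewrite polar_sq_self dotp_refl. Qed.

Definition wprod n x : R := \prod_(b <- pos) wpoly (kappa b) b n x.
(** Both [a] and [- a] are excluded so that the index condition is stable under [r_a], which
    exchanges them. *)
Definition wprod_but a n x : R :=
  \prod_(b <- pos | (b != a) && (b != - a)) wpoly (kappa b) b n x.

Lemma pos_neq_opp a b : a \in pos -> b \in pos -> b != - a.
Proof.
rewrite !mem_filter => /andP[a0 _] /andP[+ _]; apply: contraTneq => ->.
by rewrite dotpNl oppr_gt0 -leNgt ltW.
Qed.

Lemma wprod_butE a n x : a \in pos ->
  wprod_but a n x = \prod_(b <- pos | b != a) wpoly (kappa b) b n x.
Proof.
move=> ap; rewrite /wprod_but big_seq_cond [RHS]big_seq_cond.
by apply: eq_bigl => b; case: (boolP (b \in pos)) => //= bp; rewrite pos_neq_opp// andbT.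
Qed.

Lemma wprodE a n x : a \in pos -> wprod n x = wpoly (kappa a) a n x * wprod_but a n x.
Proof. by move=> ap; rewrite /wprod (bigD1_seq a)//= ?uniq_pos// wprod_butE. Qed.

Lemma wprod_but_self a n x : a \in pos -> wprod_but a n (refl a x) = wprod_but a n x.
Proof.
move=> ap; have aR := pos_root ap.
pose T b := wpoly (kappa b) b n x.
rewrite -[RHS](@big_pos_refl _ _ _ _ rs reg _ _ _ (fun b => (b != a) && (b != - a)) T a aR).
- rewrite /wprod_but big_seq_cond [RHS]big_seq_cond; apply: eq_big => b; last first.
    by move=> /andP[bp _]; rewrite wpoly_refl /T (kappa_refl mult aR (pos_root bp)).
  by rewrite !(inv_eq (reflK a)) reflN refl_self opprK; congr (_ && _); exact: andbC.
- by move=> b bR; rewrite /T (kappa_opp rs mult)// wpoly_opp.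
- by move=> b _; rewrite eqr_oppLR eqr_opp andbC.
Qed.

Lemma hp_wprod n : hp (size pos * (2 * n)) (wprod n).
Proof. by apply: hp_prod => b; exact: hp_wpoly. Qed.

Lemma hp_wprod_but a n : exists m, hp m (wprod_but a n).
Proof.
rewrite (_ : wprod_but a n = fun x =>
   \prod_(b <- [seq b <- pos | (b != a) && (b != - a)]) wpoly (kappa b) b n x).
  by eexists; apply: hp_prod => b; exact: hp_wpoly.
by apply/funext => x; rewrite big_filter.
Qed.

End WeightedSphere.

Lemma mem_tail (T : eqType) (c : T) s a : a \in s -> a \in c :: s.
Proof. by rewrite inE => ->; rewrite orbT. Qed.

Section DunklGreen.
Variables (R : realType) (d : nat).
Hypothesis d_gt0 : (0 < d)%N.
Local Notation V := 'rV[R]_d.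
Variables (Rs : seq V) (b0 : V) (kappa : V -> R).
Hypotheses (rs : root_system Rs) (reg : regular Rs b0) (mult : multiplicity Rs kappa).
Implicit Types (f g P : V -> R) (x y a b v : V).

Local Notation pos := (pos_roots Rs b0).
Local Notation D := (dunkl Rs b0 kappa).

Lemma int_sphere_sum (s : seq V) (F : V -> V -> R) :
  (forall a, a \in s -> sphere_continuous (F a)) ->
  sphere_continuous (fun x => \sum_(a <- s) F a x) /\
  int_sphere (fun x => \sum_(a <- s) F a x) = \sum_(a <- s) int_sphere (F a).
Proof.
elim: s => [|c s IH] cF.
  rewrite big_nil (_ : (fun _ => _) = fun=> 0); last by apply/funext => x; rewrite big_nil.
  by split; [exact: sphere_continuousC|exact: int_sphere0].
have [cs E] := IH (fun a as_ => cF a (mem_tail c as_)).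
have cc := cF c (mem_head c s).
rewrite big_cons (_ : (fun _ => _) = fun x => F c x + \sum_(a <- s) F a x); last first.
  by apply/funext => x; rewrite big_cons.
by split; [exact: sphere_continuousD|rewrite int_sphereD// E].
Qed.

Lemma hpz_sphere k f : hpz k f -> sphere_continuous f.
Proof. by move=> /hpz_continuous/continuous_sphere. Qed.

Lemma int_sphere_refl_hpz a k f : hpz k f -> int_sphere (f \o refl a) = int_sphere f.
Proof.
by move=> /hpzP[[n _ hf]|-> //]; exact: (int_sphere_refl_hp d_gt0 a hf).
Qed.

Lemma sphere_continuous_polar_sq a : sphere_continuous (@polar_sq R d a).
Proof. exact: hp_sphere (hp_polar_sq a). Qed.

Lemma sphere_continuous_horner (p : {poly R}) a :
  sphere_continuous (fun y : V => p.[polar_sq a y]).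
Proof.
move=> y y1; apply: (@continuous_comp _ _ _ (@polar_sq R d a) (horner p)).
  exact: sphere_continuous_polar_sq.
exact: continuous_horner.
Qed.

Lemma sphere_continuous_binrem k a n :
  sphere_continuous (fun y : V => binrem k n (polar_sq a y)).
Proof.
have -> : (fun y : V => binrem k n (polar_sq a y)) =
   (fun y => (k *: (binpoly k n - (binpoly k n).[1] *: 'X^n)).[polar_sq a y]).
  by apply/funext => y; rewrite !hornerE.
exact: sphere_continuous_horner.
Qed.

Lemma dotp_sphere y : enorm y = 1 -> dotp y y = 1.
Proof. by move=> y1; rewrite -enorm_sqr y1 expr1n. Qed.

Section ApproximateWeight.
Variable n : nat.
Local Notation wb := (wprod_but Rs b0 kappa).
Local Notation W := (wprod Rs b0 kappa n).
Let rem a y := binrem (kappa a) n (polar_sq a y).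

Lemma sphere_continuous_wprod_but a : sphere_continuous (wb a n).
Proof. by have [m /hp_sphere] := hp_wprod_but Rs b0 kappa a n. Qed.

Lemma sphere_continuous_wprod : sphere_continuous W.
Proof. exact: hp_sphere (hp_wprod Rs b0 kappa n). Qed.

(** Averaging with the image under [r_a], which fixes the other factors and negates [<a, y>],
    replaces [P] by half of [<a, y>] times its difference quotient. The resulting [<a, y>^2] is
    [|a|^2 (1 - u)], and the differential equation turns [1 - u] times the derivative into [- rem].
    Thus the difference part of the Dunkl operator emerges from the derivative of the weight. *)
Lemma int_sphere_wpoly_deriv k P a : hp k P -> a \in pos ->
  int_sphere (fun y => P y * (wpoly_deriv (kappa a) a n y * dotp a y) * wb a n y) =
  - (dotp a a / 2) * int_sphere (fun y => dquot a P y * (rem a y * wb a n y)).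
Proof.
move=> hP ap; have a0 := pos_neq0 rs ap.
set Z := (fun y => _ * wb a n y).
have [j hj] := hp_wprod_but Rs b0 kappa a n.
have hZ : exists m, hpz m Z.
  eexists; apply: hpz_mul; last exact: (hj : hpz j _).
  apply: (hpz_mul (hP : hpz k _)); apply: hpz_mul; first exact: hpz_wpoly_deriv.
  exact: (hp_dotp a : hpz 1 _).
have [m {}hZ] := hZ.
have cZ := hpz_sphere hZ; have cZr := hpz_sphere (hpz_refl a hZ).
have cY : sphere_continuous (fun y => dquot a P y * (rem a y * wb a n y)).
  apply: sphere_continuousM; first by apply: hpz_sphere; exact: hpz_dquot a0 (hP : hpz k _).
  apply: sphere_continuousM; first exact: sphere_continuous_binrem.
  exact: sphere_continuous_wprod_but.
have : int_sphere (fun y => Z y + (Z \o refl a) y) =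
    int_sphere (fun y => - dotp a a * (dquot a P y * (rem a y * wb a n y))).
  apply: int_sphere_eq => //; first exact: sphere_continuousD.
    by apply: sphere_continuousM => //; exact: sphere_continuousC.
  move=> y /dotp_sphere y1; rewrite /Z /= wpoly_deriv_self dotp_refl_same (wprod_but_self rs reg mult)//.
  have -> : P (refl a y) = P y - dotp a y * dquot a P y by rewrite -dquot_eq// subKr.
  have E := binpoly_ode (kappa a) n (polar_sq a y).
  rewrite -wpoly_deriv_sphere// -/(binrem (kappa a) n (polar_sq a y)) in E.
  have -> : rem a y = - ((1 - polar_sq a y) * wpoly_deriv (kappa a) a n y) by rewrite E opprK.
  rewrite {1}/polar_sq y1; field.
  by rewrite dotpxx_eq0.
rewrite int_sphereD// (int_sphere_refl_hpz a hZ) int_sphereZ// => E.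
by move: E; lra.
Qed.

(** [sphere_green] for [P W], rewritten by [derive_wpoly]. The degree [2 n] of each factor occurs on
    both sides and cancels, so the remaining constants do not depend on [n]. *)
Lemma approximate_green k P v : hp k.+1 P ->
  int_sphere (fun y => 'D_v P y * W y) +
  \sum_(a <- pos) dotp a v * int_sphere (fun y => dquot a P y * (rem a y * wb a n y)) =
  (k + d)%:R * int_sphere (fun y => dotp v y * P y * W y) +
  2 * \sum_(a <- pos) int_sphere (fun y => dotp v y * P y * (rem a y * wb a n y)).
Proof.
move=> hP; set M := (size pos * (2 * n))%N.
have hW : hp M W := hp_wprod Rs b0 kappa n.
have hPW : hp (k + M).+1 (fun y => P y * W y) by rewrite -addSn; exact: hp_mul.
have := sphere_green d_gt0 v hPW.
have cP := hp_sphere hP; have cW := sphere_continuous_wprod.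
have cv : sphere_continuous (dotp v) := hp_sphere (hp_dotp v).
have cDP : sphere_continuous (fun y => 'D_v P y).
  by apply: hpz_sphere; exact: (hpz_derive v (hP : hpz k.+1 _)).
have crem a : sphere_continuous (rem a) by exact: sphere_continuous_binrem.
have cwb := sphere_continuous_wprod_but.
have cvP : sphere_continuous (fun y => dotp v y * P y) by exact: sphere_continuousM.
pose X a y := dotp v y * P y * (rem a y * wb a n y).
pose Z a y := P y * (wpoly_deriv (kappa a) a n y * dotp a y) * wb a n y.
have cX a : sphere_continuous (X a).
  by apply: sphere_continuousM => //; exact: sphere_continuousM.
have cZ a : sphere_continuous (Z a).
  apply: sphere_continuousM => //; apply: sphere_continuousM => //.
  apply: sphere_continuousM; last exact: hp_sphere (hp_dotp a).
  exact: hpz_sphere (hpz_wpoly_deriv _ _ _).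
have cvPW : sphere_continuous (fun y => dotp v y * P y * W y) by exact: sphere_continuousM.
have cc (c : R) (u : V -> R) : sphere_continuous u -> sphere_continuous (fun y => c * u y).
  by move=> cu; apply: sphere_continuousM => //; exact: sphere_continuousC.
pose T a y := -2 * X a y + (- 2 * (dotp a v / dotp a a) * Z a y +
   (2 * n)%:R * (dotp v y * P y * W y)).
have cT a : sphere_continuous (T a).
  by apply: sphere_continuousD; [exact: cc|apply: sphere_continuousD; exact: cc].
have [cS ES] := int_sphere_sum (fun a (_ : a \in pos) => cT a).
have -> : int_sphere (fun y => 'D_v (fun y => P y * W y) y) =
    int_sphere (fun y => 'D_v P y * W y + \sum_(a <- pos) T a y).
  apply: int_sphere_eq.
  - by apply: hpz_sphere; exact: (hpz_derive v (hPW : hpz (k + M).+1 _)).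
  - by apply: sphere_continuousD => //; exact: sphere_continuousM.
  move=> y /dotp_sphere y1.
  rewrite (hpz_deriveM _ _ (hP : hpz k.+1 _) (hW : hpz M _)) addrC mulrC; congr (_ + _).
  have dw a : derivable (wpoly (kappa a) a n) y v.
    by apply: (@hpz_derivable _ _ (2 * n)%N); exact: hp_wpoly.
  rewrite /wprod (derive_val (is_derive := is_derive_prod (uniq_pos _ rs) dw)).
  rewrite mulr_sumr big_seq [RHS]big_seq; apply: eq_bigr => a ap.
  rewrite -wprod_butE// derive_wpoly ?(pos_neq0 rs ap)// /T /X /Z (wprodE kappa rs n y ap) /rem.
  by ring.
rewrite int_sphereD//; last exact: sphere_continuousM.
rewrite ES.
have -> : \sum_(a <- pos) int_sphere (T a) =
   - 2 * \sum_(a <- pos) int_sphere (X a) +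
   \sum_(a <- pos) dotp a v * int_sphere (fun y => dquot a P y * (rem a y * wb a n y)) +
   M%:R * int_sphere (fun y => dotp v y * P y * W y).
  have -> : M%:R * int_sphere (fun y => dotp v y * P y * W y) =
     \sum_(a <- pos) (2 * n)%:R * int_sphere (fun y => dotp v y * P y * W y).
    by rewrite big_const_seq count_predT iter_addr_0 /M natrM -[RHS]mulr_natl mulrA.
  rewrite mulr_sumr -!big_split/= big_seq [RHS]big_seq; apply: eq_bigr => a ap.
  rewrite /T int_sphereD; [|exact: cc|by apply: sphere_continuousD; exact: cc].
  rewrite int_sphereD; [|exact: cc|exact: cc].
  rewrite !int_sphereZ// (int_sphere_wpoly_deriv hP ap) -addrA; congr (_ + (_ + _)).
  field; by rewrite dotpxx_eq0 (pos_neq0 rs ap).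
have -> : int_sphere (fun x => dotp v x * (P x * W x)) = int_sphere (fun y => dotp v y * P y * W y).
  by congr int_sphere; apply/funext => y; rewrite mulrA.
rewrite addnAC natrD => E.
rewrite /X in E.
lra.
Qed.

End ApproximateWeight.

Lemma cvg_prod_seq (s : seq V) (Q : pred V) (F : nat -> V -> R) (G : V -> R) :
  (forall b, b \in s -> F n b @[n --> \oo] --> G b) ->
  \prod_(b <- s | Q b) F n b @[n --> \oo] --> \prod_(b <- s | Q b) G b.
Proof.
elim: s => [|c s IH] cF.
  by rewrite big_nil; under eq_fun do rewrite big_nil; exact: cvg_cst.
have IH' := IH (fun b bs => cF b (mem_tail c bs)).
rewrite big_cons; under eq_fun do rewrite big_cons.
by case: (Q c) => //; apply: cvgM => //; apply: cF; rewrite mem_head.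
Qed.

Lemma prod_seq_le (s : seq V) (Q : pred V) (F C : V -> R) :
  (forall b, b \in s -> `|F b| <= C b) ->
  `|\prod_(b <- s | Q b) F b| <= \prod_(b <- s | Q b) `|C b|.
Proof.
move=> FC; rewrite normr_prod big_seq_cond [leRHS]big_seq_cond.
apply: ler_prod => b /andP[bs _]; rewrite normr_ge0 /=.
exact: le_trans (FC b bs) (ler_norm _).
Qed.

Lemma cf_prod_seq (s : seq V) (F : V -> V -> R) y :
  (forall b, b \in s -> {for y, continuous (F b)}) ->
  {for y, continuous (fun y => \prod_(b <- s) F b y)}.
Proof.
elim: s => [|c s IH] cF.
  by rewrite (_ : (fun _ => _) = fun=> 1); [exact: cfC|apply/funext => x; rewrite big_nil].
rewrite (_ : (fun _ => _) = fun y => F c y * \prod_(b <- s) F b y).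
  apply: cfM; first exact: cF (mem_head _ _).
  by apply: IH => b bs; exact: cF (mem_tail c bs).
by apply/funext => x; rewrite big_cons.
Qed.

(** [h_kappa^2] divided by the constant that brings every factor into [[0, 1]] on the sphere, where
    the binomial series applies. *)
Definition hnorm y : R := \prod_(b <- pos) (dotp b y ^+ 2 / dotp b b) `^ kappa b.

Lemma sq_ratio_ge0 b y : 0 <= dotp b y ^+ 2 / dotp b b.
Proof. by rewrite divr_ge0 ?sqr_ge0 ?dotp_ge0. Qed.

Lemma continuous_hnorm y : {for y, continuous hnorm}.
Proof.
apply: cf_prod_seq => b bp; apply: continuous_powR_comp.
- by apply: (kappa_ge0 mult); exact: (pos_root bp).
- by move=> z; exact: sq_ratio_ge0.
- apply: cfM; last exact: cfC.
  by apply: cfX; exact: hp_continuous (hp_dotp b) _.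
Qed.

Lemma sphere_continuous_hnorm : sphere_continuous hnorm.
Proof. by move=> y _; exact: continuous_hnorm. Qed.

Lemma hweight_hnorm y : hweight Rs b0 kappa y ^+ 2 =
  (\prod_(b <- pos) dotp b b `^ kappa b) * hnorm y.
Proof.
rewrite /hnorm /hweight -prodrXl -big_split/= big_seq [RHS]big_seq; apply: eq_bigr => b bp.
rewrite -powRM ?dotp_ge0 ?sq_ratio_ge0// mulrC divfK ?dotpxx_eq0 ?(pos_neq0 rs bp)//.
by rewrite -[dotp b y ^+ 2]real_normK ?num_real// !expr2 powRM.
Qed.

Lemma polar_sq01 b y : b != 0 -> enorm y = 1 -> 0 <= polar_sq b y <= 1.
Proof.
move=> b0' /dotp_sphere y1; rewrite /polar_sq y1 subr_ge0 lerBlDr lerDl sq_ratio_ge0 andbT.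
by rewrite ler_pdivrMr ?dotp_gt0// mul1r (le_trans (cauchy_schwarz b y))// y1 mulr1.
Qed.

Lemma sphere_weight_bounds : exists C : V -> R, forall b y, b \in pos -> enorm y = 1 ->
  [/\ forall n, `|wpoly (kappa b) b n y| <= C b,
      forall n, `|binrem (kappa b) n (polar_sq b y)| <= C b,
      wpoly (kappa b) b n y @[n --> \oo] --> (dotp b y ^+ 2 / dotp b b) `^ kappa b &
      binrem (kappa b) n (polar_sq b y) @[n --> \oo] -->
        kappa b * (dotp b y ^+ 2 / dotp b b) `^ kappa b].
Proof.
have /choice[C HC] : forall b, exists c : R, b \in pos -> forall u : R, 0 <= u <= 1 ->
  [/\ forall n, `|(binpoly (kappa b) n).[u]| <= c, forall n, `|binrem (kappa b) n u| <= c,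
      (binpoly (kappa b) n).[u] @[n --> \oo] --> (1 - u) `^ kappa b &
      binrem (kappa b) n u @[n --> \oo] --> kappa b * (1 - u) `^ kappa b].
  move=> b; have [bp|bp] := boolP (b \in pos); last by exists 0.
  have [c Hc] := binomial_approximation (kappa_ge0 mult (pos_root bp)).
  by exists c.
exists C => b y bp y1; have y1' := dotp_sphere y1.
have [H1 H2 H3 H4] := HC b bp _ (polar_sq01 (pos_neq0 rs bp) y1).
have E : 1 - polar_sq b y = dotp b y ^+ 2 / dotp b b by rewrite /polar_sq y1' subKr.
rewrite E in H3 H4; split => //.
- by move=> n; rewrite wpoly_sphere.
- by under eq_fun do rewrite wpoly_sphere//.
Qed.

Lemma cvg_int_wprod g : sphere_continuous g ->
  int_sphere (fun y => g y * wprod Rs b0 kappa n y) @[n --> \oo] -->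
  int_sphere (fun y => g y * hnorm y).
Proof.
move=> cg; have [C HC] := sphere_weight_bounds; have [B gB] := sphere_bounded cg.
apply: (@int_sphere_dct _ _ (B * \prod_(b <- pos) `|C b|)).
- by move=> n; apply: sphere_continuousM => //; exact: sphere_continuous_wprod.
- by apply: sphere_continuousM => //; exact: sphere_continuous_hnorm.
- move=> n y y1; rewrite normrM ler_pM// ?gB//; apply: prod_seq_le => b bp.
  by case: (HC b y bp y1).
- move=> y y1; apply: cvgM; first exact: cvg_cst.
  by apply: cvg_prod_seq => b bp; case: (HC b y bp y1).
Qed.

Lemma cvg_int_wprod_but g a : sphere_continuous g -> a \in pos ->
  int_sphere (fun y => g y * (binrem (kappa a) n (polar_sq a y) *
     wprod_but Rs b0 kappa a n y)) @[n --> \oo] -->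
  kappa a * int_sphere (fun y => g y * hnorm y).
Proof.
move=> cg ap; have [C HC] := sphere_weight_bounds; have [B gB] := sphere_bounded cg.
rewrite -int_sphereZ; last by apply: sphere_continuousM => //; exact: sphere_continuous_hnorm.
apply: (@int_sphere_dct _ _ (B * (C a * \prod_(b <- pos | (b != a) && (b != - a)) `|C b|))).
- move=> n; apply: sphere_continuousM => //; apply: sphere_continuousM.
    exact: sphere_continuous_binrem.
  exact: sphere_continuous_wprod_but.
- apply: sphere_continuousM; first exact: sphere_continuousC.
  by apply: sphere_continuousM => //; exact: sphere_continuous_hnorm.
- move=> n y y1; rewrite normrM ler_pM// ?gB// normrM ler_pM//.
    by case: (HC a y ap y1).
  by apply: prod_seq_le => b bp; case: (HC b y bp y1).
- move=> y y1.
  have -> : kappa a * (g y * hnorm y) = g y * (kappa a * (dotp a y ^+ 2 / dotp a a) `^ kappa a *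
    \prod_(b <- pos | (b != a) && (b != - a)) (dotp b y ^+ 2 / dotp b b) `^ kappa b).
    rewrite mulrCA -mulrA; congr (_ * (_ * _)).
    rewrite /hnorm (bigD1_seq a)//= ?(uniq_pos _ rs)//; congr (_ * _).
    rewrite big_seq_cond [RHS]big_seq_cond; apply: eq_bigl => b.
    by case: (boolP (b \in pos)) => //= bp; rewrite (pos_neq_opp ap bp) andbT.
  apply: cvgM; first exact: cvg_cst.
  apply: cvgM; first by case: (HC a y ap y1).
  by apply: cvg_prod_seq => b bp; case: (HC b y bp y1).
Qed.

(** Limit of [approximate_green]. The terms with [binrem] tend to [kappa a] times integrals against
    the weight: on the left they supply the difference part of [D v], on the right the summand
    [2 sum kappa], and the constant is [k + 2 lambda + 2]. *)
Lemma dunkl_green_hnorm k P v : hp k.+1 P ->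
  int_sphere (fun y => D v P y * hnorm y) =
  ((k + d)%:R + 2 * \sum_(a <- pos) kappa a) * int_sphere (fun y => dotp v y * P y * hnorm y).
Proof.
move=> hP.
have cP := hp_sphere hP.
have cDP : sphere_continuous (fun y => 'D_v P y).
  by apply: hpz_sphere; exact: (hpz_derive v (hP : hpz k.+1 _)).
have cvP : sphere_continuous (fun y => dotp v y * P y).
  by apply: sphere_continuousM => //; exact: hp_sphere (hp_dotp v).
have cdq a : a \in pos -> sphere_continuous (dquot a P).
  by move=> ap; apply: hpz_sphere; exact: hpz_dquot (pos_neq0 rs ap) (hP : hpz k.+1 _).
have ch := sphere_continuous_hnorm.
have sums (s : seq V) (F : nat -> V -> R) (G : V -> R) :
    (forall b, b \in s -> F n b @[n --> \oo] --> G b) ->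
    \sum_(b <- s) F n b @[n --> \oo] --> \sum_(b <- s) G b.
  elim: s => [|c s IH] cF.
    by rewrite big_nil; under eq_fun do rewrite big_nil; exact: cvg_cst.
  have IH' := IH (fun b bs => cF b (mem_tail c bs)).
  rewrite big_cons; under eq_fun do rewrite big_cons.
  by apply: cvgD => //; apply: cF; rewrite mem_head.
have E : int_sphere (fun y => 'D_v P y * hnorm y) +
   \sum_(a <- pos) dotp a v * (kappa a * int_sphere (fun y => dquot a P y * hnorm y)) =
   (k + d)%:R * int_sphere (fun y => dotp v y * P y * hnorm y) +
   2 * \sum_(a <- pos) kappa a * int_sphere (fun y => dotp v y * P y * hnorm y).
  pose F1 n := int_sphere (fun y => 'D_v P y * wprod Rs b0 kappa n y) +
    \sum_(a <- pos) dotp a v * int_sphere (fun y => dquot a P y *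
      (binrem (kappa a) n (polar_sq a y) * wprod_but Rs b0 kappa a n y)).
  pose F2 n := (k + d)%:R * int_sphere (fun y => dotp v y * P y * wprod Rs b0 kappa n y) +
    2 * \sum_(a <- pos) int_sphere (fun y => dotp v y * P y *
      (binrem (kappa a) n (polar_sq a y) * wprod_but Rs b0 kappa a n y)).
  have F12 : F1 = F2 by apply/funext => n; exact: approximate_green.
  have L1 : F1 n @[n --> \oo] --> int_sphere (fun y => 'D_v P y * hnorm y) +
      \sum_(a <- pos) dotp a v * (kappa a * int_sphere (fun y => dquot a P y * hnorm y)).
    apply: cvgD; first exact: cvg_int_wprod.
    apply: (sums pos (fun n a => _)) => a ap; apply: cvgM; first exact: cvg_cst.
    by apply: cvg_int_wprod_but => //; exact: cdq.
  have L2 : F2 n @[n --> \oo] --> (k + d)%:R * int_sphere (fun y => dotp v y * P y * hnorm y) +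
      2 * \sum_(a <- pos) kappa a * int_sphere (fun y => dotp v y * P y * hnorm y).
    apply: cvgD; first by apply: cvgM; [exact: cvg_cst|exact: cvg_int_wprod].
    apply: cvgM; first exact: cvg_cst.
    apply: (sums pos (fun n a => _)) => a ap.
    exact: cvg_int_wprod_but.
  by rewrite F12 in L1; exact: (cvg_unique _ L1 L2).
have -> : int_sphere (fun y => D v P y * hnorm y) =
    int_sphere (fun y => 'D_v P y * hnorm y +
      \sum_(a <- pos) (dotp a v * kappa a) * (dquot a P y * hnorm y)).
  congr int_sphere; apply/funext => y; rewrite /dunkl mulrDl; congr (_ + _).
  by rewrite mulr_suml; apply: eq_bigr => a _; ring.
have cG a : a \in pos -> sphere_continuous (fun y => (dotp a v * kappa a) * (dquot a P y * hnorm y)).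
  move=> ap; apply: sphere_continuousM; first exact: sphere_continuousC.
  by apply: sphere_continuousM => //; exact: cdq.
have [cS ES] := int_sphere_sum cG.
rewrite int_sphereD//; last exact: sphere_continuousM.
rewrite ES.
rewrite (_ : \sum_(a <- pos) _ = \sum_(a <- pos) dotp a v * (kappa a * int_sphere (fun y => dquot a P y * hnorm y))).
  by rewrite E -mulr_suml; ring.
rewrite big_seq [RHS]big_seq; apply: eq_bigr => a ap.
by rewrite int_sphereZ ?mulrA//; apply: sphere_continuousM => //; exact: cdq.
Qed.

End DunklGreen.

(** * The weighted functional and its Gaussian normalization *)

Section WeightedFunctional.
Variables (R : realType) (d : nat).
Hypothesis d_gt0 : (0 < d)%N.
Local Notation V := 'rV[R]_d.
Variables (Rs : seq V) (b0 : V) (kappa : V -> R).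
Hypotheses (rs : root_system Rs) (reg : regular Rs b0) (mult : multiplicity Rs kappa).
Implicit Types (f g P : V -> R) (x y a b v : V) (k l : int).

Local Notation pos := (pos_roots Rs b0).
Local Notation w := (hnorm Rs b0 kappa).

Definition wint f : R := int_sphere (fun y => f y * w y).

Let cw : sphere_continuous w := @sphere_continuous_hnorm _ _ _ b0 _ mult.

Lemma wintD f g : sphere_continuous f -> sphere_continuous g ->
  wint (fun y => f y + g y) = wint f + wint g.
Proof.
move=> cf cg; rewrite /wint -int_sphereD; [|exact: sphere_continuousM..].
by congr int_sphere; apply/funext => y; rewrite mulrDl.
Qed.

Lemma wintZ (c : R) f : sphere_continuous f -> wint (fun y => c * f y) = c * wint f.
Proof.
move=> cf; rewrite /wint -int_sphereZ; last exact: sphere_continuousM.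
by congr int_sphere; apply/funext => y; rewrite mulrA.
Qed.

Lemma wint0 : wint (fun=> 0) = 0.
Proof.
have c0 : sphere_continuous (fun _ : V => 0 : R) by exact: sphere_continuousC.
rewrite -[RHS](mul0r (wint (fun=> 0))) -wintZ//.
by congr wint; apply/funext => y; rewrite mul0r.
Qed.

(** Reflection invariance on the sphere was established for polynomials, so it is applied to the
    product with the approximate weight, itself invariant because [kappa] is, and then passed to the
    limit. *)
Lemma wint_refl a k f : a \in Rs -> hpz k f -> wint (f \o refl a) = wint f.
Proof.
move=> aR hf.
have H1 := cvg_int_wprod (b0 := b0) rs mult (hpz_sphere (hpz_refl a hf)).
have H2 := cvg_int_wprod (b0 := b0) rs mult (hpz_sphere hf).
suff E : (fun n => int_sphere (fun y => (f \o refl a) y * wprod Rs b0 kappa n y)) =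
    (fun n => int_sphere (fun y => f y * wprod Rs b0 kappa n y)).
  have H3 : (fun n => int_sphere (fun y => f y * wprod Rs b0 kappa n y)) @ \oo -->
    wint (f \o refl a) by rewrite -E; exact: H1.
  exact: (cvg_unique _ H3 H2).
apply/funext => n.
have hfW := hpz_mul hf (hp_wprod Rs b0 kappa n : hpz (Posz _) (wprod Rs b0 kappa n)).
rewrite -(int_sphere_refl_hpz d_gt0 a hfW); congr int_sphere; apply/funext => y /=.
congr (_ * _); pose T b := wpoly (kappa b) b n y.
rewrite /wprod -[LHS](@big_pos_refl _ _ _ _ rs reg _ _ _ xpredT T a aR)//.
  rewrite big_seq [RHS]big_seq; apply: eq_bigr => b bp.
  by rewrite /T (kappa_refl mult aR (pos_root bp)) wpoly_refl.
by move=> b bR; rewrite /T (kappa_opp rs mult)// wpoly_opp.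
Qed.

Lemma wint_odd n f : hp n f -> odd n -> wint f = 0.
Proof.
move=> hf on; have cf := hp_sphere hf.
have := int_sphere_opp (sphere_continuousM cf cw).
have -> : (fun x => f (- x) * w (- x)) = (fun x => -1 * (f x * w x)).
  apply/funext => x; rewrite -scaleN1r (hp_hom _ _ hf) -signr_odd on expr1 mulrA.
  congr (_ * _); rewrite /hnorm; apply: eq_bigr => b _.
  by rewrite scaleN1r dotpNr sqrrN.
rewrite int_sphereZ ?/wint//; last exact: sphere_continuousM.
by lra.
Qed.

Lemma hp_line n f x v : hp n f -> exists p : {poly R}, forall t : R, f (x + t *: v) = p.[t].
Proof.
elim/hp_induction => {n f} [c|n i f _ [p pE]|n f g _ [p pE] _ [q qE]|n].
- by exists c%:P => t; rewrite hornerC.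
- exists (((x 0 i)%:P + v 0 i *: 'X) * p) => t.
  by rewrite hornerM hornerD hornerC hornerZ hornerX !mxE pE [v 0 i * t]mulrC.
- by exists (p + q) => t; rewrite hornerD pE qE.
- by exists 0 => t; rewrite horner0.
Qed.

Lemma poly_eq0_of_horner (p : {poly R}) : (forall t, p.[t] = 0) -> p = 0.
Proof.
move=> p0; apply/eqP; apply: contraT => pn0.
have := max_poly_roots pn0 (rs := [seq i%:R | i <- iota 0 (size p)]).
rewrite size_map size_iota ltnn; apply.
  by apply/allP => _ /mapP[i _ ->]; apply/rootP.
by rewrite map_inj_uniq ?iota_uniq// => i j /eqP; rewrite eqr_nat => /eqP.
Qed.

(** Restricted to the line through [x] and [y], both functions are nonzero polynomials in one
    variable. *)
Lemma hp_mul_neq0 n m f g x y : hp n f -> hp m g -> f x != 0 -> g y != 0 ->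
  exists z, f z * g z != 0.
Proof.
move=> hf hg fx gy; have [p pE] := hp_line x (y - x) hf; have [q qE] := hp_line x (y - x) hg.
apply: contrapT => H; have : p * q = 0.
  apply: poly_eq0_of_horner => t; rewrite hornerM -pE -qE.
  by apply/eqP; apply: contraT => nz; case: H; exists (x + t *: (y - x)).
move=> /eqP; rewrite mulf_eq0 => /orP[] /eqP E.
  by move: fx; rewrite -[x]addr0 -(scale0r (y - x)) pE E horner0 eqxx.
by move: gy; rewrite -[y](subrK x) addrC -[y - x]scale1r qE E horner0 eqxx.
Qed.

(** The weight vanishes on the hyperplanes, so a point with [f x != 0] is not enough. The product of
    [f] with all the linear forms is nonzero somewhere, and normalizing that point gives a point of
    the sphere where both [f] and the weight are nonzero. *)
Lemma wint_sqr_eq0 n f : hp n f -> wint (fun y => f y * f y) = 0 -> f = fun=> 0.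
Proof.
move=> hf I0; apply/funext => x; apply/eqP; apply: contraT => fx.
have [g [m hg] [[y gy] gz]] : exists2 g : V -> R, exists m, hp m g & (exists y, g y != 0) /\
    (forall z, g z != 0 -> z != 0 /\ forall b, b \in pos -> dotp b z != 0).
  have hne : forall b, b \in pos -> dotp b b != 0 by move=> b bp; rewrite dotpxx_eq0 (pos_neq0 rs bp).
  have : forall b, b \in pos -> b \in pos by [].
  elim: {1 3}pos => [|c s IH] sub.
    (* The coordinate forces [z != 0] even if there are no roots. *)
    exists (fun z => z 0 (Ordinal d_gt0)); first by exists 1%N; exact: hp_coord.
    split; last by move=> z z0; split=> //; apply: contraNneq z0 => ->; rewrite mxE.
    by exists (delta_mx 0 (Ordinal d_gt0)); rewrite mxE !eqxx oner_eq0.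
  have [g [m hg] [[y gy] gz]] := IH (fun b bs => sub b (mem_tail c bs)).
  exists (fun z => g z * dotp c z); first by exists (m + 1)%N; apply: hp_mul => //; exact: hp_dotp.
  split; first exact: hp_mul_neq0 hg (hp_dotp c) gy (hne c (sub c (mem_head _ _))).
  move=> z; rewrite mulf_eq0 negb_or => /andP[/gz[z0 zb] cz]; split=> // b.
  by rewrite inE => /predU1P[->|/zb].
have [z] := hp_mul_neq0 hf hg fx gy.
rewrite mulf_eq0 negb_or => /andP[fz /gz[z0 zb]].
set u := (enorm z)^-1 *: z; have u1 : enorm u = 1 by exact: enorm_normalize.
have e0 : (enorm z)^-1 != 0 by rewrite invr_eq0 enorm_eq0.
have fu : f u != 0 by rewrite (hp_hom _ _ hf) mulf_neq0// expf_neq0.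
have wu : 0 < w u.
  rewrite /hnorm big_seq; apply: prodr_gt0 => b bp; apply: powR_gt0.
  rewrite divr_gt0 ?dotp_gt0 ?(pos_neq0 rs bp)//.
  by rewrite lt_neqAle sqr_ge0 andbT eq_sym sqrf_eq0 dotpZr mulf_neq0// zb.
have w0 v : 0 <= w v by apply: prodr_ge0 => b _; exact: powR_ge0.
have : 0 < wint (fun y => f y * f y).
  rewrite /wint; apply: (int_sphere_gt0 _ _ u1).
  - by apply: sphere_continuousM => //; apply: sphere_continuousM; exact: hp_sphere hf.
  - by move=> v _; rewrite mulr_ge0// -expr2 sqr_ge0.
  - by rewrite mulr_gt0// lt_neqAle -expr2 sqr_ge0 andbT eq_sym sqrf_eq0.
by rewrite I0 ltxx.
Qed.

Lemma wint1_gt0 : 0 < wint (fun=> 1).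
Proof.
rewrite lt_neqAle eq_sym; apply/andP; split; last first.
  apply: int_sphere_ge0 => [|y _]; first by apply: sphere_continuousM => //; exact: sphere_continuousC.
  by rewrite mul1r; apply: prodr_ge0 => b _; exact: powR_ge0.
apply/eqP => H; have := @wint_sqr_eq0 0 (fun=> 1) (hp_const _ 1).
rewrite (_ : (fun y => 1 * 1) = fun=> 1) ?mulr1// => /(_ H) /(congr1 (fun F => F 0)) /eqP.
by rewrite oner_eq0.
Qed.

Local Notation lam := (lambda Rs b0 kappa).
Local Notation Dj := (dunklj Rs b0 kappa).

Lemma lambda_ge : 0 < 2 * lam + 2.
Proof.
rewrite /lambda; have : 0 <= \sum_(a <- pos) kappa a.
  by rewrite big_seq; apply: sumr_ge0 => a ap; apply: (kappa_ge0 mult); exact: pos_root ap.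
have : (1 : R) <= d%:R by rewrite ler1n.
lra.
Qed.

(* ratio between the Gaussian and the spherical integral of a homogeneous polynomial *)
Fixpoint gauss_moment (n : nat) : R :=
  match n with
  | 0 | 1 => 1
  | n'.+2 => (n'%:R + 2 * lam + 2) * gauss_moment n'
  end.

Lemma gauss_moment_gt0 n : 0 < gauss_moment n.
Proof.
suff : 0 < gauss_moment n /\ 0 < gauss_moment n.+1 by case.
elim: n => [|n [H1 H2]]; first by split.
split=> //; rewrite /= mulr_gt0//.
have := lambda_ge; have : 0 <= n%:R :> R by []; lra.
Qed.

Lemma gauss_moment_double n : gauss_moment (2 * n) = 2 ^+ n * poch (lam + 1) n.
Proof.
elim: n => [|n IH]; first by rewrite muln0 expr0 /poch big_ord0 mul1r.
rewrite mulnS add2n /= IH /poch big_ord_recr /= exprS natrM.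
by ring.
Qed.

(** The degree is an argument since [f] is a bare function. In negative degrees, where homogeneous
    functions are 0, the factor 1 is a dummy. *)
Definition gint (k : int) f : R := (if k is Posz n then gauss_moment n else 1) * wint f.

Lemma gintD k l f g m : hpz k f -> hpz l g -> gint m (fun y => f y + g y) = gint m f + gint m g.
Proof. by move=> /hpz_sphere cf /hpz_sphere cg; rewrite /gint wintD// mulrDr. Qed.

Lemma gintZ k (c : R) f m : hpz k f -> gint m (fun y => c * f y) = c * gint m f.
Proof. by move=> /hpz_sphere cf; rewrite /gint wintZ// mulrCA. Qed.

Lemma gintB k l f g m : hpz k f -> hpz l g -> gint m (fun y => f y - g y) = gint m f - gint m g.
Proof.
move=> hf hg; rewrite (_ : (fun y => _) = (fun y => f y + (-1) * g y)).
  by rewrite (gintD _ hf (hpz_scale (-1) hg)) (gintZ _ _ hg) mulN1r.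
by apply/funext => y; rewrite mulN1r.
Qed.

Lemma gint0 k : gint k (fun=> 0) = 0.
Proof. by rewrite /gint wint0 mulr0. Qed.

Lemma gint_sum k m (I : Type) (s : seq I) (F : I -> V -> R) : (forall i, hpz k (F i)) ->
  gint m (fun y => \sum_(i <- s) F i y) = \sum_(i <- s) gint m (F i).
Proof.
move=> hF; elim: s => [|i s IH].
  by rewrite big_nil -[RHS](gint0 m); congr gint; apply/funext => y; rewrite big_nil.
rewrite big_cons -IH -(gintD _ (hF i) (hpz_sum s hF)).
by congr gint; apply/funext => y; rewrite big_cons.
Qed.

Lemma hpz_dunklj j k f : hpz k f -> hpz (k - 1) (Dj j f).
Proof. exact: hpz_dunkl. Qed.

(** The recursion of [gauss_moment] absorbs the constant of [dunkl_green_hnorm], which gives the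
    identity the same form in all degrees. In degree 0 both sides vanish, the right one by
    parity. *)
Lemma gint_green j k f : hpz k f -> gint (k - 1) (Dj j f) = gint (k + 1) (fun x => x 0 j * f x).
Proof.
move=> /hpzP[[n -> hf]|->]; last first.
  rewrite /dunklj dunkl_cst gint0 (_ : (fun x => _) = fun=> 0) ?gint0//.
  by apply/funext => x; rewrite mulr0.
case: n hf => [|n] hf.
  have := hpz_dunklj j (hf : hpz 0 f); rewrite sub0r => /= ->; rewrite gint0.
  by rewrite /gint (wint_odd (hp_mulx j hf))// mulr0.
have -> : n.+1%:Z - 1 = n by rewrite intS; ring.
have -> : n.+1%:Z + 1 = n.+2 by rewrite !intS; ring.
rewrite /gint /= /wint (dunkl_green_hnorm d_gt0 rs reg mult _ hf).
have -> : (fun y => dotp (ebasis R j) y * f y * w y) = (fun y => y 0 j * f y * w y).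
  by apply/funext => y; rewrite dotp_delta.
by rewrite /lambda natrD; field.
Qed.

Lemma dquot_self a f x : dquot a f (refl a x) = dquot a f x.
Proof.
rewrite /dquot dotp_refl_same oppr_eq0; case: ifPn => [ax|].
  by rewrite reflK invrN mulrN -mulNr opprB.
by rewrite negbK => /eqP ax; rewrite refl_fix.
Qed.

(* The adjoint of [D_j] for the Gaussian inner product is [x_j - D_j]. *)
Lemma gint_parts j k l f g : hpz k f -> hpz l g ->
  gint (k + l - 1) (fun x => Dj j f x * g x) + gint (k + l - 1) (fun x => f x * Dj j g x) =
  gint (k + l + 1) (fun x => x 0 j * (f x * g x)).
Proof.
move=> hf hg; have hfg := hpz_mul hf hg.
have hDf := hpz_mul (hpz_dunklj j hf) hg; have hDg := hpz_mul hf (hpz_dunklj j hg).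
rewrite -(gintD _ hDf hDg) -gint_green// /dunklj (dunklM _ _ rs _ hf hg).
(* The guard makes [F a] polynomial for every vector [a], as [hpz_sum] demands. *)
pose F a x := if a == 0 then 0 else
  kappa a * dotp a (ebasis R j) * (dotp a x * dquot a f x * dquot a g x).
have hF a : hpz (k + l - 1) (F a).
  rewrite /F; case: eqVneq => [_|a0]; first exact: hpz_zero.
  apply: hpz_scale; have := hpz_mul (hpz_mul (hp_dotp a : hpz 1 _) (hpz_dquot a0 hf)) (hpz_dquot a0 hg).
  by congr hpz; ring.
have E x : \sum_(a <- pos) kappa a * dotp a (ebasis R j) * (dotp a x * dquot a f x * dquot a g x) =
    \sum_(a <- pos) F a x.
  rewrite big_seq [RHS]big_seq; apply: eq_bigr => a ap.
  by rewrite /F (negbTE (pos_neq0 rs ap)).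
under [X in _ = gint _ X]eq_fun do rewrite E.
rewrite (gintB _ (hpz_add (k := k + l - 1) _ _) (hpz_sum pos hF)).
- rewrite (gint_sum _ _ hF) big_seq big1 ?subr0// => a ap.
  (* Under [r_a] the factor [<a, x>] is odd and both quotients are even, so this invariant integral
     equals its opposite. *)
  have : wint (F a \o refl a) = wint (F a) by apply: (wint_refl (pos_root ap) (hF a)).
  rewrite (_ : F a \o refl a = (fun x => -1 * F a x)).
    rewrite wintZ; last exact: hpz_sphere (hF a).
    by rewrite /gint => H; rewrite (_ : wint (F a) = 0) ?mulr0//; lra.
  apply/funext => x /=; rewrite /F; case: eqP => [_|_]; first by rewrite mulr0.
  by rewrite dotp_refl_same !dquot_self; ring.
- by move: hDf; congr hpz; ring.
- by move: hDg; congr hpz; ring.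
Qed.

End WeightedFunctional.

(** * Harmonic polynomials *)

Section DunklAlgebra.
Variables (R : realType) (d : nat).
Hypothesis d_gt0 : (0 < d)%N.
Local Notation V := 'rV[R]_d.
Variables (Rs : seq V) (b0 : V) (kappa : V -> R).
Hypotheses (rs : root_system Rs) (reg : regular Rs b0) (mult : multiplicity Rs kappa).
Implicit Types (f g P : V -> R) (x y a b v : V) (k l : int).

Local Notation pos := (pos_roots Rs b0).
Local Notation Dj := (dunklj Rs b0 kappa).
Local Notation Delta := (dlap Rs b0 kappa).
Local Notation wint := (wint Rs b0 kappa).
Local Notation gint := (gint Rs b0 kappa).

Lemma hpz_Dj j k f : hpz k f -> hpz (k - 1) (Dj j f).
Proof. exact: hpz_dunkl. Qed.

Lemma hpz_eq k l f : k = l -> hpz k f -> hpz l f.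
Proof. by move=> ->. Qed.

Lemma hpz_hp k f : hpz k f -> exists n, hp n f.
Proof. by move=> /hpzP[[n _ hf]|->]; [exists n|exists 0%N; exact: hp_const]. Qed.

Definition shift_op i j f := dunkl_shift Rs b0 kappa (delta_mx 0 i) (delta_mx 0 j) f.

Lemma shift_op_sym i j : shift_op i j = shift_op j i.
Proof.
apply/funext => f; apply/funext => x; rewrite /shift_op /dunkl_shift dotpC; congr (_ + _).
by apply: eq_bigr => a _; ring.
Qed.

Lemma hpz_shift i j k f : hpz k f -> hpz k (shift_op i j f).
Proof.
move=> hf; apply: hpz_add; first exact: hpz_scale.
by apply: hpz_sum => a; apply: hpz_scale; exact: (hpz_refl a hf).
Qed.

Lemma Dj_mulx i j k f : hpz k f ->
  Dj i (fun x => x 0 j * f x) = (fun x => x 0 j * Dj i f x + shift_op i j f x).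
Proof. exact: dunkl_mulx. Qed.

(** Three integrations by parts move both operators to [g]. The first four terms together are
    symmetric in [i] and [j], so only the last one survives in a commutator. *)
Lemma gint_dunkl2 i j k l f g : hpz k f -> hpz l g ->
  gint (k + l - 2) (fun x => Dj i (Dj j f) x * g x) =
  gint (k + l + 2) (fun x => x 0 i * (x 0 j * (f x * g x)))
  - gint (k + l) (fun x => x 0 i * (f x * Dj j g x))
  - gint (k + l) (fun x => f x * shift_op j i g x)
  - gint (k + l) (fun x => x 0 j * (f x * Dj i g x))
  + gint (k + l - 2) (fun x => f x * Dj j (Dj i g) x).
Proof.
have lin (a1 a2 a3 b1 b2 c h e : R) :
  a1 + a2 = a3 -> a3 + (b1 + b2) = c -> a2 + e = h -> a1 = c - b1 - b2 - h + e by lra.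
move=> hf hg.
have parts := gint_parts d_gt0 rs reg mult.
have hDjf := hpz_Dj j hf; have hDig := hpz_Dj i hg.
have A1 := parts i _ _ _ _ hDjf hg.
have A2 := parts j _ _ _ _ hf (hpz_mulx i hg).
have A3 := parts j _ _ _ _ hf hDig.
have e1 : k - 1 + l - 1 = k + l - 2 by ring.
have e2 : k - 1 + l + 1 = k + l by ring.
have e3 : k + (l + 1) - 1 = k + l by ring.
have e4 : k + (l + 1) + 1 = k + l + 2 by ring.
have e5 : k + (l - 1) - 1 = k + l - 2 by ring.
have e6 : k + (l - 1) + 1 = k + l by ring.
rewrite e1 e2 in A1; rewrite e3 e4 in A2; rewrite e5 e6 in A3.
have A4 : gint (k + l) (fun x => f x * Dj j (fun x => x 0 i * g x) x) =
    gint (k + l) (fun x => x 0 i * (f x * Dj j g x)) + gint (k + l) (fun x => f x * shift_op j i g x).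
  rewrite (Dj_mulx _ _ hg).
  have h1 : hpz (k + l) (fun x => x 0 i * (f x * Dj j g x)).
    by apply: hpz_eq (hpz_mulx i (hpz_mul hf (hpz_Dj j hg))); ring.
  have h2 := hpz_mul hf (hpz_shift j i hg).
  rewrite -(gintD _ mult _ h1 h2); congr gint; apply/funext => x; ring.
have A5 : gint (k + l) (fun x => x 0 i * (Dj j f x * g x)) =
    gint (k + l) (fun x => Dj j f x * (x 0 i * g x)).
  by congr gint; apply/funext => x; ring.
have A6 : gint (k + l + 2) (fun x => x 0 j * (f x * (x 0 i * g x))) =
    gint (k + l + 2) (fun x => x 0 i * (x 0 j * (f x * g x))).
  by congr gint; apply/funext => x; ring.
rewrite A5 in A1; rewrite A4 A6 in A2.
exact: lin A1 A2 A3.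
Qed.

Lemma Dj_zero j : Dj j (fun=> 0) = fun=> 0.
Proof. exact: dunkl_cst. Qed.

Lemma hpz_neg k f : k < 0 -> hpz k f -> f = fun=> 0.
Proof. by case: k. Qed.

(* The commutator [D_i, D_j] is skew for the Gaussian inner product and lowers the degree by 2;
   by induction on the degree its square vanishes, hence it vanishes. *)
Lemma dunkl_comm i j k f : hpz k f -> Dj i (Dj j f) = Dj j (Dj i f).
Proof.
have hC k' f' : hpz k' f' -> hpz (k' - 2) (fun x => Dj i (Dj j f') x - Dj j (Dj i f') x).
  move=> hf'; apply: hpz_sub; last by apply: hpz_eq (hpz_Dj j (hpz_Dj i hf')); ring.
  by apply: hpz_eq (hpz_Dj i (hpz_Dj j hf')); ring.
have key n f' : hp n f' -> (forall m g, (m < n)%N -> hp m g -> Dj i (Dj j g) = Dj j (Dj i g)) ->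
    Dj i (Dj j f') = Dj j (Dj i f').
  move=> hf' IH.
  (* [h] lies two degrees below [f'], so by induction the commutator vanishes on [h]; then
     [gint_dunkl2] with [g = h] shows that the integral of [h^2] is 0. *)
  set h := fun x => Dj i (Dj j f') x - Dj j (Dj i f') x.
  have hh : hpz (n%:Z - 2) h := hC n f' hf'.
  suff h0 : h = fun=> 0.
    apply/funext => x; apply/eqP; rewrite -subr_eq0; apply/eqP.
    exact: (congr1 (fun F => F x) h0).
  case: n hf' IH hh => [|[|n]] hf' IH hh; [exact: hpz_neg hh|exact: hpz_neg hh|].
  have e2 : n.+2%:Z - 2 = n by rewrite !intS; ring.
  rewrite e2 in hh.
  have Ch : Dj i (Dj j h) = Dj j (Dj i h) by apply: (IH n) => //; exact: leqnSn.
  have hDji : hpz (n.+2%:Z - 2) (Dj j (Dj i f')) by apply: hpz_eq (hpz_Dj j (hpz_Dj i (hf' : hpz n.+2 f'))); ring.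
  have hDij : hpz (n.+2%:Z - 2) (Dj i (Dj j f')) by apply: hpz_eq (hpz_Dj i (hpz_Dj j (hf' : hpz n.+2 f'))); ring.
  have G1 := gint_dunkl2 i j (hf' : hpz n.+2 f') hh.
  have G2 := gint_dunkl2 j i (hf' : hpz n.+2 f') hh.
  have G : gint (n.+2%:Z + n%:Z - 2) (fun x => h x * h x) = 0.
    have -> : (fun x => h x * h x) = (fun x => Dj i (Dj j f') x * h x - Dj j (Dj i f') x * h x).
      by apply/funext => x; rewrite -mulrBl.
    rewrite (gintB _ mult _ (hpz_mul hDij (hh : hpz n h)) (hpz_mul hDji (hh : hpz n h))) G1 G2.
    have -> : (fun x => x 0 j * (x 0 i * (f' x * h x))) = (fun x => x 0 i * (x 0 j * (f' x * h x))).
      by apply/funext => x; ring.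
    by rewrite Ch (shift_op_sym i j); ring.
  apply: (wint_sqr_eq0 d_gt0 rs mult (hh : hp n h)).
  have e3 : n.+2%:Z + n%:Z - 2 = (n + n)%N by rewrite !intS PoszD; ring.
  move: G; rewrite e3 /gint => /eqP; rewrite mulf_eq0 gt_eqF ?gauss_moment_gt0//= => /eqP.
  exact.
move=> /hpz_hp[n]; elim/ltn_ind: n f => n IH f' hf'.
by apply: (key n f' hf') => m g mn hg; exact: (IH m mn g hg).
Qed.

Lemma Delta_zero : Delta (fun=> 0) = fun=> 0.
Proof. by apply/funext => x; rewrite /dlap big1// => j _; rewrite !Dj_zero. Qed.

Lemma hpz_Delta k f : hpz k f -> hpz (k - 2) (Delta f).
Proof.
move=> hf; apply: hpz_sum => j; apply: hpz_eq (hpz_Dj j (hpz_Dj j hf)); ring.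
Qed.

Lemma hpz_iter_Delta k n f : hpz k f -> hpz (k - 2 * n%:Z) (iter n Delta f).
Proof.
move=> hf; elim: n => [|n IH]; first by rewrite mulr0 subr0.
by rewrite iterS; apply: hpz_eq (hpz_Delta IH); rewrite intS; ring.
Qed.

Lemma DjD j k l f g : hpz k f -> hpz l g ->
  Dj j (fun x => f x + g x) = (fun x => Dj j f x + Dj j g x).
Proof. exact: dunklD. Qed.

Lemma DjZ j k (c : R) f : hpz k f -> Dj j (fun x => c * f x) = (fun x => c * Dj j f x).
Proof. exact: (dunklZ _ _ rs). Qed.

Lemma Dj_sum j k (I : Type) (s : seq I) (F : I -> V -> R) : (forall i, hpz k (F i)) ->
  Dj j (fun x => \sum_(i <- s) F i x) = (fun x => \sum_(i <- s) Dj j (F i) x).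
Proof.
move=> hF; elim: s => [|i s IH].
  rewrite (_ : (fun x => _) = fun=> 0); last by apply/funext => x; rewrite big_nil.
  by rewrite Dj_zero; apply/funext => x; rewrite big_nil.
rewrite (_ : (fun x => _) = fun x => F i x + \sum_(i <- s) F i x); last first.
  by apply/funext => x; rewrite big_cons.
rewrite (DjD _ (hF i) (hpz_sum s hF)) IH.
by apply/funext => x; rewrite big_cons.
Qed.

Lemma DeltaD k l f g : hpz k f -> hpz l g ->
  Delta (fun x => f x + g x) = (fun x => Delta f x + Delta g x).
Proof.
move=> hf hg; apply/funext => x; rewrite /dlap -big_split/=; apply: eq_bigr => j _.
by rewrite (DjD _ hf hg) (DjD _ (hpz_Dj j hf) (hpz_Dj j hg)).
Qed.

Lemma DeltaZ k (c : R) f : hpz k f -> Delta (fun x => c * f x) = (fun x => c * Delta f x).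
Proof.
move=> hf; apply/funext => x; rewrite /dlap mulr_sumr; apply: eq_bigr => j _.
by rewrite (DjZ _ _ hf) (DjZ _ _ (hpz_Dj j hf)).
Qed.

Lemma Dj_Delta j k f : hpz k f -> Dj j (Delta f) = Delta (Dj j f).
Proof.
move=> hf; rewrite /dlap (Dj_sum j (k := k - 1 - 1)); last by move=> i; exact/hpz_Dj/hpz_Dj.
apply/funext => x; apply: eq_bigr => i _.
by rewrite (dunkl_comm j i (hpz_Dj i hf)) (dunkl_comm j i hf).
Qed.

Lemma Dj_iter_Delta j k n f : hpz k f -> Dj j (iter n Delta f) = iter n Delta (Dj j f).
Proof.
move=> hf; elim: n => // n IH.
by rewrite !iterS (Dj_Delta _ (hpz_iter_Delta n hf)) IH.
Qed.

(** Commuting [x_j] through two copies of [D_i] leaves a shift operator once after and once before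
    [D_i]. Summed over [i], their reflection parts are [D_a f] at [r_a x] and [D_a (f \o r_a)] at
    [x], which cancel because [r_a] sends [a] to [- a]; what is left is [2 D_j]. *)
Lemma Delta_mulx j k f : hpz k f ->
  Delta (fun x => x 0 j * f x) = (fun x => x 0 j * Delta f x + 2 * Dj j f x).
Proof.
move=> hz; have [n hf] := hpz_hp hz; have {k}hz : hpz n f := hf.
apply/funext => x; rewrite {1}/dlap.
have E i : Dj i (Dj i (fun x => x 0 j * f x)) x =
    x 0 j * Dj i (Dj i f) x + (shift_op i j (Dj i f) x + Dj i (shift_op i j f) x).
  rewrite (Dj_mulx _ _ hz) (DjD i (hpz_mulx j (hpz_Dj i hz)) (hpz_shift i j hz)).
  by rewrite (Dj_mulx _ _ (hpz_Dj i hz)) [RHS]addrA.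
rewrite (eq_bigr _ (fun i _ => E i)) big_split/= -mulr_sumr; congr (_ + _).
pose e := delta_mx 0 j : V.
have S1 i : shift_op i j (Dj i f) x = e 0 i * Dj i f x +
    \sum_(a <- pos) (2 * kappa a * dotp a e / dotp a a) * (a 0 i * Dj i f (refl a x)).
  rewrite /shift_op /dunkl_shift dotp_delta; congr (_ + _); apply: eq_bigr => a _.
  by rewrite [dotp a (delta_mx 0 i)]dotpC dotp_delta -/e; ring.
have S2 i : Dj i (shift_op i j f) x = e 0 i * Dj i f x +
    \sum_(a <- pos) (2 * kappa a * dotp a e / dotp a a) * (a 0 i * Dj i (f \o refl a) x).
  rewrite /shift_op /dunkl_shift.
  rewrite (DjD i (k := n) (l := n)); last 2 first.
  - exact: hpz_scale.
  - by apply: hpz_sum => a; apply: hpz_scale; exact: (hpz_refl a hz).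
  rewrite (DjZ _ _ hz) dotp_delta; congr (_ + _).
  rewrite (Dj_sum i (k := n)); last by move=> a; apply: hpz_scale; exact: (hpz_refl a hz).
  apply: eq_bigr => a _; rewrite (DjZ _ _ (hpz_refl a hz)).
  by rewrite [dotp a (delta_mx 0 i)]dotpC dotp_delta -/e; ring.
have sumD a g m y : hp m g -> \sum_i a 0 i * Dj i g y = dunkl Rs b0 kappa a g y.
  by move=> hg; exact: (dunkl_sum_delta _ _ _ _ _ hg).
under eq_bigr => i _ do rewrite S1 S2.
rewrite !big_split/= (sumD e f n x hf).
rewrite [X in _ + X + _]exchange_big [X in _ + (_ + X)]exchange_big/=.
set A := \sum_(a <- pos) _; set B := \sum_(a <- pos) _.
suff AB : A + B = 0.
  have -> : dunkl Rs b0 kappa e f x = Dj j f x by [].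
  by rewrite addrACA AB addr0; ring.
rewrite /A /B -big_split/= big_seq big1// => a ap.
rewrite -!mulr_sumr (sumD a f n (refl a x) hf) (sumD a (f \o refl a) n x (hp_refl a hf)).
rewrite (dunkl_refl rs reg mult _ (pos_root ap) hz) refl_self /=.
have -> : dunkl Rs b0 kappa (- a) f (refl a x) = - dunkl Rs b0 kappa a f (refl a x).
  have := dunkl_linv Rs b0 kappa (-1) a 0 (refl a x) hf; rewrite scaleN1r addr0 => ->.
  have := dunkl_linv Rs b0 kappa 1 0 0 (refl a x) hf; rewrite scale1r addr0; lra.
by ring.
Qed.

Lemma iter_Delta_zero n : iter n Delta (fun=> 0) = fun=> 0.
Proof. by elim: n => // n IH; rewrite iterS IH Delta_zero. Qed.

(** Each Laplacian contributes one commutator [2 D_j], and these can be collected because [D_j] and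
    [Delta] commute. *)
Lemma iter_Delta_mulx j k n f : hpz k f ->
  iter n.+1 Delta (fun x => x 0 j * f x) =
  (fun x => x 0 j * iter n.+1 Delta f x + (2 * n.+1%:R) * Dj j (iter n Delta f) x).
Proof.
move=> hf; elim: n => [|n IH]; first by rewrite /= (Delta_mulx j hf) mulr1.
rewrite iterS IH (DeltaD (hpz_mulx j (hpz_iter_Delta n.+1 hf))
  (hpz_scale (2 * n.+1%:R) (hpz_Dj j (hpz_iter_Delta n hf)))).
rewrite (Delta_mulx j (hpz_iter_Delta n.+1 hf)) (DeltaZ _ (hpz_Dj j (hpz_iter_Delta n hf))).
rewrite -(Dj_Delta j (hpz_iter_Delta n hf)) -iterS.
by apply/funext => x; rewrite -[n.+2]addn1 natrD /=; ring.
Qed.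

Definition mono (s : seq 'I_d) : V -> R := fun x => \prod_(j <- s) x 0 j.
Definition Dword (s : seq 'I_d) f := foldr Dj f s.

Lemma mono_cons j s : mono (j :: s) = (fun x => x 0 j * mono s x).
Proof. by apply/funext => x; rewrite /mono big_cons. Qed.

Lemma hp_mono s : hp (size s) (mono s).
Proof.
elim: s => [|j s IH]; last by rewrite mono_cons; exact: hp_mulx.
by rewrite /mono (_ : (fun x => _) = fun=> 1); [exact: hp_const|apply/funext => x; rewrite big_nil].
Qed.

Lemma hpz_Dword s k f : hpz k f -> hpz (k - (size s)%:Z) (Dword s f).
Proof.
move=> hf; elim: s => [|j s IH] /=; first by rewrite subr0.
by apply: hpz_eq (hpz_Dj j IH); rewrite intS; ring.
Qed.

Lemma Dword_Dj s j k f : hpz k f -> Dj j (Dword s f) = Dword s (Dj j f).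
Proof.
move=> hf; elim: s => //= i s <-.
by rewrite (dunkl_comm j i (hpz_Dword s hf)).
Qed.

Lemma Dword_iter_Delta s k n f : hpz k f -> Dword s (iter n Delta f) = iter n Delta (Dword s f).
Proof.
move=> hf; elim: s => //= j s IH.
by rewrite IH (Dj_iter_Delta _ _ (hpz_Dword s hf)).
Qed.

(* Up to grading: Gaussian integral of [w P] against [e^(-Delta/2) w] equals that of [w(D) P]. *)
Lemma gint_word s N l P : (size s < N)%N -> hpz l P ->
  gint (l - (size s)%:Z) (Dword s P) =
  \sum_(n < N) (- 2^-1) ^+ n / n`!%:R *
    gint ((size s)%:Z + l - 2 * n%:Z) (fun x => iter n Delta (mono s) x * P x).
Proof.
elim: s l P N => [|j s IH] l P [|N]// sN hP.
  rewrite big_ord_recl /= big1 => [|i _].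
    rewrite mulr0 !subr0 add0r expr0 fact0 divr1 mul1r addr0; congr gint.
    by apply/funext => x; rewrite /mono big_nil mul1r.
  rewrite (_ : (fun x => _) = fun=> 0) ?(gint0 _ mult) ?mulr0//.
  have E : iter (lift ord0 i) Delta (mono [::]) = fun=> 0.
    apply: (hpz_neg _ (hpz_iter_Delta (lift ord0 i) (hp_mono [::] : hpz 0 _))).
    by rewrite sub0r oppr_lt0 mulr_gt0.
  by apply/funext => x; rewrite [Delta _](E) mul0r.
have hm : hpz (size s) (mono s) := hp_mono s.
have -> : Dword (j :: s) P = Dword s (Dj j P) by rewrite -(Dword_Dj s j hP).
have -> : l - (size (j :: s))%:Z = l - 1 - (size s)%:Z by rewrite /= intS; ring.
rewrite (IH _ _ N.+1 _ (hpz_Dj j hP)); last exact: ltnW.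
have hd n : hpz ((size s)%:Z - 2 * n%:Z) (iter n Delta (mono s)) by exact: hpz_iter_Delta.
(* Integration by parts splits the [n]-th summand for [s] into [A n - B n]; the summand of index
   [n + 1] for [j :: s] recombines [A (n + 1)] with [B n]. *)
pose A n := gint ((size s).+1%:Z + l - 2 * n%:Z) (fun x => x 0 j * (iter n Delta (mono s) x * P x)).
pose B n := gint ((size s)%:Z + l - 1 - 2 * n%:Z) (fun x => Dj j (iter n Delta (mono s)) x * P x).
have L (n : nat) : gint ((size s)%:Z + (l - 1) - 2 * n%:Z) (fun x => iter n Delta (mono s) x * Dj j P x) =
    A n - B n.
  have := gint_parts d_gt0 rs reg mult j (hd n) hP.
  have -> : (size s)%:Z - 2 * n%:Z + l - 1 = (size s)%:Z + l - 1 - 2 * n%:Z by ring.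
  have -> : (size s)%:Z - 2 * n%:Z + l + 1 = (size s).+1%:Z + l - 2 * n%:Z by rewrite intS; ring.
  have -> : (size s)%:Z + (l - 1) - 2 * n%:Z = (size s)%:Z + l - 1 - 2 * n%:Z by ring.
  by rewrite /A /B; lra.
under eq_bigr => n _ do rewrite L mulrBr.
rewrite sumrB.
have Rt (n : nat) : gint ((size (j :: s))%:Z + l - 2 * n.+1%:Z)
      (fun x => iter n.+1 Delta (mono (j :: s)) x * P x) = A n.+1 + 2 * n.+1%:R * B n.
  rewrite mono_cons (iter_Delta_mulx j n hm).
  have h1 := hpz_mul (hpz_mulx j (hd n.+1)) hP.
  have h2 := hpz_scale (2 * n.+1%:R : R) (hpz_mul (hpz_Dj j (hd n)) hP).
  rewrite (_ : (fun x => _) = (fun x => x 0 j * iter n.+1 Delta (mono s) x * P x +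
     (2 * n.+1%:R) * (Dj j (iter n Delta (mono s)) x * P x))); last first.
    by apply/funext => x; ring.
  rewrite (gintD _ mult _ h1 h2) (gintZ _ mult _ _ (hpz_mul (hpz_Dj j (hd n)) hP)); congr (_ + _ * _).
    by rewrite /A; congr gint; apply/funext => x; rewrite mulrA.
  by rewrite /B; congr gint; rewrite /= !intS; ring.
have G0 : gint ((size (j :: s))%:Z + l - 2 * 0%:Z) (fun x => iter 0 Delta (mono (j :: s)) x * P x) = A 0%N.
  by rewrite /A mono_cons; congr gint; apply/funext => x; rewrite /= mulrA.
(* The shifted sum has no partner for the last [B]; it is zero, since [size s < N] makes its degree
   negative. *)
have BN : B N = 0.
  rewrite /B (hpz_neg _ (hpz_Dj j (hd N))); last by move: sN => /=; lia.
  rewrite (_ : (fun x => _) = fun=> 0) ?(gint0 _ mult)//.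
  by apply/funext => x; rewrite mul0r.
rewrite [X in _ - X]big_ord_recr/= BN mulr0 addr0 -sumrN !big_ord_recl/= G0 -addrA; congr (_ + _).
rewrite -big_split/=; apply: eq_bigr => i _.
have := Rt i; rewrite /= /bump /= add1n => ->; rewrite mulrDr; congr (_ + _).
move: (B i) => Bi; rewrite factS natrM exprS; move: ((- 2^-1) ^+ i) => t.
have hu : i.+1%:R != 0 :> R by rewrite pnatr_eq0.
have hv : i`!%:R != 0 :> R by rewrite pnatr_eq0 -lt0n fact_gt0.
move: hu hv; move: (i.+1%:R : R) (i`!%:R : R) => u v hu hv.
by field; rewrite hv hu.
Qed.

End DunklAlgebra.

(** * The mean value formula for homogeneous polynomials *)

Section HarmonicMean.
Variables (R : realType) (d : nat).
Hypothesis d_gt0 : (0 < d)%N.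
Local Notation V := 'rV[R]_d.
Variables (Rs : seq V) (b0 : V) (kappa : V -> R).
Hypotheses (rs : root_system Rs) (reg : regular Rs b0) (mult : multiplicity Rs kappa).
Implicit Types (f g P : V -> R) (x y a b v : V) (k l : int) (deg : nat).

Local Notation pos := (pos_roots Rs b0).
Local Notation Dj := (dunklj Rs b0 kappa).
Local Notation Delta := (dlap Rs b0 kappa).
Local Notation wint := (wint Rs b0 kappa).
Local Notation gint := (gint Rs b0 kappa).
Local Notation Dword := (Dword Rs b0 kappa).
Local Notation lam := (lambda Rs b0 kappa).

(** Green's formula turns [D_j D_j r] into [x_j D_j r], and the Euler identity [dunkl_euler]
    evaluates the sum over [j]; its difference part integrates to 0 by reflection invariance. *)
Lemma gint_Delta k r : hpz k r -> gint (k - 2) (Delta r) = k%:~R * gint k r.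
Proof.
move=> hr; rewrite /dlap (gint_sum b0 mult (k - 2) (k := k - 1 - 1)); last first.
  by move=> j; exact: (hpz_Dj _ _ rs _ (hpz_Dj _ _ rs _ hr)).
have E j : gint (k - 2) (Dj j (Dj j r)) = gint k (fun x => x 0 j * Dj j r x).
  have e1 : k - 1 - 1 = k - 2 by ring.
  have e2 : k - 1 + 1 = k by ring.
  by have := gint_green d_gt0 rs reg mult j (hpz_Dj b0 kappa rs j hr); rewrite e1 e2.
under eq_bigr => j _ do rewrite E.
rewrite -(gint_sum b0 mult k (k := k)); last first.
  by move=> j; apply: hpz_eq (hpz_mulx j (hpz_Dj _ _ rs _ hr)); ring.
move: hr => /hpzP[[n -> hr]|->]; last first.
  rewrite (_ : (fun x => _) = fun=> 0) ?(gint0 _ mult) ?mulr0//.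
  apply/funext => x; rewrite big1// => j _.
  by rewrite /dunklj dunkl_cst mulr0.
rewrite (_ : (fun x => _) = (fun x => n%:R * r x +
    \sum_(a <- pos) kappa a * (r x - r (refl a x)))); last first.
  by apply/funext => x; rewrite (dunkl_euler _ _ rs x hr).
have hs a : hpz n (fun x => kappa a * (r x - r (refl a x))).
  by apply: hpz_scale; apply: hpz_sub => //; exact: (hp_refl a hr).
rewrite (gintD b0 mult n (hpz_scale n%:R (hr : hpz n r)) (hpz_sum pos hs)).
rewrite (gintZ b0 mult _ _ (hr : hpz n r)) (gint_sum b0 mult _ _ hs) big_seq big1 ?addr0// => a ap.
have hra : hpz n (r \o refl a) := hp_refl a hr.
rewrite (gintZ b0 mult _ _ (hpz_sub (hr : hpz n r) hra)) (gintB b0 mult _ (hr : hpz n r) hra).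
rewrite {2}/gint (wint_refl d_gt0 rs reg mult (pos_root ap) (hr : hpz n r)) -/(gint n r).
by rewrite subrr mulr0.
Qed.

(** The degrees passed through are [2 n, ..., 4, 2], with product [2 ^ n n!]. *)
Lemma gint_iter_Delta n r : hp (2 * n) r ->
  gint 0 (iter n Delta r) = 2 ^+ n * n`!%:R * gint (2 * n)%N r.
Proof.
elim: n r => [|n IH] r hr; first by rewrite muln0 expr0 fact0 !mul1r.
have h2 : hpz (2 * n.+1)%N r := hr.
have e : (2 * n.+1)%N%:Z - 2 = (2 * n)%N by lia.
have hD : hp (2 * n) (Delta r) by have := hpz_Delta b0 kappa rs h2; rewrite e.
rewrite iterSr (IH _ hD); have := gint_Delta h2; rewrite e => ->.
by rewrite exprS factS -pmulrn !natrM; ring.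
Qed.

Section Words.
Variables (deg : nat) (L : seq (R * deg.-tuple 'I_d)).
(** [q] is kept as a combination of words of one length [deg], so that the letter-by-letter
    adjunction [gint_word] applies to each summand with the same degrees. *)
Definition words_poly x := \sum_(p <- L) p.1 * mono p.2 x.
Definition words_op f x := \sum_(p <- L) p.1 * Dword p.2 f x.
Local Notation pL := words_poly.
Local Notation DL := words_op.
Hypothesis harm : forall x, Delta pL x = 0.

Let hmono (p : R * deg.-tuple 'I_d) : hpz deg (mono p.2 : V -> R).
Proof. by have := hp_mono R p.2; rewrite size_tuple. Qed.

Let hDword (p : R * deg.-tuple 'I_d) k f : hpz k f -> hpz (k - deg%:Z) (Dword p.2 f).
Proof. by move=> hf; have := hpz_Dword b0 kappa rs p.2 hf; rewrite size_tuple. Qed.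

Lemma hp_words : hp deg pL.
Proof. by apply: hp_sum => p; apply: hp_scale; exact: hmono. Qed.

Lemma hpz_DL k f : hpz k f -> hpz (k - deg%:Z) (DL f).
Proof.
by move=> hf; apply: hpz_sum => p; apply: hpz_scale; exact: hDword.
Qed.

Lemma iter_Delta_words (I : Type) (s : seq I) (c : I -> R) (F : I -> V -> R) k n :
  (forall i, hpz k (F i)) ->
  iter n Delta (fun x => \sum_(i <- s) c i * F i x) =
  (fun x => \sum_(i <- s) c i * iter n Delta (F i) x).
Proof.
move=> hF; elim: n => // n IH; rewrite iterS IH.
have hG i : hpz (k - 2 * n%:Z) (iter n Delta (F i)) by exact: hpz_iter_Delta.
elim: s {IH} => [|i s IH].
  rewrite (_ : (fun x => _) = fun=> 0); last by apply/funext => x; rewrite big_nil.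
  by rewrite Delta_zero; apply/funext => x; rewrite big_nil.
rewrite (_ : (fun x => _) = fun x => c i * iter n Delta (F i) x +
    \sum_(j <- s) c j * iter n Delta (F j) x); last by apply/funext => x; rewrite big_cons.
rewrite (DeltaD b0 kappa rs (hpz_scale (c i) (hG i))
  (hpz_sum s (fun j => hpz_scale (c j) (hG j)))).
rewrite IH (DeltaZ b0 kappa rs _ (hG i)).
by apply/funext => x; rewrite big_cons.
Qed.

(* Only the term [n = 0] of [gint_word] survives for a harmonic polynomial. *)
Lemma gint_words l P : hpz l P -> gint (l - deg%:Z) (DL P) = gint (deg%:Z + l) (fun x => pL x * P x).
Proof.
move=> hP.
have hw (p : R * deg.-tuple 'I_d) : hpz (l - deg%:Z) (Dword p.2 P) by exact: hDword.
rewrite /words_op (gint_sum b0 mult (k := l - deg%:Z) _ _ (fun p => hpz_scale p.1 (hw p))).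
have E (p : R * deg.-tuple 'I_d) : gint (l - deg%:Z) (fun x => p.1 * Dword p.2 P x) =
    \sum_(n < deg.+1) (- 2^-1) ^+ n / n`!%:R *
      gint (deg%:Z + l - 2 * n%:Z) (fun x => p.1 * (iter n Delta (mono p.2) x * P x)).
  have := gint_word d_gt0 rs reg mult (s := p.2) (N := deg.+1) _ hP.
  rewrite size_tuple (gintZ b0 mult _ _ (hw p)) => ->//; rewrite mulr_sumr.
  apply: eq_bigr => n _.
  rewrite (gintZ b0 mult _ _ (hpz_mul (hpz_iter_Delta b0 kappa rs n (hmono p)) hP)).
  by ring.
under eq_bigr => p _ do rewrite E.
rewrite exchange_big/= big_ord_recl /= [X in _ + X]big1 => [|n _].
  rewrite addr0 expr0 fact0 divr1; under eq_bigr => p _ do rewrite mul1r.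
  rewrite -(gint_sum b0 mult (k := deg%:Z + l)); last first.
    by move=> p; apply/hpz_scale/hpz_mul => //; exact: hmono.
  rewrite mulr0 subr0; congr gint; apply/funext => x /=.
  by rewrite mulr_suml; apply: eq_bigr => p _; rewrite mulrA.
rewrite -mulr_sumr.
rewrite -(gint_sum b0 mult (k := deg%:Z - 2 * (lift ord0 n)%:Z + l)); last first.
  move=> p; apply/hpz_scale/hpz_mul => //; exact/hpz_iter_Delta/hmono.
rewrite (_ : (fun y => _) = fun=> 0) ?(gint0 b0 mult) ?mulr0//.
apply/funext => x; under eq_bigr => p _ do rewrite mulrA.
rewrite -mulr_suml.
have := iter_Delta_words L (fun p => p.1) (lift ord0 n) hmono.
move=> /(congr1 (fun F => F x)) /= <-.
rewrite -iterS iterSr (_ : Delta _ = fun=> 0); last exact/funext.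
by rewrite iter_Delta_zero mul0r.
Qed.

(** [q(D) Delta^n P] is a constant, hence its own mean. Moving [Delta^n] outside gives the factor
    [2 ^ n n!], adjunction gives [q P] of degree [2 (deg + n)], and the Gaussian moment of that
    degree supplies [2 ^ (deg + n)] and the Pochhammer symbol. The powers of 2 add up to that in
    [(r / 2) ^ (deg + 2 n)]. *)
Lemma words_mean p n P : hp p P -> p = (deg + 2 * n)%N ->
  DL (iter n Delta P) 0 / (n`!%:R * poch (lam + 1) (deg + n)) / 2 ^+ (deg + 2 * n) =
  (wint (fun=> 1))^-1 * wint (fun y => pL y * P y).
Proof.
move=> hP pE; rewrite {p}pE in hP.
have hz : hpz (deg + 2 * n)%N P := hP.
have comm : DL (iter n Delta P) = iter n Delta (DL P).
  rewrite /words_op (iter_Delta_words L (fun p => p.1) n (k := (2 * n)%N)); last first.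
    move=> p; apply: hpz_eq (hDword p hz); lia.
  apply/funext => x; apply: eq_bigr => p _.
  by rewrite (Dword_iter_Delta d_gt0 rs reg mult _ _ hz).
have e1 : (deg + 2 * n)%N%:Z - deg%:Z = (2 * n)%N by lia.
have hD : hp (2 * n) (DL P) by have := hpz_DL hz; rewrite e1.
have e2 : (2 * n)%N%:Z - 2 * n%:Z = 0%N by lia.
have h0 : hp 0 (iter n Delta (DL P)).
  by have := hpz_iter_Delta b0 kappa rs n (hD : hpz (2 * n)%N _); rewrite e2.
have G := gint_iter_Delta hD.
have G2 := gint_words hz.
have e3 : deg%:Z + (deg + 2 * n)%N%:Z = (2 * (deg + n))%N by lia.
rewrite e1 e3 in G2; rewrite G2 /gint /= gauss_moment_double mul1r in G.
have C : wint (iter n Delta (DL P)) = iter n Delta (DL P) 0 * wint (fun=> 1).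
  rewrite -(wintZ b0 mult); last exact: sphere_continuousC.
  by congr wint; apply/funext => y; rewrite mulr1 (hp0_cst y h0).
rewrite C in G; rewrite comm.
have W0 : wint (fun=> 1) != 0 by rewrite gt_eqF// (wint1_gt0 d_gt0 b0 rs mult).
have P0 : poch (lam + 1) (deg + n) != 0.
  rewrite gt_eqF// /poch; apply: prodr_gt0 => i _.
  have := lambda_ge d_gt0 b0 mult; have : 0 <= i%:R :> R by []; lra.
have -> : iter n Delta (DL P) 0 = 2 ^+ n * n`!%:R * (2 ^+ (deg + n) * poch (lam + 1) (deg + n) *
    wint (fun x => pL x * P x)) / wint (fun=> 1) by rewrite -G mulfK.
have -> : (deg + 2 * n = n + (deg + n))%N by lia.
rewrite [in X in _ / X]exprD.
have F0 : n`!%:R != 0 :> R by rewrite pnatr_eq0 -lt0n fact_gt0.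
have := @expf_neq0 R 2 n (negbT (pnatr_eq0 R 2)).
have := @expf_neq0 R 2 (deg + n) (negbT (pnatr_eq0 R 2)).
move: (2 ^+ n) (2 ^+ (deg + n)) => u v v0 u0.
by field; rewrite W0 P0 F0 u0 v0.
Qed.

(** Below [deg] the operator [q(D)] annihilates [P]; from [deg] on, the excluded degrees are those
    for which [q P] has odd degree. *)
Lemma words_mean0 p P : hp p P -> (forall n, p <> (deg + 2 * n)%N) -> wint (fun y => pL y * P y) = 0.
Proof.
move=> hP ne; have hz : hpz p P := hP.
have [pd|pd] := ltnP p deg.
  have := gint_words hz; rewrite (hpz_neg _ (hpz_DL hz)); last by lia.
  rewrite (gint0 b0 mult) => /esym/eqP; rewrite -PoszD /gint mulf_eq0.
  by rewrite gt_eqF ?gauss_moment_gt0//= => /eqP.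
apply: (wint_odd b0 mult (hp_mul hp_words hP)).
apply/negPn/negP => e; apply: (ne (p - deg)./2).
have e' : odd (p - deg) = false by rewrite oddB// -oddD addnC; exact: negbTE.
by have := odd_double_half (p - deg); rewrite e'; lia.
Qed.

Lemma DL_iter_Delta0 p n P : hp p P -> p <> (deg + 2 * n)%N -> DL (iter n Delta P) 0 = 0.
Proof.
move=> hP ne; have hz : hpz p P := hP.
have := hpz_DL (hpz_iter_Delta b0 kappa rs n hz).
move=> /hpzP[[m e hm]|->//].
have := hp_hom 0 0 hm; rewrite scale0r => ->.
rewrite expr0n; suff -> : (m == 0%N) = false by rewrite mul0r.
by lia.
Qed.

End Words.

End HarmonicMean.

Section PolynomialMean.
Variables (R : realType) (d : nat).
Local Notation V := 'rV[R]_d.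
Variables (Rs : seq V) (b0 : V) (kappa : V -> R).
Implicit Types (f g P : V -> R).

Definition word (mm : mpoly.multinom d) : seq 'I_d :=
  flatten [seq nseq (mpoly.fun_of_multinom mm j) j | j <- enum 'I_d].

Lemma size_word mm : size (word mm) = mpoly.mdeg mm.
Proof.
rewrite mpoly.mdegE -big_enum /word; elim: (enum 'I_d) => [|j s IH]; first by rewrite big_nil.
by rewrite /= size_cat size_nseq IH big_cons.
Qed.

Lemma mono_word mm (x : V) : mono (word mm) x = \prod_i x 0 i ^+ mpoly.fun_of_multinom mm i.
Proof.
rewrite -[RHS]big_enum /mono /word; elim: (enum 'I_d) => [|j s IH]; first by rewrite !big_nil.
rewrite /= big_cat big_cons IH; congr (_ * _).
by elim: (mpoly.fun_of_multinom mm j) => [|n In]; rewrite ?big_nil// big_cons In exprS.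
Qed.

Lemma dmon_word mm f : dmon Rs b0 kappa mm f = Dword Rs b0 kappa (word mm) f.
Proof.
rewrite /dmon /Dword /word; elim: (enum 'I_d) => //= j s ->.
by rewrite foldr_cat; elim: (mpoly.fun_of_multinom mm j) => //= n ->.
Qed.

Lemma mpoly_words deg q : all (fun mm => mpoly.mdeg mm == deg) (mpoly.msupp q) ->
  exists L : seq (R * deg.-tuple 'I_d),
    peval q = words_poly L /\ forall f, qD Rs b0 kappa q f = words_op Rs b0 kappa L f.
Proof.
have -> : peval q = fun x : V => \sum_(m <- mpoly.msupp q) mpoly.mcoeff m q * mono (word m) x.
  by apply/funext => x; rewrite /peval mpoly.mevalE; apply: eq_bigr => m _; rewrite mono_word.
have E f : qD Rs b0 kappa q f =
    fun x : V => \sum_(m <- mpoly.msupp q) mpoly.mcoeff m q * Dword Rs b0 kappa (word m) f x.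
  by apply/funext => x; rewrite /qD; apply: eq_bigr => m _; rewrite dmon_word.
under [X in _ -> X]eq_exists do under eq_forall do rewrite E.
elim: (mpoly.msupp q) => [_|m s IH /= /andP[dm /IH[L [L1 L2]]]].
  by exists [::]; split => [|f]; apply/funext => x; rewrite /words_poly /words_op !big_nil.
have sz : size (word m) == deg by rewrite size_word.
exists ((mpoly.mcoeff m q, Tuple sz) :: L); split => [|f]; apply/funext => x.
  by rewrite /words_poly !big_cons /= (congr1 (fun F => F x) L1).
by rewrite /words_op !big_cons /= (congr1 (fun F => F x) (L2 f)).
Qed.

Hypothesis d_gt0 : (0 < d)%N.
Hypotheses (rs : root_system Rs) (reg : regular Rs b0) (mult : multiplicity Rs kappa).
Variables (deg : nat) (q : mpoly.mpoly d R).
Hypothesis hq : harmonic_homog Rs b0 kappa deg q.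

Local Notation Delta := (dlap Rs b0 kappa).
Local Notation wint := (wint Rs b0 kappa).

Lemma hp_peval : hp deg (peval q).
Proof. by have [L [-> _]] := mpoly_words hq.1; exact: hp_words. Qed.

(** Only the term with [deg + 2 n = p] can be nonzero, and the bound on [p] places it below [N]; if
    there is none, the mean vanishes too. *)
Lemma exp_term_hp N p P r : hp p P -> (p < deg + 2 * N)%N ->
  \sum_(n < N) exp_term Rs b0 kappa deg q P r n =
  (wint (fun=> 1))^-1 * wint (fun y => peval q y * P (r *: y)).
Proof.
move=> hP pN; have [L [qL qDL]] := mpoly_words hq.1.
have harm x : Delta (words_poly L) x = 0 by rewrite -qL; exact: hq.2.
have cq : sphere_continuous (fun y => peval q y * P y).
  exact: hp_sphere (hp_mul hp_peval hP).
have -> : (fun y => peval q y * P (r *: y)) = (fun y => r ^+ p * (peval q y * P y)).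
  by apply/funext => y; rewrite (hp_hom _ _ hP) mulrCA.
rewrite (wintZ b0 mult _ cq) qL.
have [[n pE]|ne] := pselect (exists n, p = (deg + 2 * n)%N); last first.
  rewrite (words_mean0 d_gt0 rs reg mult harm hP); last by move=> n pE; apply: ne; exists n.
  rewrite !mulr0 big1// => n _; rewrite /exp_term qDL.
  by rewrite (DL_iter_Delta0 d_gt0 b0 kappa rs L hP) ?mul0r// => pE; apply: ne; exists n.
have nN : (n < N)%N by lia.
rewrite (bigD1 (Ordinal nN))//= big1 ?addr0 => [|i /negP ni].
  rewrite mulrCA -(words_mean d_gt0 rs reg mult harm hP pE) -pE /exp_term qDL -pE expr_div_n /=.
  by ring.
rewrite /exp_term qDL (DL_iter_Delta0 d_gt0 b0 kappa rs L hP) ?mul0r// => pE'; apply: ni.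
by apply/eqP/val_inj => /=; lia.
Qed.

End PolynomialMean.

(** * Dunkl operators on smooth functions *)

Section UnitIntegral.
Variable R : realType.
Implicit Types (f g F : R -> R) (t : R).
Local Notation mu := (@lebesgue_measure R).

Definition uint f : R := (\int[mu]_(t in `[0%R, 1%R]) f t)%R.
Definition ucont f := forall t, 0 <= t <= 1 -> {for t, continuous f}.

Lemma ucont_within f : ucont f -> {within `[0%R, 1%R], continuous (f : R^o -> R^o)}.
Proof. by move=> cf; apply: continuous_in_subspaceT => t; rewrite inE /= in_itv /=; exact: cf. Qed.

Lemma ucont_integrable f : ucont f -> mu.-integrable `[0%R, 1%R] (EFin \o f).
Proof.
move=> /ucont_within cf; apply: continuous_compact_integrable cf; exact: segment_compact.
Qed.

Lemma uintD f g : ucont f -> ucont g -> uint (fun t => f t + g t) = uint f + uint g.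
Proof. by move=> /ucont_integrable cf /ucont_integrable cg; by apply: RintegralD => //; exact: measurable_itv. Qed.

Lemma uintZ c f : ucont f -> uint (fun t => c * f t) = c * uint f.
Proof. by move=> /ucont_integrable cf; by apply: RintegralZl => //; exact: measurable_itv. Qed.

Lemma ucont_cst c : ucont (fun=> c).
Proof. by move=> t _; exact: cst_continuous. Qed.

Lemma ucont_add f g : ucont f -> ucont g -> ucont (fun t => f t + g t).
Proof. by move=> cf cg t t01; apply: continuousD; [exact: cf|exact: cg]. Qed.

Lemma ucont_scale c f : ucont f -> ucont (fun t => c * f t).
Proof. by move=> cf t t01; apply: continuousM; [exact: cst_continuous|exact: cf]. Qed.

Lemma uint_sum (I : Type) (s : seq I) (F : I -> R -> R) : (forall i, ucont (F i)) ->
  uint (fun t => \sum_(i <- s) F i t) = \sum_(i <- s) uint (F i).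
Proof.
move=> cF; suff [_ //] : ucont (fun t => \sum_(i <- s) F i t) /\
  uint (fun t => \sum_(i <- s) F i t) = \sum_(i <- s) uint (F i).
elim: s => [|i s [cs IH]].
  have -> : (fun t => \sum_(i <- [::]) F i t) = fun=> 0 by apply/funext => t; rewrite big_nil.
  split; first exact: ucont_cst.
  have := uintZ 0 (@ucont_cst 0); rewrite !mul0r big_nil; exact.
have -> : (fun t => \sum_(j <- i :: s) F j t) = fun t => F i t + \sum_(j <- s) F j t.
  by apply/funext => t; rewrite big_cons.
split; first exact: ucont_add.
by rewrite (uintD (cF i) cs) IH big_cons.
Qed.

Lemma uint_eq f g : (forall t, 0 <= t <= 1 -> f t = g t) -> uint f = uint g.
Proof. by move=> fg; apply: eq_Rintegral => t; rewrite inE /= in_itv /=; exact: fg. Qed.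

Lemma uint_cst c : uint (fun=> c) = c.
Proof.
rewrite /uint Rintegral_cst; last exact: measurable_itv.
rewrite [X in fine X](_ : _ = 1%:E) ?mulr1//.
by apply: etrans (lebesgue_measure_itv _) _; rewrite /= lte_fin ltr01 -EFinB subr0.
Qed.

Lemma uint_le f (M : R) : ucont f -> (forall t, 0 <= t <= 1 -> `|f t| <= M) -> `|uint f| <= M.
Proof.
move=> cf fM; have cn : ucont (fun t => `|f t|) by move=> t t01; apply: cvg_norm; exact: cf.
have : `|uint f| <= uint (fun t => `|f t|).
  by apply: le_normr_Rintegral; [exact: measurable_itv|exact: ucont_integrable].
move=> /le_trans; apply; rewrite -[leRHS](uint_cst M); apply: le_Rintegral.
- exact: measurable_itv.
- exact: ucont_integrable cn.
- by apply: ucont_integrable => t _; exact: cst_continuous.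
- by move=> t /=; rewrite in_itv /=; exact: fM.
Qed.

Lemma uint_FTC F f : (forall t, 0 <= t <= 1 -> is_derive t 1 F (f t)) -> ucont f ->
  uint f = F 1 - F 0.
Proof.
move=> dF cf.
have cF t : 0 <= t <= 1 -> {for t, continuous F}.
  move=> t01; apply: (@differentiable_continuous R R^o R^o).
  by apply/derivable1_diffP; have [] := dF t t01.
rewrite /uint /Rintegral (@continuous_FTC2 R f F 0 1 ltr01 (ucont_within cf)) //.
  split.
  - move=> t; rewrite in_itv /= => /andP[t0 t1]; have [] := dF t _ => //; by rewrite !ltW.
  - by apply: cvg_at_right_filter; apply: cF; rewrite lexx ler01.
  - by apply: cvg_at_left_filter; apply: cF; rewrite lexx ler01.
move=> t; rewrite in_itv /= => /andP[t0 t1]; rewrite derive1E.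
by have [] := dF t _ => //; rewrite !ltW.
Qed.

End UnitIntegral.

Section Calculus.
Variables (R : realType) (d : nat).
Local Notation V := 'rV[R]_d.
Implicit Types (f g w : V -> R) (x y v u : V).

Lemma line_mvt_abs f v x (h : R) : (forall s, `|s| <= `|h| -> derivable f (s *: v + x) v) ->
  exists2 s, `|s| <= `|h| & f (h *: v + x) - f x = 'D_v f (s *: v + x) * h.
Proof.
move=> df; have [h0|h0] := leP 0 h.
  have [s /andP[s0 sh] E] : exists2 s, 0 <= s <= h & f (h *: v + x) - f x = 'D_v f (s *: v + x) * h.
    by apply: line_mvt => // s /andP[s0 sh]; apply: df; rewrite !ger0_norm.
  by exists s => //; rewrite !ger0_norm.
have nh0 : 0 <= - h by lra.
have E u y (c : R) : c *: (- u) + y = (- c) *: u + y :> V by rewrite scalerN scaleNr.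
have dN s : `|s| <= `|h| -> is_derive (s *: v + x) (- v) f (- 'D_v f (s *: v + x)).
  by move=> sh; apply: derive_oppv; exact: df.
have [s /andP[s0 sh] H] : exists2 s, 0 <= s <= - h &
    f (- h *: - v + x) - f x = 'D_(- v) f (s *: - v + x) * - h.
  apply: (@line_mvt _ _ f (- v) x (- h) nh0) => s /andP[s0 sh]; rewrite E.
  have /dN[] // : `|- s| <= `|h| by rewrite normrN ger0_norm// ltr0_norm.
have sh' : `|- s| <= `|h| by rewrite normrN ger0_norm// ltr0_norm.
exists (- s) => //; move: H; rewrite !E opprK => ->.
by have [_ ->] := dN _ sh'; rewrite mulrNN.
Qed.

(** The increment along [v] is governed by the derivative at [x], the one along [u] by the mean
    value theorem at a nearby point; hence continuity is asked of ['D_u f]. *)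
Lemma derive_linear f x v u (c : R) :
  (\forall y \near x, derivable f y v) -> (\forall y \near x, derivable f y u) ->
  {for x, continuous ('D_u f)} ->
  is_derive x (v + c *: u) f ('D_v f x + c * 'D_u f x).
Proof.
move=> /nbhs_ballP[r1 /= r10 dv] /nbhs_ballP[r2 /= r20 du] /continuous_atP cu.
apply/is_deriveP => e e0.
have e20 : 0 < e / 2 by rewrite divr_gt0.
have /is_deriveP/(_ _ e20)[r3 r30 Hv] : is_derive x v f ('D_v f x).
  by apply/derivableP; apply: dv; exact: ballxx.
have c10 : 0 < `|c| + 1 by rewrite ltr_wpDl.
have e30 : 0 < e / 2 / (`|c| + 1) by rewrite divr_gt0.
have [r4 r40 Hu] := cu _ e30.
pose N := `|v| + `|c| * `|u| + 1.
have N0 : 0 < N by rewrite /N ltr_wpDl// addr_ge0// mulr_ge0.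
exists (Num.min r3 (Num.min (r2 / N) (r4 / N))) => [|h].
  by rewrite !lt_min r30 !divr_gt0.
rewrite !lt_min => /and3P[h3 h2 h4].
have bnd s : `|s| <= `|h * c| -> forall r, `|h| < r / N -> `|s *: u + (h *: v + x) - x| < r.
  move=> sh r; rewrite ltr_pdivlMr// => hr; rewrite addrA addrK.
  apply: le_lt_trans (ler_normD _ _) _; rewrite !normrZ; apply: le_lt_trans _ hr.
  have := ler_wpM2r (normr_ge0 u) sh; rewrite normrM /N => H.
  have h0 := normr_ge0 h; have := mulr_ge0 h0 (normr_ge0 v); lra.
have [s sh E] : exists2 s, `|s| <= `|h * c| &
    f ((h * c) *: u + (h *: v + x)) - f (h *: v + x) = 'D_u f (s *: u + (h *: v + x)) * (h * c).
  apply: line_mvt_abs => s sh; apply: du; rewrite -ball_normE /= distrC; exact: bnd.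
have -> : h *: (v + c *: u) + x = (h * c) *: u + (h *: v + x).
  by rewrite scalerDr scalerA addrCA addrA.
have H1 := Hv _ h3.
have H2 := Hu _ (bnd _ sh _ h4).
have -> : f ((h * c) *: u + (h *: v + x)) - f x - h * ('D_v f x + c * 'D_u f x) =
  ('D_u f (s *: u + (h *: v + x)) - 'D_u f x) * (h * c) + (f (h *: v + x) - f x - h * 'D_v f x).
  by rewrite mulrBl -E; ring.
apply: le_trans (ler_normD _ _) _; rewrite !normrM.
have : `|'D_u f (s *: u + (h *: v + x)) - 'D_u f x| * (`|h| * `|c|) <= e / 2 * `|h|.
  rewrite mulrCA [leRHS]mulrC ler_wpM2l//.
  have := ltW H2; rewrite ler_pdivlMr// => H; apply: le_trans H.
  by rewrite ler_wpM2l// lerDl.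
by move: H1; lra.
Qed.

(** Stronger than uniform continuity on [K], since [y] is arbitrary: it will be applied to a segment
    and its perturbations. *)
Lemma compact_uniform (K : set V) w : compact K -> (forall p, K p -> {for p, continuous w}) ->
  forall e, 0 < e -> exists2 r, 0 < r & forall p y, K p -> `|y - p| < r -> `|w y - w p| < e.
Proof.
move=> cK cw e e0.
have e20 : 0 < e / 2 by rewrite divr_gt0.
pose P (r : R) p := forall y, `|y - p| < r -> `|w y - w p| < e.
have H : forall p, K p -> \forall x' \near p & i \near at_right (0 : R), P i x'.
  move=> p Kp; have /continuous_atP/(_ _ e20)[r r0 Hr] := cw p Kp.
  have r20 : 0 < r / 2 by rewrite divr_gt0.
  exists ([set x' | `|x' - p| < r / 2], [set i | i < r / 2]) => /=.
    split; last exact: nbhs_right_lt.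
    by apply/nbhs_ballP; exists (r / 2) => // y; rewrite -ball_normE /= distrC.
  move=> [x' i] /= [x'p ir] y yx'.
  have H1 : `|w x' - w p| < e / 2 by apply: Hr; apply: lt_trans x'p _; lra.
  have H2 : `|w y - w p| < e / 2.
    by apply: Hr; have := ler_distD x' y p; lra.
  by have := ler_distD (w p) (w y) (w x'); rewrite [`|w p - w x'|]distrC; lra.
have {}H := (compact_near_coveringP K).1 cK R (at_right (0 : R)) P (at_right_proper_filter 0) H.
have [r [r0 Hr]] := filter_ex (filterI (nbhs_right_gt (0 : R)) H).
by exists r => // p y Kp; exact: Hr.
Qed.

End Calculus.

(** * Smooth functions with a prescribed order of vanishing *)

Section SmoothFlat.
Variables (R : realType) (d : nat) (rho : R).
Hypothesis rho_gt0 : 0 < rho.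
Local Notation V := 'rV[R]_d.
Implicit Types (f g w : V -> R) (x y v u a : V) (K : nat).

Local Notation U := (fun x : V => enorm x < rho).

(** The order of vanishing is carried along because it decides which operators annihilate the
    function at the origin. *)
Definition smooth_flat K f :=
  smooth_on U f /\ forall vs : seq V, (size vs < K)%N -> Defs.iterD vs f 0 = 0.

Lemma ball0 : U 0.
Proof. by rewrite /= enorm0. Qed.

Lemma ball_near x : U x -> \forall y \near x, U y.
Proof.
move=> Ux; have := @continuous_enorm R d x _ (lt_nbhsl (Ux : enorm x < rho)).
exact.
Qed.

Lemma sf_continuous K f x : smooth_flat K f -> U x -> {for x, continuous f}.
Proof. by move=> [sf _] Ux; have [] := sf [::] 0 x Ux. Qed.

Lemma sf_derivable K f x v : smooth_flat K f -> U x -> derivable f x v.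
Proof. by move=> [sf _] Ux; have [] := sf [::] v x Ux. Qed.

Lemma sf_is_derive K f x v : smooth_flat K f -> U x -> is_derive x v f ('D_v f x).
Proof. by move=> sf Ux; apply/derivableP; exact: sf_derivable sf Ux. Qed.

Lemma sf_eq0 K f : smooth_flat K f -> (0 < K)%N -> f 0 = 0.
Proof. by move=> [_ ff] K0; exact: (ff [::]). Qed.

Lemma sf_derive K f v : smooth_flat K f -> smooth_flat K.-1 ('D_v f).
Proof.
move=> [sf ff]; have E vs : Defs.iterD vs ('D_v f) = Defs.iterD (rcons vs v) f by rewrite /Defs.iterD foldr_rcons.
split=> [vs u x Ux|vs sz]; rewrite E; first exact: sf.
by apply: ff; rewrite size_rcons; lia.
Qed.

Lemma sf_leq K L f : (L <= K)%N -> smooth_flat K f -> smooth_flat L f.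
Proof. by move=> LK [sf ff]; split=> // vs sz; apply: ff; exact: leq_trans LK. Qed.

(* Coinduction: a class of functions stable under differentiation consists of smooth functions. *)
Lemma sf_coind (S : nat -> (V -> R) -> Prop) :
  (forall K f, S K f -> [/\ forall x, U x -> {for x, continuous f}, (0 < K)%N -> f 0 = 0 &
     forall v, exists2 f', S K.-1 f' & forall x, U x -> is_derive x v f (f' x)]) ->
  forall K f, S K f -> smooth_flat K f.
Proof.
move=> HS K f SKf.
have H vs : exists2 g, S (K - size vs)%N g & forall x, U x -> Defs.iterD vs f x = g x.
  elim: vs => [|v vs [g Sg gE]]; first by exists f; rewrite ?subn0.
  have [_ _ /(_ v)[g' Sg' dg]] := HS _ _ Sg.
  exists g'; first by rewrite subnS.
  move=> x Ux; rewrite /= (@derive_near _ _ _ g).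
    by have [] := dg x Ux.
  by apply: filterS (ball_near Ux) => y; exact: gE.
split=> [vs v x Ux|vs sz]; have [g Sg gE] := H vs; have [cg g0 dg] := HS _ _ Sg.
  have gn : \forall y \near x, g y = Defs.iterD vs f y.
    by apply: filterS (ball_near Ux) => y /gE.
  split; last exact: continuous_near gn (cg x Ux).
  have [g' _ dg'] := dg v; apply: derivable_near gn _.
  by have [] := dg' x Ux.
by rewrite gE ?g0 ?subn_gt0//; exact: ball0.
Qed.

Lemma sf_ext K f g : (forall x, U x -> f x = g x) -> smooth_flat K f -> smooth_flat K g.
Proof.
move=> fg sf; apply: (@sf_coind (fun K g => exists2 f, smooth_flat K f & forall x, U x -> f x = g x)).
  move=> {K f g fg sf} K g [f sf fg].
  have fgn x : U x -> \forall y \near x, f y = g y.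
    by move=> Ux; apply: filterS (ball_near Ux) => y; exact: fg.
  split=> [x Ux|K0|v].
  - exact: continuous_near (fgn x Ux) (sf_continuous sf Ux).
  - by rewrite -fg ?(sf_eq0 sf)//; exact: ball0.
  - exists ('D_v f); first by exists ('D_v f) => //; exact: sf_derive.
    by move=> x Ux; apply: is_derive_near (fgn x Ux) _; exact: sf_is_derive sf Ux.
by exists f.
Qed.

Lemma sf_add K f g : smooth_flat K f -> smooth_flat K g -> smooth_flat K (fun x => f x + g x).
Proof.
move=> sf sg; apply: (@sf_coind (fun K h => exists f g,
  [/\ smooth_flat K f, smooth_flat K g & h = fun x => f x + g x])); last by exists f, g.
move=> {K f g sf sg} K _ [f [g [sf sg ->]]]; split=> [x Ux|K0|v].
- by apply: cfD; [exact: sf_continuous sf Ux|exact: sf_continuous sg Ux].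
- by rewrite (sf_eq0 sf)// (sf_eq0 sg)// addr0.
- exists (fun x => 'D_v f x + 'D_v g x); last first.
    by move=> x Ux; apply: is_derive_add; [exact: sf_is_derive sf Ux|exact: sf_is_derive sg Ux].
  by exists ('D_v f), ('D_v g); split => //; exact: sf_derive.
Qed.

Lemma sf_scale K f (c : R) : smooth_flat K f -> smooth_flat K (fun x => c * f x).
Proof.
move=> sf; apply: (@sf_coind (fun K h => exists2 f, smooth_flat K f & h = fun x => c * f x)); last by exists f.
move=> {K f sf} K _ [f sf ->]; split=> [x Ux|K0|v].
- by apply: cfM; [exact: cfC|exact: sf_continuous sf Ux].
- by rewrite (sf_eq0 sf)// mulr0.
- exists (fun x => c * 'D_v f x); first by exists ('D_v f) => //; exact: sf_derive.
  move=> x Ux; have := is_derive_mul (is_derive_const x v c) (sf_is_derive v sf Ux).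
  by rewrite mulr0 addr0.
Qed.

Lemma sf_zero K : smooth_flat K (fun=> 0).
Proof.
split=> [vs v x _|vs _]; have -> : Defs.iterD vs (fun _ : V => 0 : R) = fun=> 0 => //.
- by elim: vs => //= u vs ->; exact: derive_zero.
- by split; [case: (is_derive_const x v (0 : R))|exact: cfC].
- by elim: vs => //= u vs ->; exact: derive_zero.
Qed.

Lemma sf_cst (c : R) : smooth_flat 0 (fun=> c).
Proof.
apply: (@sf_coind (fun K h => K = 0%N /\ exists c : R, h = fun=> c)); last by split=> //; exists c.
move=> K _ [-> [b ->]]; split=> // [x _|v]; first exact: cfC.
by exists (fun=> 0) => [|x _]; [split => //; exists 0|exact: is_derive_const].
Qed.

Lemma sf_sum K (I : eqType) (s : seq I) (F : I -> V -> R) :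
  (forall i, i \in s -> smooth_flat K (F i)) -> smooth_flat K (fun x => \sum_(i <- s) F i x).
Proof.
elim: s => [_|i s IH sF].
  by rewrite (_ : (fun x => _) = fun=> 0); [exact: sf_zero|apply/funext => x; rewrite big_nil].
rewrite (_ : (fun x => _) = fun x => F i x + \sum_(j <- s) F j x).
  apply: sf_add; first by apply: sF; exact: mem_head.
  by apply: IH => j js; apply: sF; rewrite inE js orbT.
by apply/funext => x; rewrite big_cons.
Qed.

Lemma sf_mulx K f i : smooth_flat K f -> smooth_flat K.+1 (fun x => x 0 i * f x).
Proof.
(* The class of all [x_i f + g] is stable under differentiation: the derivative of [x_i] feeds [f]
   into the second summand, and [f] may vanish to one order less than [g]. *)
move=> sf; apply: (@sf_coind (fun K h => exists f g,
  [/\ smooth_flat K.-1 f, smooth_flat K g & h = fun x => x 0 i * f x + g x])); last first.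
  exists f, (fun=> 0); split=> //; last by apply/funext => x; rewrite addr0.
  exact: sf_zero.
move=> {K f sf} K _ [f [g [sf sg ->]]]; split=> [x Ux|K0|v].
- apply: cfD; last exact: sf_continuous sg Ux.
  by apply: cfM; [exact: (hp_continuous (hp_coord R i))|exact: sf_continuous sf Ux].
- by rewrite mxE mul0r add0r (sf_eq0 sg).
- exists (fun x => x 0 i * 'D_v f x + (v 0 i * f x + 'D_v g x)).
    exists ('D_v f), (fun x => v 0 i * f x + 'D_v g x); split => //; first exact: sf_derive.
    by apply: sf_add; [exact: sf_scale|exact: sf_derive].
  move=> x Ux; rewrite addrA; apply: is_derive_add; last exact: sf_is_derive sg Ux.
  rewrite [v 0 i * _]mulrC; apply: is_derive_mul (sf_is_derive v sf Ux).
  exact: is_derive_coord.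
Qed.

Lemma sf_hp k f : hp k f -> smooth_flat k f.
Proof.
elim/hp_induction => {k f} [c|k i f _ IH|k f g _ I1 _ I2|k].
- exact: sf_cst.
- exact: sf_mulx.
- exact: sf_add.
- exact: sf_zero.
Qed.

Lemma norm_refl_le a x : `|refl a x| <= d%:R * `|x|.
Proof.
by apply: le_trans (norm_le_enorm _) _; rewrite enorm_refl; exact: enorm_le_norm.
Qed.

Section Average.
Variables B C : V -> V.
Hypothesis linB : forall (h : R) v x, B (h *: v + x) = h *: B v + B x.
Hypothesis linC : forall (h : R) v x, C (h *: v + x) = h *: C v + C x.
Variable M : R.
Hypotheses (boundB : forall x, `|B x| <= M * `|x|) (boundC : forall x, `|C x| <= M * `|x|).
Hypotheses (UB : forall x, U x -> U (B x)) (UC : forall x, U x -> U (C x)).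

(** The segment from [B x] to [C x]. It serves with [B = id], [C = refl a] for difference quotients,
    and with [B = 0], [C = id] for Hadamard's lemma. *)
Let A (t : R) x := t *: (C x - B x) + B x.

Let AE t x : A t x = (1 - t) *: B x + t *: C x.
Proof. by rewrite /A scalerBr scalerBl scale1r addrC addrA addrAC. Qed.

Let UA t x : 0 <= t <= 1 -> U x -> U (A t x).
Proof. by move=> t01 Ux; rewrite AE; apply: enorm_convex => //; [exact: UB|exact: UC]. Qed.

Let linA t (h : R) v x : A t (h *: v + x) = h *: A t v + A t x.
Proof.
rewrite !AE linB linC !scalerDr !scalerA addrACA; congr (_ + _ + _).
  by rewrite mulrC.
by rewrite mulrC.
Qed.

Let A0 t : A t 0 = 0.
Proof.
have E D : (forall (h : R) v x, D (h *: v + x) = h *: D v + D x) -> D 0 = 0 :> V.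
  by move=> linD; have := linD (-1) 0 0; rewrite scaler0 addr0 scaleN1r addNr.
by rewrite AE (E _ linB) (E _ linC) !scaler0 addr0.
Qed.

Let A_bound t x y : 0 <= t <= 1 -> `|A t y - A t x| <= M * `|y - x|.
Proof.
move=> /andP[t0 t1].
have -> : A t y - A t x = A t (y - x).
  by have := linA t (-1) x y; rewrite !scaleN1r [- x + y]addrC [- A t x + _]addrC.
rewrite AE; apply: le_trans (ler_normD _ _) _; rewrite !normrZ ger0_norm; last by lra.
rewrite ger0_norm//; have := boundB (y - x); have := boundC (y - x) => H1 H2.
have t1' : 0 <= 1 - t by lra.
by have := ler_wpM2l t0 H1; have := ler_wpM2l t1' H2; lra.
Qed.

Let cA x : continuous (fun t => A t x).
Proof.
move=> t; apply: cvgD; last exact: cvg_cst.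
exact: scalel_continuous.
Qed.

Let uniform w x : (forall y, U y -> {for y, continuous w}) -> U x -> forall e, 0 < e ->
  exists2 r, 0 < r & forall t y, 0 <= t <= 1 -> `|y - x| < r -> `|w (A t y) - w (A t x)| < e.
Proof.
move=> cw Ux e e0.
have cK : compact ((fun t => A t x) @` `[0%R, 1%R]).
  by apply: continuous_compact (@segment_compact _ _ _); apply: continuous_subspaceT; exact: cA.
have [|r r0 H] := compact_uniform cK (w := w) _ e0.
  by move=> p [t]; rewrite /= in_itv /= => t01 <-; apply: cw; exact: UA.
exists (r / (`|M| + 1)) => [|t y t01 yx]; first by rewrite divr_gt0.
apply: H; first by exists t => //=; rewrite in_itv.
apply: le_lt_trans (A_bound _ _ t01) _.
rewrite ltr_pdivlMr// in yx; apply: le_lt_trans yx; rewrite mulrC ler_wpM2l//.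
by have := ler_norm M; lra.
Qed.

(** Differentiating [w (A t x)] in [x] produces a factor [t]; the power [t ^ i] makes the family of
    averages stable under derivatives. *)
Definition average i w x := uint (fun t => t ^+ i * w (A t x)).

Lemma ucont_average i w x : (forall y, U y -> {for y, continuous w}) -> U x ->
  ucont (fun t => t ^+ i * w (A t x)).
Proof.
move=> cw Ux t t01; apply: continuousM; first exact: exprn_continuous.
by apply: (@continuous_comp _ _ _ (fun t => A t x) w); [exact: cA|apply: cw; exact: UA].
Qed.

Let pow01 t i : 0 <= t <= 1 -> `|t ^+ i| <= 1 :> R.
Proof. by move=> /andP[t0 t1]; rewrite ger0_norm ?exprn_ge0// exprn_ile1. Qed.

Lemma average_continuous i w x : (forall y, U y -> {for y, continuous w}) -> U x ->
  {for x, continuous (average i w)}.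
Proof.
move=> cw Ux; apply/continuous_atP => e e0; have e20 : 0 < e / 2 by rewrite divr_gt0.
have [r1 r10 H] := uniform cw Ux e20.
have /nbhs_ballP[r2 /= r20 HU] := ball_near Ux.
exists (Num.min r1 r2) => [|y]; first by rewrite lt_min r10.
rewrite lt_min => /andP[yx1 yx2].
have Uy : U y by apply: HU; rewrite -ball_normE /= distrC.
have cx := ucont_average (i := i) cw Ux; have cy := ucont_average (i := i) cw Uy.
have cNx : ucont (fun t => -1 * (t ^+ i * w (A t x))).
  by move=> t t01; apply: continuousM; [exact: cst_continuous|exact: cx].
rewrite /average (_ : _ - _ = uint (fun t => t ^+ i * w (A t y) + -1 * (t ^+ i * w (A t x)))); last first.
  by rewrite uintD// uintZ// mulN1r.
apply: (@le_lt_trans _ _ (e / 2)); last by lra.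
apply: uint_le => [t t01|t t01]; first by apply: continuousD; [exact: cy|exact: cNx].
rewrite mulN1r -mulrBr normrM -[leRHS]mul1r ler_pM//; first exact: pow01.
by apply: ltW; exact: H.
Qed.

(** Differentiation under the integral sign: the mean value theorem for each [t], with both
    derivatives of [w] continuous uniformly along the compact segment. *)
Lemma average_derive K i w x v : smooth_flat K w -> U x ->
  is_derive x v (average i w) (average i ('D_(B v) w) x + average i.+1 ('D_(C v - B v) w) x).
Proof.
move=> sw Ux.
set g1 := 'D_(B v) w; set g2 := 'D_(C v - B v) w.
have cg1 y : U y -> {for y, continuous g1} by exact: sf_continuous (sf_derive _ sw).
have cg2 y : U y -> {for y, continuous g2} by exact: sf_continuous (sf_derive _ sw).
have cw y : U y -> {for y, continuous w} by exact: sf_continuous sw.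
have dA t y : 0 <= t <= 1 -> U y -> is_derive y v (fun y => w (A t y)) (g1 (A t y) + t * g2 (A t y)).
  move=> t01 Uy; have Ay := UA t01 Uy.
  have /is_deriveP H : is_derive (A t y) (B v + t *: (C v - B v)) w (g1 (A t y) + t * g2 (A t y)).
    apply: derive_linear; last exact: cg2.
      by apply: filterS (ball_near Ay) => z Uz; exact: sf_derivable sw Uz.
    by apply: filterS (ball_near Ay) => z Uz; exact: sf_derivable sw Uz.
  by apply/is_deriveP => e /H[r r0 {}H]; exists r => // h /H; rewrite linA /A [B v + _]addrC.
apply/is_deriveP => e e0; have e20 : 0 < e / 2 by rewrite divr_gt0.
have [r1 r10 H1] := uniform cg1 Ux e20.
have [r2 r20 H2] := uniform cg2 Ux e20.
have /nbhs_ballP[r3 /= r30 HU] := ball_near Ux.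
have v10 : 0 < `|v| + 1 by rewrite ltr_wpDl.
exists (Num.min (r1 / (`|v| + 1)) (Num.min (r2 / (`|v| + 1)) (r3 / (`|v| + 1)))) => [|h].
  by rewrite !lt_min !divr_gt0.
rewrite !lt_min => /and3P[h1 h2 h3].
have bnd s r : `|s| <= `|h| -> `|h| < r / (`|v| + 1) -> `|s *: v + x - x| < r.
  move=> sh; rewrite ltr_pdivlMr// addrK normrZ => hr.
  by have := ler_wpM2r (normr_ge0 v) sh; have := normr_ge0 h; lra.
have Us s : `|s| <= `|h| -> U (s *: v + x).
  by move=> sh; apply: HU; rewrite -ball_normE /= distrC; exact: bnd.
have Uh := Us h (lexx _).
have c0 := ucont_average (i := i) cw Ux; have ch := ucont_average (i := i) cw Uh.
have c1 := ucont_average (i := i) cg1 Ux; have c2 := ucont_average (i := i.+1) cg2 Ux.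
have cZ := @ucont_scale R; have cD := @ucont_add R.
rewrite (_ : _ - _ - _ = uint (fun t => (t ^+ i * w (A t (h *: v + x)) + -1 * (t ^+ i * w (A t x))) +
    - h * (t ^+ i * g1 (A t x) + t ^+ i.+1 * g2 (A t x)))); last first.
  rewrite (uintD (cD _ _ ch (cZ (-1) _ c0)) (cZ (- h) _ (cD _ _ c1 c2))).
  rewrite (uintD ch (cZ (-1) _ c0)) (uintZ (-1) c0) (uintZ (- h) (cD _ _ c1 c2)) (uintD c1 c2).
  by rewrite mulN1r mulNr.
apply: uint_le => [|t t01].
  exact: cD (cD _ _ ch (cZ (-1) _ c0)) (cZ (- h) _ (cD _ _ c1 c2)).
have [s sh E] : exists2 s, `|s| <= `|h| &
   w (A t (h *: v + x)) - w (A t x) = (g1 (A t (s *: v + x)) + t * g2 (A t (s *: v + x))) * h.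
  have [s sh E] : exists2 s, `|s| <= `|h| & w (A t (h *: v + x)) - w (A t x) =
      'D_v (fun y => w (A t y)) (s *: v + x) * h.
    by apply: (line_mvt_abs (f := fun y => w (A t y))) => s sh; have [] := dA t _ t01 (Us s sh).
  by exists s => //; rewrite E; have [_ ->] := dA t _ t01 (Us s sh).
rewrite (_ : _ + _ = t ^+ i * (h * ((g1 (A t (s *: v + x)) - g1 (A t x)) +
   t * (g2 (A t (s *: v + x)) - g2 (A t x))))); last first.
  by rewrite mulN1r -mulrBr E exprS; ring.
rewrite normrM -[leRHS]mul1r ler_pM//; first exact: pow01.
rewrite normrM mulrC ler_wpM2r//.
apply: le_trans (ler_normD _ _) _; rewrite normrM.
have G1 := H1 t _ t01 (bnd s _ sh h1).
have G2 := H2 t _ t01 (bnd s _ sh h2).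
have t1 : `|t| <= 1 by rewrite -[t]expr1; exact: pow01.
have e2 : e = e / 2 + 1 * (e / 2) by lra.
rewrite [leRHS]e2; apply: lerD; first exact: ltW.
by apply: ler_pM => //; exact: ltW.
Qed.

(** Sums are included since the derivative of one average is a sum of two; this is the class fed to
    [sf_coind]. *)
Inductive averages : nat -> (V -> R) -> Prop :=
| averages_int K i w : smooth_flat K w -> averages K (average i w)
| averages_add K f g : averages K f -> averages K g -> averages K (fun x => f x + g x).

Lemma sf_average K i w : smooth_flat K w -> smooth_flat K (average i w).
Proof.
move=> sw; apply: (@sf_coind averages); last exact: averages_int.
move=> {K i w sw} K f; elim=> {K f} [K i w sw|K f g _ [cf f0 df] _ [cg g0 dg]].
  split=> [x Ux|K0|v].
  - by apply: average_continuous => // y; exact: sf_continuous sw.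
  - rewrite /average (@uint_eq _ _ (fun=> 0)) ?uint_cst// => t t01.
    by rewrite A0 (sf_eq0 sw)// mulr0.
  - exists (fun x => average i ('D_(B v) w) x + average i.+1 ('D_(C v - B v) w) x).
      by apply: averages_add; apply: averages_int; exact: sf_derive.
    by move=> x; exact: average_derive sw.
split=> [x Ux|K0|v].
- by apply: cfD; [exact: cf|exact: cg].
- by rewrite f0// g0// addr0.
- have [f' Sf df'] := df v; have [g' Sg dg'] := dg v.
  exists (fun x => f' x + g' x); first exact: averages_add.
  by move=> x Ux; apply: is_derive_add; [exact: df'|exact: dg'].
Qed.

Lemma average_FTC K w x u : smooth_flat K w -> U x -> C x - B x = u ->
  w (C x) - w (B x) = average 0 ('D_u w) x.
Proof.
move=> sw Ux uE.
have E1 : A 1 x = C x by rewrite /A scale1r subrK.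
have E0 : A 0 x = B x by rewrite /A scale0r add0r.
have -> : average 0 ('D_u w) x = w (A 1 x) - w (A 0 x); last by rewrite E1 E0.
apply: (@uint_FTC _ (fun t => w (A t x))) => [t t01|].
  have Au s : A s x = s *: u + B x by rewrite /A uE.
  have -> : (fun t => w (A t x)) = (fun t => w (t *: u + B x)) by apply/funext => s; rewrite Au.
  have H : is_derive (t *: u + B x) u w ('D_u w (t *: u + B x)).
    have Ut : U (t *: u + B x) by rewrite -Au; exact: UA.
    exact: (sf_is_derive u sw Ut).
  by move/is_derive_line: H; rewrite expr0 mul1r Au.
have cu y : U y -> {for y, continuous ('D_u w)} by exact: sf_continuous (sf_derive _ sw).
exact: (ucont_average (i := 0) cu Ux).
Qed.

End Average.

End SmoothFlat.

Section DunklSmooth.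
Variables (R : realType) (d : nat) (rho : R).
Hypothesis rho_gt0 : 0 < rho.
Local Notation V := 'rV[R]_d.
Implicit Types (f g w : V -> R) (x y v u a : V) (K m n : nat).
Local Notation U := (fun x : V => enorm x < rho).
Local Notation sf := (smooth_flat rho).

Lemma is_derive_scale f x v (c : R) : derivable f x v -> is_derive x (c *: v) f (c * 'D_v f x).
Proof.
move=> /derivableP/is_deriveP H; apply/is_deriveP => e e0.
have c0 : 0 < `|c| + 1 by rewrite ltr_wpDl.
have [r r0 {}H] := H (e / (`|c| + 1)) (divr_gt0 e0 c0).
exists (r / (`|c| + 1)) => [|h]; first by rewrite divr_gt0.
rewrite ltr_pdivlMr// => hr; rewrite scalerA mulrA.
have hc : `|h * c| <= `|h| * (`|c| + 1) by rewrite normrM ler_wpM2l// lerDl.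
apply: le_trans (H _ (le_lt_trans hc hr)) _.
rewrite mulrAC ler_pdivrMr// -mulrA; apply: ler_wpM2l => //; exact: ltW.
Qed.

Lemma linear_id (h : R) v x : id (h *: v + x) = h *: id v + id x :> V.
Proof. by []. Qed.

Lemma linear_refl a (h : R) v x : refl a (h *: v + x) = h *: refl a v + refl a x.
Proof. by rewrite reflD reflZ. Qed.

(** [r_a x - x] is [- 2 <a, x> / |a|^2] times [a], so the fundamental theorem along the segment
    produces the factor [<a, x>] that the quotient divides out. On the hyperplane the segment is a
    point, and the formula gives the value prescribed in [dquot]. *)
Lemma dquot_average K a f x : a != 0 -> sf K f -> U x ->
  dquot a f x = 2 / dotp a a * average id (refl a) 0 ('D_a f) x.
Proof.
move=> a0 sff Ux; have aa : dotp a a != 0 by rewrite gt_eqF ?dotp_gt0.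
have Ur y : U y -> U (refl a y) by rewrite /= enorm_refl.
have Ua t : 0 <= t <= 1 -> U (t *: (refl a x - x) + x).
  move=> t01; rewrite (_ : _ + x = (1 - t) *: x + t *: refl a x).
    exact: enorm_convex t01 Ux (Ur x Ux).
  by rewrite scalerBr scalerBl scale1r addrC addrA addrAC.
pose s := - (2 * dotp a x / dotp a a).
have uE : refl a x - id x = s *: a by rewrite /refl addrC addKr /s scaleNr.
have FTC := average_FTC rho_gt0 (fun y Uy => Uy) Ur sff Ux uE.
have c1 : ucont (fun t => t ^+ 0 * 'D_a f (t *: (refl a x - id x) + id x)).
  have cDf y : U y -> {for y, continuous ('D_a f)} by exact: (sf_continuous (sf_derive rho_gt0 a sff)).
  exact: (ucont_average (fun y Uy => Uy) Ur (i := 0) cDf Ux).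
have FE : average id (refl a) 0 ('D_(s *: a) f) x = s * average id (refl a) 0 ('D_a f) x.
  rewrite /average -(uintZ s c1); apply: uint_eq => t t01.
  have [_ ->] := is_derive_scale s (sf_derivable (v := a) sff (Ua t t01)).
  by rewrite mulrCA.
rewrite /dquot; case: ifPn => [ax|/negPn/eqP ax].
  rewrite -[f x - _]opprB FTC FE /s; move: (average _ _ _ _ _) => A.
  by field; rewrite ax aa.
congr (_ * _); rewrite /average (@uint_eq _ _ (fun=> 'D_a f x)) ?uint_cst// => t _.
by rewrite refl_fix// subrr scaler0 add0r expr0 mul1r.
Qed.

Lemma sf_dquot K a f : a != 0 -> sf K f -> sf K.-1 (dquot a f).
Proof.
move=> a0 sff.
apply: (sf_ext rho_gt0 (f := fun x => 2 / dotp a a * average id (refl a) 0 ('D_a f) x)).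
  by move=> x Ux; rewrite (dquot_average a0 sff Ux).
apply: sf_scale => //; apply: (@sf_average _ _ _ rho_gt0 _ _ linear_id (linear_refl a) (d%:R + 1)).
- by move=> x; rewrite mulrDl mul1r lerDr mulr_ge0.
- by move=> x; apply: le_trans (norm_refl_le a x) _; rewrite mulrDl mul1r lerDl.
- by [].
- by move=> x; rewrite /= enorm_refl.
- exact: sf_derive.
Qed.

(** What it takes to apply [T] to a Taylor expansion: a loss of at most [m] orders of vanishing,
    additivity, and dependence on values in the ball alone. Dunkl operators are nonlocal but
    qualify, as reflections preserve the ball. *)
Definition lowers m (T : (V -> R) -> V -> R) :=
  [/\ forall K f, sf K f -> sf (K - m) (T f),
      forall f g, sf 0 f -> sf 0 g -> forall x, U x -> T (fun y => f y + g y) x = T f x + T g x &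
      forall f g, (forall x, U x -> f x = g x) -> forall x, U x -> T f x = T g x].

Lemma lowers_id : lowers 0 id.
Proof. by split=> [K f||f g fg x Ux]//; [rewrite subn0|exact: fg]. Qed.

Lemma lowers_comp m n T S : lowers m T -> lowers n S -> lowers (n + m) (fun f => T (S f)).
Proof.
move=> [T1 T2 T3] [S1 S2 S3]; split=> [K f sff|f g sff sg x Ux|f g fg x Ux].
- by rewrite subnDA; apply: T1; exact: S1.
- rewrite (T3 _ (fun y => S f y + S g y))// => [|y Uy]; last exact: S2.
  by apply: T2 => //; [exact: S1 sff|exact: S1 sg].
- by apply: T3 => // y Uy; exact: S3.
Qed.

Lemma lowers_scale m T (c : R) : lowers m T -> lowers m (fun f x => c * T f x).
Proof.
move=> [T1 T2 T3]; split=> [K f sff|f g sff sg x Ux|f g fg x Ux].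
- by apply: sf_scale => //; exact: T1.
- by rewrite T2// mulrDr.
- by rewrite (T3 f g).
Qed.

Lemma lowers_sum m (I : eqType) (s : seq I) (T : I -> (V -> R) -> V -> R) :
  (forall i, i \in s -> lowers m (T i)) -> lowers m (fun f x => \sum_(i <- s) T i f x).
Proof.
move=> Ti; split=> [K f sff|f g sff sg x Ux|f g fg x Ux].
- by apply: sf_sum => // i /Ti[T1 _ _]; exact: T1.
- by rewrite -big_split/= big_seq [RHS]big_seq; apply: eq_bigr => i /Ti[_ T2 _]; exact: T2.
- by rewrite big_seq [RHS]big_seq; apply: eq_bigr => i /Ti[_ _ T3]; exact: T3.
Qed.

Lemma lowers_dquot a : a != 0 -> lowers 1 (dquot a).
Proof.
move=> a0; split=> [K f sff|f g sff sg x Ux|f g fg x Ux].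
- by rewrite subn1; exact: sf_dquot.
- by apply: dquotD; [exact: sf_derivable sff Ux|exact: sf_derivable sg Ux].
- rewrite /dquot fg// fg ?enorm_refl//; case: ifP => // _; congr (_ * _).
  by apply: derive_near; apply: filterS (ball_near Ux) => y; exact: fg.
Qed.

Lemma lowers_derive v : lowers 1 (fun f => 'D_v f).
Proof.
split=> [K f sff|f g sff sg x Ux|f g fg x Ux].
- by rewrite subn1; exact: sf_derive.
- by have [_ ->] := is_derive_add (sf_is_derive v sff Ux) (sf_is_derive v sg Ux).
- by apply: derive_near; apply: filterS (ball_near Ux) => y; exact: fg.
Qed.

Variables (Rs : seq V) (b0 : V) (kappa : V -> R).
Hypothesis rs : root_system Rs.

Lemma lowers_add m T S : lowers m T -> lowers m S -> lowers m (fun f x => T f x + S f x).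
Proof.
move=> [T1 T2 T3] [S1 S2 S3]; split=> [K f sff|f g sff sg x Ux|f g fg x Ux].
- by apply: sf_add => //; [exact: T1|exact: S1].
- by rewrite T2// S2// addrACA.
- by rewrite (T3 f g)// (S3 f g).
Qed.

Lemma lowers_dunkl xi : lowers 1 (dunkl Rs b0 kappa xi).
Proof.
apply: lowers_add; first exact: lowers_derive.
by apply: lowers_sum => a ap; apply/lowers_scale/lowers_dquot; exact: pos_neq0 ap.
Qed.

Lemma lowers_dlap : lowers 2 (dlap Rs b0 kappa).
Proof.
apply: lowers_sum => j _.
by apply: (@lowers_comp 1 1 (dunklj Rs b0 kappa j) (dunklj Rs b0 kappa j)); exact: lowers_dunkl.
Qed.

Lemma lowers_iter m n T : lowers m T -> lowers (n * m) (iter n T).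
Proof.
move=> lT; elim: n => [|n IH]; first exact: lowers_id.
by rewrite mulSnr; exact: lowers_comp lT IH.
Qed.

Lemma lowers_Dword (s : seq 'I_d) : lowers (size s) (Dword Rs b0 kappa s).
Proof.
elim: s => [|j s IH]; first exact: lowers_id.
rewrite /= -addn1.
exact: (@lowers_comp 1 (size s) (dunklj Rs b0 kappa j) (Dword Rs b0 kappa s) (lowers_dunkl _) IH).
Qed.

Lemma lowers_words_op deg (L : seq (R * deg.-tuple 'I_d)) : lowers deg (words_op Rs b0 kappa L).
Proof.
apply: lowers_sum => p _; apply: lowers_scale.
by have := lowers_Dword p.2; rewrite size_tuple.
Qed.

Lemma lowers_flat m T K f : lowers m T -> sf K f -> (m < K)%N -> T f 0 = 0.
Proof.
by move=> [T1 _ _] /T1 sff mK; apply: (sf_eq0 sff); rewrite subn_gt0.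
Qed.

Lemma lowers_expansion m T K f g (P : nat -> V -> R) : lowers m T ->
  (forall k, hp k (P k)) -> sf K g -> (m < K)%N ->
  (forall x, U x -> f x = \sum_(k < K) P k x + g x) ->
  T f 0 = \sum_(k < K) T (P k) 0.
Proof.
move=> lT hP sg mK fE; have [T1 T2 T3] := lT; have U0 := @ball0 _ d _ rho_gt0.
have sP k : sf 0 (P k) by apply: sf_leq (sf_hp rho_gt0 (hP k)).
rewrite (T3 f _ fE)// T2//; last 2 first.
- by apply: sf_sum => // k _.
- exact: sf_leq sg.
rewrite (lowers_flat lT sg mK) addr0.
have T0 : T (fun=> 0) 0 = 0 := lowers_flat lT (sf_zero _ _ m.+1) (ltnSn m).
elim: K {mK fE sg} => [|K IH].
  by rewrite big_ord0 -[RHS]T0; congr (T _ 0); apply/funext => x; rewrite big_ord0.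
rewrite big_ord_recr/= -IH -T2//; last by apply: sf_sum.
by congr (T _ 0); apply/funext => x; rewrite big_ord_recr.
Qed.

End DunklSmooth.

Section Taylor.
Variables (R : realType) (d : nat) (rho : R).
Hypothesis rho_gt0 : 0 < rho.
Local Notation V := 'rV[R]_d.
Implicit Types (f g w : V -> R) (x y v u a : V) (K m n : nat).
Local Notation U := (fun x : V => enorm x < rho).
Local Notation sf := (smooth_flat rho).

Lemma sf_derive_sum K f x y : sf K f -> U y ->
  'D_x f y = \sum_i x 0 i * 'D_(delta_mx 0 i) f y.
Proof.
move=> sff Uy; rewrite {1}[x]rV_sum_delta.
suff [] : is_derive y (\sum_i x 0 i *: delta_mx 0 i) f (\sum_i x 0 i * 'D_(delta_mx 0 i) f y) by [].
elim: (index_enum _) => [|i s IH]; first by rewrite !big_nil -[X in is_derive _ X](scale0r (0 : V)) -[0 in X in is_derive _ _ _ X](mul0r ('D_0 f y)); apply: is_derive_scale; exact: sf_derivable sff Uy.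
rewrite !big_cons addrC [X in is_derive _ _ _ X]addrC.
have [_ E] := IH; rewrite -E.
have near_df v : \forall z \near y, derivable f z v.
  by apply: filterS (ball_near Uy) => z Uz; exact: sf_derivable sff Uz.
apply: derive_linear => //.
exact: sf_continuous (sf_derive rho_gt0 _ sff) Uy.
Qed.

(** The coefficient of [x_i] in Hadamard's lemma: the integral of the [i]-th partial derivative
    along the segment from 0 to [x]. *)
Definition hadamard (i : 'I_d) f : V -> R := average (fun=> 0) id 0 ('D_(delta_mx 0 i) f).

Let linear0 (h : R) v x : (fun=> 0) (h *: v + x) = h *: (fun _ : V => 0 : V) v + (fun=> 0) x.
Proof. by rewrite scaler0 addr0. Qed.

Let U0 : U 0. Proof. exact: ball0. Qed.

Lemma sf_hadamard i K f : sf K f -> sf K.-1 (hadamard i f).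
Proof.
move=> sff; apply: (@sf_average _ _ _ rho_gt0 _ _ linear0 (@linear_id _ _) 1) => //.
- by move=> x; rewrite normr0 mul1r.
- by move=> x; rewrite mul1r.
- exact: sf_derive.
Qed.

Lemma hadamardE K f x : sf K f -> U x -> f x = f 0 + \sum_i x 0 i * hadamard i f x.
Proof.
move=> sff Ux.
have UC y : U y -> U (id y) by [].
have UB y : U y -> U ((fun _ : V => 0) y) by move=> _; exact: U0.
have uE : id x - (fun=> 0) x = x by rewrite /= subr0.
have FTC := average_FTC rho_gt0 UB UC sff Ux uE.
rewrite -[LHS](subrK (f 0)) FTC addrC; congr (_ + _).
have cD i y : U y -> {for y, continuous ('D_(delta_mx 0 i) f)}.
  exact: (sf_continuous (sf_derive rho_gt0 (delta_mx 0 i) sff)).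
have cA i : ucont (fun t => t ^+ 0 * 'D_(delta_mx 0 i) f (t *: (id x - (fun=> 0) x) + (fun=> 0) x)).
  exact: (ucont_average UB UC (i := 0) (cD i) Ux).
under eq_bigr => i _ do rewrite /hadamard /average -(uintZ _ (cA i)).
rewrite -uint_sum; last by move=> i; apply: ucont_scale; exact: cA.
rewrite /average; apply: uint_eq => t t01 /=.
have Ut : U (t *: (x - 0) + 0).
  rewrite /= subr0 addr0 enormZ; move: t01 => /andP[t0 t1]; rewrite ger0_norm//.
  by apply: le_lt_trans Ux; rewrite -[leRHS]mul1r ler_wpM2r ?enorm_ge0.
rewrite (sf_derive_sum _ sff Ut) mulr_sumr; apply: eq_bigr => i _.
by rewrite mulrCA.
Qed.

(** Hadamard's lemma iterated. Writing the remainder as a sum of [x_i] times previous remainders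
    yields two properties at once: flatness, for the operators at the origin, and the bound by
    [|x| ^ K], for the integral. *)
Lemma taylor K f : sf 0 f -> exists (P : nat -> V -> R) (g : V -> R),
  [/\ forall k, hp k (P k), sf K g,
      exists C r, [/\ 0 <= C, 0 < r & forall x, `|x| < r -> `|g x| <= C * `|x| ^+ K] &
      forall x, U x -> f x = \sum_(k < K) P k x + g x].
Proof.
elim: K f => [|K IH] f sff.
  exists (fun k => fun=> 0), f; split=> //; first by move=> k; exact: hp_zero.
    have /continuous_atP/(_ 1 ltr01)[r r0 H] := sf_continuous sff U0.
    exists (`|f 0| + 1), r; split=> [|//|x xr]; first exact: addr_ge0.
    rewrite expr0 mulr1; have := H x; rewrite subr0 => /(_ xr) fx.
    by have := ler_normD (f x - f 0) (f 0); rewrite subrK; lra.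
  by move=> x _; rewrite big_ord0 add0r.
have H i := IH _ (sf_hadamard i sff).
have /choice[P' HP] : forall i : 'I_d, exists P : nat -> V -> R, exists g : V -> R,
  [/\ forall k, hp k (P k), sf K g,
      exists C r, [/\ 0 <= C, 0 < r & forall x, `|x| < r -> `|g x| <= C * `|x| ^+ K] &
      forall x, U x -> hadamard i f x = \sum_(k < K) P k x + g x] by [].
have /choice[g Hg] := HP.
pose P k : V -> R := if k is k'.+1 then fun x => \sum_i x 0 i * P' i k' x else fun=> f 0.
exists P, (fun x => \sum_i x 0 i * g i x); split.
- case=> [|k]; first exact: hp_const.
  by apply: hp_sum => i; apply: hp_mulx; have [] := Hg i.
- by apply: sf_sum => // i _; apply: sf_mulx => //; have [] := Hg i.
- suff [C [r [C0 r0 B]]] : exists C r, [/\ 0 <= C, 0 < r &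
      forall i, i \in index_enum 'I_d -> forall x, `|x| < r -> `|g i x| <= C * `|x| ^+ K].
    exists (d%:R * C), r; split=> [||x xr]; [exact: mulr_ge0|by []|].
    apply: le_trans (ler_norm_sum _ _ _) _.
    apply: (@le_trans _ _ (\sum_(i < d) (`|x| * (C * `|x| ^+ K)))).
      apply: ler_sum => i _; rewrite normrM; apply: ler_pM => //; first exact: rV_coord_le.
      by apply: B => //; exact: mem_index_enum.
    by rewrite sumr_const card_ord -[leLHS]mulr_natl exprS le_eqVlt; apply/orP; left; apply/eqP; ring.
  elim: (index_enum _) => [|i s [C [r [C0 r0 B]]]]; first by exists 0, 1.
  have [_ _ [C' [r' [C'0 r'0 B']]] _] := Hg i.
  exists (C + C'), (Num.min r r'); split=> [||j]; [exact: addr_ge0|by rewrite lt_min r0|].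
  rewrite inE => /predU1P[->|js] x; rewrite lt_min => /andP[xr xr']; rewrite mulrDl.
    by apply: le_trans (B' x xr') _; rewrite lerDr mulr_ge0// exprn_ge0.
  by apply: le_trans (B j js x xr) _; rewrite lerDl mulr_ge0// exprn_ge0.
- move=> x Ux; rewrite (hadamardE sff Ux) big_ord_recl -addrA; congr (_ + _).
  rewrite exchange_big -big_split/=; apply: eq_bigr => i _.
  by have [_ _ _ ->//] := Hg i; rewrite mulrDr mulr_sumr.
Qed.

End Taylor.

(** * Power series *)

Section PowerSeries.
Variables (R : realType) (d : nat) (rho : R).
Hypothesis rho_gt0 : 0 < rho.
Local Notation V := 'rV[R]_d.
Implicit Types (f g u : V -> R) (x y v a : V) (k n K : nat).
Local Notation U := (fun x : V => enorm x < rho).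
Local Notation sf := (smooth_flat rho).

Lemma hpb_derive_le k M u v x (s : R) : hpb k M u -> `|x| <= s ->
  `|'D_v u x| <= k%:R * `|v| * M * s ^+ k.-1.
Proof.
move=> hu xs; have M0 := hpb_ge0 hu; have s0 := le_trans (normr_ge0 x) xs.
have [_] := hpb_derive v hu; case: k hu => [|k] hu /= D.
  by rewrite (congr1 (fun F => F x) D) normr0 !mul0r.
apply: le_trans (hpb_le x D) _; rewrite ler_wpM2l//; first by rewrite !mulr_ge0.
by apply: lerXn2r; rewrite ?nnegrE.
Qed.

Lemma hpb_lipschitz k M u v x (s h : R) : hpb k M u -> (forall t, `|t| <= `|h| -> `|t *: v + x| <= s) ->
  `|u (h *: v + x) - u x| <= `|h| * (k%:R * `|v| * M * s ^+ k.-1).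
Proof.
move=> hu xs; have [t th ->] : exists2 t, `|t| <= `|h| & u (h *: v + x) - u x = 'D_v u (t *: v + x) * h.
  by apply: line_mvt_abs => t _; have [] := hpb_derive v hu.
by rewrite normrM mulrC ler_wpM2l//; apply: hpb_derive_le hu _; exact: xs.
Qed.

Lemma hpb_quadratic k M u v x (s h : R) : hpb k M u -> (forall t, `|t| <= `|h| -> `|t *: v + x| <= s) ->
  `|u (h *: v + x) - u x - h * 'D_v u x| <=
  `|h| ^+ 2 * (k.-1%:R * `|v| * (k%:R * `|v| * M) * s ^+ k.-2).
Proof.
move=> hu xs; have [t th E] : exists2 t, `|t| <= `|h| & u (h *: v + x) - u x = 'D_v u (t *: v + x) * h.
  by apply: line_mvt_abs => t _; have [] := hpb_derive v hu.
rewrite E [h * _]mulrC -mulrBl normrM mulrC expr2 -mulrA ler_wpM2l//.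
have [_] := hpb_derive v hu; case: k hu => [|k] hu /= D.
  by rewrite !(congr1 (fun F => F _) D) subrr normr0 !mul0r mulr0.
apply: le_trans (hpb_lipschitz (s := s) D _) _ => [z zt|]; first by apply: xs; exact: le_trans th.
rewrite ler_wpM2r// !mulr_ge0 ?exprn_ge0 ?(hpb_ge0 hu)//.
by apply: le_trans (normr_ge0 _) (xs 0 _); rewrite normr0.
Qed.

Lemma cvg_norm_le (a : nat -> R) l C : a @ \oo --> l -> (forall n, `|a n| <= C) -> `|l| <= C.
Proof.
move=> al aC; have al' : `|a n| @[n --> \oo] --> `|l| by exact: cvg_norm al.
rewrite -(cvg_lim (@Rhausdorff R) al').
apply: limr_le; first by apply/cvg_ex; exists (`|l|).
exact: nearW.
Qed.

Lemma bounded_abs_sum_cvg (a : nat -> R) C : (forall n, \sum_(k < n) `|a k| <= C) ->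
  cvg ((fun n => \sum_(k < n) a k) @ \oo).
Proof.
move=> aC.
have E (b : nat -> R) : (fun n => \sum_(k < n) b k) = series b.
  by apply/funext => n; rewrite /series /= big_mkord.
rewrite E; apply: normed_cvg; apply: nondecreasing_is_cvgn.
  by apply: nondecreasing_series => n _ _; exact: normr_ge0.
exists C => _ [n _ <-]; apply: le_trans (aC n).
by rewrite /normed_series_of /= /series /= big_mkord.
Qed.

Definition majorant (N : nat -> R) :=
  (forall k, 0 <= N k) /\
  forall s : R, 0 <= s < rho -> exists C, forall n, \sum_(k < n) N k * s ^+ k <= C.

(** With [t] midway between [s] and [rho], [(k + 1) s ^ k (t - s) <= t ^ (k + 1)], so the
    differentiated series at [s] is controlled by the original one at [t]. *)
Lemma majorant_derive N : majorant N -> majorant (fun k => k.+1%:R * N k.+1).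
Proof.
move=> [N0 HN]; split=> [k|s /andP[s0 sr]]; first by rewrite mulr_ge0.
pose t := (s + rho) / 2.
have st : s < t by rewrite /t; lra.
have [|C HC] := HN t; first by rewrite /t; apply/andP; split; lra.
exists (C / (t - s)) => n; rewrite ler_pdivlMr ?subr_gt0// mulr_suml.
have key k : k.+1%:R * s ^+ k * (t - s) <= t ^+ k.+1.
  suff : k.+1%:R * s ^+ k * (t - s) <= t ^+ k.+1 - s ^+ k.+1.
    by have := exprn_ge0 k.+1 s0; lra.
  elim: k => [|k IH]; first by rewrite !expr0 !expr1 !mul1r.
  have sk : s ^+ k.+1 <= t ^+ k.+1 by apply: lerXn2r; rewrite ?nnegrE//; lra.
  have -> : t ^+ k.+2 - s ^+ k.+2 = s * (t ^+ k.+1 - s ^+ k.+1) + (t - s) * t ^+ k.+1.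
    by rewrite !(exprS _ k.+1); ring.
  have := ler_wpM2l s0 IH; have ts : 0 <= t - s by lra.
  have := ler_wpM2l ts sk; rewrite -[k.+2]addn1 natrD [s ^+ k.+1]exprS.
  by move: (s ^+ k) (t ^+ k.+1) => a b; lra.
apply: le_trans _ (HC n.+1); rewrite big_ord_recl -[leLHS]add0r lerD//.
  by rewrite mulr_ge0.
apply: ler_sum => k _; rewrite /= /bump /= add1n.
by have := ler_wpM2l (N0 k.+1) (key k); lra.
Qed.

(** A power series grouped by degree and starting in degree [K]. The class is stable under
    differentiation at the price of lowering [K], hence consists of smooth functions by
    [sf_coind]. *)
Definition majorized K f := exists (u : nat -> V -> R) (N : nat -> R),
  [/\ forall k, hpb k (N k) (u k), forall k, (k < K)%N -> u k = fun=> 0, majorant N &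
      forall x, U x -> (fun n => \sum_(k < n) u k x) @ \oo --> f x].

Lemma majorized_continuous K f x : majorized K f -> U x -> {for x, continuous f}.
Proof.
move=> [u [N [hu _ mN uf]]] Ux.
pose s := (`|x| + rho) / 2.
have xr : `|x| < rho by apply: le_lt_trans (norm_le_enorm x) Ux.
have [N0 /(_ s)[|C HC]] := majorant_derive mN.
  by rewrite /s; have nx := normr_ge0 x; apply/andP; split; lra.
have C0 : 0 <= C by have := HC 0%N; rewrite big_ord0.
apply/continuous_atP => e e0.
have /nbhs_ballP[r1 /= r10 HU] := ball_near Ux.
have C1 : 0 < C + 1 by lra.
have r2 : 0 < s - `|x| by rewrite /s; lra.
exists (Num.min r1 (Num.min (s - `|x|) (e / (C + 1)))) => [|y]; first by rewrite !lt_min r10 r2 divr_gt0.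
rewrite !lt_min => /and3P[y1 y2 y3].
have Uy : U y by apply: HU; rewrite -ball_normE /= distrC.
suff : `|f y - f x| <= `|y - x| * C.
  move=> /le_lt_trans; apply; rewrite ltr_pdivlMr// in y3.
  by apply: le_lt_trans y3; rewrite ler_wpM2l//; lra.
apply: (cvg_norm_le (a := fun n => \sum_(k < n.+1) u k y - \sum_(k < n.+1) u k x)).
  apply: cvgB; first by have := uf y Uy; rewrite -(cvg_shiftS (fun n => \sum_(k < n) u k y)).
  by have := uf x Ux; rewrite -(cvg_shiftS (fun n => \sum_(k < n) u k x)).
move=> n; rewrite -sumrB; apply: le_trans (ler_norm_sum _ _ _) _.
apply: le_trans (ler_wpM2l (normr_ge0 _) (HC n)); rewrite mulr_sumr.
have H k : `|u k y - u k x| <= `|y - x| * (k%:R * N k * s ^+ k.-1).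
  have := hpb_lipschitz (v := y - x) (x := x) (s := s) (h := 1) (hu k).
  rewrite scale1r subrK normr1 mul1r [k%:R * `|_|]mulrC -!mulrA => -> // t t1.
  apply: le_trans (ler_normD _ _) _; rewrite normrZ.
  by have := ler_wpM2r (normr_ge0 (y - x)) t1; lra.
rewrite big_ord_recl; apply: (@le_trans _ _ (0 + \sum_(i < n) `|u (lift ord0 i) y - u (lift ord0 i) x|)).
  rewrite lerD2r; apply: le_trans (H 0%N) _; by rewrite !mul0r mulr0.
by rewrite add0r; apply: ler_sum => i _; exact: (H i.+1).
Qed.

(** The error of each term is quadratic in [h], by the mean value theorem used twice. The sum of
    these errors is controlled by the majorant of the second derivative, which justifies termwise
    differentiation. *)
Lemma majorized_derive K f v : majorized K f ->
  exists2 f', majorized K.-1 f' & forall x, U x -> is_derive x v f (f' x).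
Proof.
move=> [u [N [hu u0 mN uf]]].
have mN1 := majorant_derive mN; have mN2 := majorant_derive mN1.
pose u' k : V -> R := 'D_v (u k.+1); pose N' k := `|v| * (k.+1%:R * N k.+1).
have hu' k : hpb k (N' k) (u' k).
  have [_ /=] := hpb_derive v (hu k.+1); rewrite (_ : _ * _ * _ = N' k)//.
  by rewrite /N'; ring.
have mN' : majorant N'.
  split=> [k|s sr]; first exact: hpb_ge0 (hu' k).
  have [C HC] := mN1.2 s sr; exists (`|v| * C) => n.
  apply: le_trans (ler_wpM2l (normr_ge0 v) (HC n)); rewrite mulr_sumr.
  by apply: ler_sum => k _; rewrite /N' !mulrA.
have cu' x : U x -> cvg ((fun n => \sum_(k < n) u' k x) @ \oo).
  move=> Ux; have [|C HC] := mN'.2 `|x|.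
    by rewrite normr_ge0 (le_lt_trans (norm_le_enorm x) Ux).
  suff H n : \sum_(k < n) `|u' k x| <= C by exact: (bounded_abs_sum_cvg (a := fun k => u' k x) H).
  apply: le_trans (HC n).
  by apply: ler_sum => k _; exact: hpb_le.
exists (fun x => lim ((fun n => \sum_(k < n) u' k x) @ \oo)).
  exists u', N'; split=> // k kK; rewrite /u' u0; last by lia.
  exact: derive_zero.
move=> x Ux; have xr : `|x| < rho by apply: le_lt_trans (norm_le_enorm x) Ux.
pose s := (`|x| + rho) / 2.
have [|C HC] := mN2.2 s; first by rewrite /s; have nx := normr_ge0 x; apply/andP; split; lra.
have /nbhs_ballP[r1 /= r10 HU] := ball_near Ux.
have v1 : 0 < `|v| + 1 by rewrite ltr_wpDl.
have r2 : 0 < s - `|x| by rewrite /s; lra.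
apply: (@is_derive_quadratic _ _ _ _ _ _ (`|v| ^+ 2 * C) (Num.min (r1 / (`|v| + 1)) ((s - `|x|) / (`|v| + 1)))).
  by rewrite lt_min !divr_gt0.
move=> h; rewrite lt_min !ltr_pdivlMr// => /andP[h1 h2].
have hv : `|h| * `|v| <= `|h| * (`|v| + 1) by rewrite ler_wpM2l// lerDl.
have Uh : U (h *: v + x).
  by apply: HU; rewrite -ball_normE /= distrC addrK normrZ; apply: le_lt_trans h1.
have Hs t : `|t| <= `|h| -> `|t *: v + x| <= s.
  move=> th; apply: le_trans (ler_normD _ _) _; rewrite normrZ.
  by have := ler_wpM2r (normr_ge0 v) th; lra.
(* The derivative of [u k] has index [k - 1] in [u'], hence the shifted ranges; degrees 0 and 1 have
   no quadratic error and split off below. *)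
apply: (cvg_norm_le (a := fun n => \sum_(k < n.+2) u k (h *: v + x) - \sum_(k < n.+2) u k x -
    h * \sum_(k < n.+1) u' k x)).
  apply: cvgB; [apply: cvgB|apply: cvgMr].
  - have := uf _ Uh; rewrite -(cvg_shiftS (fun n => \sum_(k < n) u k (h *: v + x))).
    by rewrite -(cvg_shiftS (fun n => \sum_(k < n.+1) u k (h *: v + x))).
  - have := uf _ Ux; rewrite -(cvg_shiftS (fun n => \sum_(k < n) u k x)).
    by rewrite -(cvg_shiftS (fun n => \sum_(k < n.+1) u k x)).
  - by have := cu' x Ux; rewrite -(cvg_shiftS (fun n => \sum_(k < n) u' k x)).
move=> n.
have D0 : 'D_v (u 0%N) x = 0.
  by have [_ /= D] := hpb_derive v (hu 0%N); rewrite (congr1 (fun F => F x) D).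
have -> : \sum_(k < n.+1) u' k x = \sum_(k < n.+2) 'D_v (u k) x by rewrite [RHS]big_ord_recl D0 add0r.
rewrite mulr_sumr -!sumrB; apply: le_trans (ler_norm_sum _ _ _) _.
have H k := hpb_quadratic (hu k) Hs.
apply: (@le_trans _ _ (\sum_(k < n.+2) (`|h| ^+ 2 * (k.-1%:R * `|v| * (k%:R * `|v| * N k) * s ^+ k.-2)))).
  by apply: ler_sum => k _; exact: H.
rewrite !big_ord_recl /= !mul0r !mulr0 !add0r mulrC.
apply: (@le_trans _ _ (`|h| ^+ 2 * (`|v| ^+ 2 * \sum_(k < n) k.+1%:R * (k.+2%:R * N k.+2) * s ^+ k))).
  rewrite !mulr_sumr; apply: ler_sum => k _; rewrite /= /bump /= !add1n /= le_eqVlt.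
  by apply/orP; left; apply/eqP; ring.
by rewrite ler_wpM2l ?exprn_ge0// ler_wpM2l ?exprn_ge0.
Qed.

Lemma sf_majorized K f : majorized K f -> sf K f.
Proof.
move=> mf; apply: (@sf_coind _ _ rho rho_gt0 majorized) => // {K f mf} K f mf; split.
- by move=> x; exact: majorized_continuous mf.
- move=> K0; have [u [N [hu u0 _ uf]]] := mf.
  have U0 : U 0 by exact: ball0.
  have := uf 0 U0; rewrite (_ : (fun n => _) = fun=> 0) => [H|].
    by rewrite -(cvg_lim (@Rhausdorff R) H); apply: lim_cst; exact: Rhausdorff.
  apply/funext => n; rewrite big1// => k _; case: (k : nat) => [|j]; first by rewrite u0.
  have := hp_hom 0 0 (ex_intro _ _ (hu j.+1) : hp j.+1 (u j.+1)).
  by rewrite scale0r expr0n mul0r.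
- by move=> v; exact: majorized_derive.
Qed.

End PowerSeries.

Section Analytic.
Variables (R : realType) (d : nat).
Local Notation V := 'rV[R]_d.
Implicit Types (f g : V -> R) (x y : V).

Lemma hpb_monomial (I : Type) (s : seq I) (e : I -> nat) (j : I -> 'I_d) :
  hpb (\sum_(i <- s) e i)%N 1 (fun x : V => \prod_(i <- s) x 0 (j i) ^+ e i).
Proof.
elim: s => [|i s IH].
  rewrite big_nil (_ : (fun x => _) = fun=> 1); last by apply/funext => x; rewrite big_nil.
  by rewrite -[X in hpb _ X](normr1 R); exact: hpb_const.
rewrite big_cons (_ : (fun x => _) = fun x => x 0 (j i) ^+ e i * \prod_(i <- s) x 0 (j i) ^+ e i); last first.
  by apply/funext => x; rewrite big_cons.
move: IH; set f := (fun x : V => \prod_(i <- s) x 0 (j i) ^+ e i) => IH.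
elim: (e i) => [|n In].
  by rewrite (_ : (fun x => _) = f)//; apply/funext => x; rewrite expr0 mul1r.
rewrite (_ : (fun x => _) = fun x => x 0 (j i) * (x 0 (j i) ^+ n * f x)); first exact: hpb_mulx.
by apply/funext => x; rewrite exprS mulrA.
Qed.

Lemma hpb_sum k (I : Type) (s : seq I) (P : pred I) (M : I -> R) (F : I -> V -> R) :
  (forall i, P i -> hpb k (M i) (F i)) ->
  hpb k (\sum_(i <- s | P i) M i) (fun x => \sum_(i <- s | P i) F i x).
Proof.
move=> H; elim: s => [|i s IH].
  rewrite big_nil (_ : (fun x => _) = fun=> 0); first exact: hpb_zero.
  by apply/funext => x; rewrite big_nil.
rewrite (_ : (fun x => _) = fun x => if P i then F i x + \sum_(i <- s | P i) F i x
    else \sum_(i <- s | P i) F i x); last by apply/funext => x; rewrite big_cons.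
by rewrite big_cons; case: ifP => // Pi; apply: hpb_add => //; exact: H.
Qed.

Definition pterm_mass k (c : ('I_d -> nat) -> R) : R :=
  \sum_(a : {ffun 'I_d -> 'I_k.+1} | (\sum_(i < d) val (a i))%N == k) `|c (fun i => val (a i))|.

Lemma hpb_pterm k c : hpb k (pterm_mass k c) (fun x : V => pterm k c 0 x).
Proof.
apply: hpb_sum => a /eqP ak; rewrite -[X in hpb _ X]mulr1; apply: hpb_scale.
have := hpb_monomial (index_enum 'I_d) (fun i => val (a i)) id; rewrite ak.
by congr hpb; apply/funext => x; apply: eq_bigr => i _; rewrite mxE subr0.
Qed.

Lemma pterm_abs_const k c (s : R) : 0 <= s -> pterm_abs k c 0 (const_mx s : V) = pterm_mass k c * s ^+ k.
Proof.
move=> s0; rewrite /pterm_abs /pterm_mass mulr_suml; apply: eq_bigr => a /eqP ak; congr (_ * _).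
under eq_bigr do rewrite !mxE subr0 ger0_norm//.
by rewrite prodrXr ak.
Qed.

Lemma majorized_tail rho K f u (N : nat -> R) :
  (forall k, hpb k (N k) (u k)) -> majorant rho N ->
  (forall x, enorm x < rho -> (fun n => \sum_(k < n) u k x) @ \oo --> f x) ->
  majorized rho K (fun x => f x - \sum_(k < K) u k x).
Proof.
move=> hu mN uf.
exists (fun k => if (k < K)%N then fun=> 0 else u k), N; split => //.
- by move=> k; case: ifP => _; [exact: (hpb_weaken (mN.1 k) (@hpb_zero _ _ k))|exact: hu].
- by move=> k ->.
- move=> x Ux; rewrite -(cvg_shiftn K).
  rewrite (_ : (fun n => _) = fun n => \sum_(k < n + K) u k x - \sum_(k < K) u k x); last first.
    apply/funext => n; rewrite addnC !big_split_ord /= [RHS]addrC addrA addNr add0r [X in X + _]big1 => [|k _]; last by rewrite ltn_ord.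
    by rewrite add0r; apply: eq_bigr => k _; rewrite ltnNge leq_addr.
  by apply: cvgB; [rewrite (cvg_shiftn K (fun n => \sum_(k < n) u k x)); exact: uf|exact: cvg_cst].
Qed.

(** Absolute convergence at the single point [(s, ..., s)] says that the coefficient masses are
    summable against [s ^ k], which majorizes the series on the ball of radius [s]. *)
Lemma analytic_majorant (f : V -> R) : analytic_on_ball f ->
  exists rho (u : nat -> V -> R) (N : nat -> R), [/\ 0 < rho, forall k, hpb k (N k) (u k), majorant rho N &
    forall x, enorm x < rho -> (fun n => \sum_(k < n) u k x) @ \oo --> f x].
Proof.
move=> /(_ 0)[|delta [delta0 [c Hc]]]; first by rewrite enorm0.
(* The point [(s, ..., s)] has Euclidean norm at most [d s], which the denominator [d + 1] keeps
   below [delta]. *)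
pose s := delta / (d.+1)%:R.
have s0 : 0 < s by rewrite divr_gt0.
have sd : s <= delta by rewrite ler_pdivrMr//; apply: ler_peMr; [exact: ltW|rewrite ler1n].
pose p : V := const_mx s.
have pd : enorm (p - 0) < delta.
  rewrite subr0; apply: le_lt_trans (enorm_le_norm _) _.
  have pn : `|p| <= s by apply: rV_norm_le => [|i]; [exact: ltW|rewrite mxE ger0_norm// ltW].
  apply: (@le_lt_trans _ _ (d%:R * s)); first by rewrite ler_wpM2l.
  by rewrite /s mulrCA gtr_pMr// ltr_pdivrMr// mul1r ltr_nat.
exists s, (fun k x => pterm k c 0 x), (fun k => pterm_mass k c); split=> //.
- by move=> k; exact: hpb_pterm.
- have N0 k : 0 <= pterm_mass k c by exact: sumr_ge0.
  split=> // t /andP[t0 ts]; exists (lim ((fun N => \sum_(k < N) pterm_abs k c 0 p) @ \oo)) => n.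
  apply: (@le_trans _ _ (\sum_(k < n) pterm_abs k c 0 p)).
    apply: ler_sum => k _; rewrite (pterm_abs_const _ _ (ltW s0)).
    by rewrite ler_wpM2l//; apply: lerXn2r; rewrite ?nnegrE//; exact: ltW.
  apply: (nondecreasing_cvgn_le (u_ := fun N => \sum_(k < N) pterm_abs k c 0 p)); last by have [] := Hc p pd.
  apply/nondecreasing_seqP => m; rewrite big_ord_recr lerDl; apply: sumr_ge0 => a _.
  by rewrite mulr_ge0//; apply: prodr_ge0 => i _; exact: exprn_ge0.
- by move=> x xs; have [] := Hc x => //; rewrite subr0; exact: lt_le_trans sd.
Qed.

End Analytic.

(** * Expansion of the spherical mean *)

Section SphericalMean.
Variables (R : realType) (d : nat).
Local Notation V := 'rV[R]_d.
Variables (Rs : seq V) (b0 : V) (kappa : V -> R).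
Hypothesis d_gt0 : (0 < d)%N.
Hypotheses (rs : root_system Rs) (reg : regular Rs b0) (mult : multiplicity Rs kappa).
Variables (deg : nat) (q : mpoly.mpoly d R).
Hypothesis hq : harmonic_homog Rs b0 kappa deg q.
Implicit Types (f g : V -> R) (x y : V) (r : R).

Local Notation wint := (wint Rs b0 kappa).
Local Notation w := (hnorm Rs b0 kappa).
Local Notation Q := (peval q).
Local Notation W := (wint (fun=> 1)).

Let cw : sphere_continuous w := @sphere_continuous_hnorm _ _ _ b0 _ mult.
Let cQ : sphere_continuous Q := hp_sphere (hp_peval hq).
Let W_gt0 : 0 < W := wint1_gt0 d_gt0 b0 rs mult.

Lemma sphere_continuous_sum n (F : nat -> V -> R) : (forall k, sphere_continuous (F k)) ->
  sphere_continuous (fun y => \sum_(k < n) F k y).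
Proof.
move=> cF; elim: n => [|n IH].
  rewrite (_ : (fun y => _) = fun=> 0); first exact: sphere_continuousC.
  by apply/funext => y; rewrite big_ord0.
rewrite (_ : (fun y => _) = fun y => \sum_(k < n) F k y + F n y); first exact: sphere_continuousD.
by apply/funext => y; rewrite big_ord_recr.
Qed.

Lemma wint_sum n (F : nat -> V -> R) : (forall k, sphere_continuous (F k)) ->
  wint (fun y => \sum_(k < n) F k y) = \sum_(k < n) wint (F k).
Proof.
move=> cF; elim: n => [|n IH].
  rewrite big_ord0 -[RHS](wint0 b0 mult); congr wint.
  by apply/funext => y; rewrite big_ord0.
rewrite big_ord_recr /= -IH -(wintD b0 mult (sphere_continuous_sum cF) (cF n)).
by congr wint; apply/funext => y; rewrite big_ord_recr.
Qed.

Lemma dilation_continuous rho K f r : smooth_flat rho K f -> 0 < r < rho ->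
  sphere_continuous (fun y => f (r *: y)).
Proof.
move=> sff /andP[r0 rr] y y1; apply: (@continuous_comp _ _ _ (fun y : V => r *: y) f).
  exact: scaler_continuous.
by apply: sf_continuous sff _; rewrite enormZ y1 mulr1 gtr0_norm.
Qed.

Lemma hp_dilation_continuous k P r : hp k P -> sphere_continuous (fun y : V => P (r *: y)).
Proof.
move=> hP; rewrite (_ : (fun y => _) = fun y => r ^+ k * P y).
  by apply: sphere_continuousM; [exact: sphere_continuousC|exact: hp_sphere hP].
by apply/funext => y; exact: hp_hom.
Qed.

Lemma sph_meanE f r : sphere_continuous (fun y => f (r *: y)) ->
  sph_mean Rs b0 kappa q f r = W^-1 * wint (fun y => Q y * f (r *: y)).
Proof.
move=> cf; rewrite /sph_mean /omega.
set c := \prod_(b <- pos_roots Rs b0) dotp b b `^ kappa b.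
have c0 : 0 < c.
  rewrite /c big_seq; apply: prodr_gt0 => b bp.
  by rewrite powR_gt0// dotp_gt0//; exact: pos_neq0 bp.
have -> : int_sphere (fun y => hweight Rs b0 kappa y ^+ 2) = c * W.
  rewrite -[RHS]/(c * int_sphere (fun y => 1 * w y)) -int_sphereZ; last first.
    by apply: sphere_continuousM => //; exact: sphere_continuousC.
  by congr int_sphere; apply/funext => y; rewrite hweight_hnorm// mul1r.
have -> : int_sphere (fun y => Q y * f (r *: y) * hweight Rs b0 kappa y ^+ 2) =
    c * wint (fun y => Q y * f (r *: y)).
  rewrite -[RHS]/(c * int_sphere (fun y => Q y * f (r *: y) * w y)) -int_sphereZ; last first.
    by apply: sphere_continuousM => //; exact: sphere_continuousM.
  by congr int_sphere; apply/funext => y; rewrite hweight_hnorm// mulrCA.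
by rewrite invfM mulrACA mulVf ?mul1r// gt_eqF.
Qed.

Lemma wint_eq f g : sphere_continuous f -> sphere_continuous g ->
  (forall y, enorm y = 1 -> f y = g y) -> wint f = wint g.
Proof.
move=> cf cg fg; apply: int_sphere_eq => [||y y1]; [exact: sphere_continuousM..|].
by rewrite fg.
Qed.

(** The two conditions on [K] pull in opposite directions: every operator in the sum must have order
    below [K] to ignore the remainder [g], and each [P k] with [k < K] must have its possible
    nonzero term among the first [N]. *)
Lemma sum_exp_term rho K N f g (P : nat -> V -> R) r : 0 < rho ->
  (forall k, hp k (P k)) -> smooth_flat rho K g ->
  (forall x, enorm x < rho -> f x = \sum_(k < K) P k x + g x) ->
  (forall n, (n < N)%N -> (deg + 2 * n < K)%N) -> (K <= deg + 2 * N)%N ->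
  \sum_(n < N) exp_term Rs b0 kappa deg q f r n =
  W^-1 * wint (fun y => Q y * \sum_(k < K) P k (r *: y)).
Proof.
move=> rho0 hP sg fE nK KN.
have [L [qL qDL]] := mpoly_words Rs b0 kappa hq.1.
have E n : (n < N)%N -> exp_term Rs b0 kappa deg q f r n =
    \sum_(k < K) exp_term Rs b0 kappa deg q (P k) r n.
  move=> nN; rewrite /exp_term -!mulr_suml; congr (_ / _ * _); rewrite qDL.
  under eq_bigr do rewrite qDL.
  have lT : lowers rho (n * 2 + deg) (fun f => words_op Rs b0 kappa L (iter n (dlap Rs b0 kappa) f)).
    apply: (lowers_comp (lowers_words_op rho0 b0 kappa rs L)).
    exact: lowers_iter (lowers_dlap rho0 b0 kappa rs).
  apply: (lowers_expansion rho0 lT hP sg _ fE).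
  by rewrite addnC mulnC; exact: nK.
under eq_bigr => n _ do rewrite (E n (ltn_ord n)).
rewrite exchange_big /=.
under eq_bigr => k _ do rewrite (exp_term_hp d_gt0 rs reg mult hq r (hP k) (leq_trans (ltn_ord k) KN)).
rewrite -mulr_sumr -(wint_sum _ (F := fun k y => Q y * P k (r *: y))); last first.
  by move=> k; apply: sphere_continuousM => //; exact: hp_dilation_continuous (hP k).
by congr (_ * wint _); apply/funext => y; rewrite mulr_sumr.
Qed.

Lemma mean_expansion_smooth f (U : set V) : open U -> U 0 -> smooth_on U f ->
  forall N eps, 0 < eps -> exists delta, 0 < delta /\
    forall r, 0 < r < delta ->
      `| sph_mean Rs b0 kappa q f r - \sum_(n < N.+1) exp_term Rs b0 kappa deg q f r n |
      <= eps * r ^+ (deg + 2 * N).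
Proof.
move=> oU U0 sfU N eps eps0.
have [rho rho0 HU] : exists2 rho, 0 < rho & forall x, enorm x < rho -> U x.
  have /nbhs_ballP[rho /= rho0 H] : nbhs (0 : V) U by exact: open_nbhs_nbhs.
  exists rho => // x xr; apply: H; rewrite -ball_normE /= sub0r normrN.
  exact: le_lt_trans (norm_le_enorm x) xr.
have sff : smooth_flat rho 0 f by split=> // vs v x xr; apply: sfU; exact: HU.
(* One more than the order of the last operator: no operator sees the remainder, and its mean is
   [O(r ^ K)], one power of [r] better than needed. *)
pose K := (deg + 2 * N).+1.
have [P [g [hP sg [C [r1 [C0 r10 gC]]] fE]]] := taylor rho0 K sff.
have [B HB] := sphere_bounded (sphere_continuousM cQ cw).
pose S := int_sphere (fun _ : V => 1 : R).
have S0 : 0 <= S by apply: int_sphere_ge0 => // y _; exact: cfC.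
pose A := `|B| * C * S / W.
have A0 : 0 <= A by apply: divr_ge0 (ltW W_gt0); apply: mulr_ge0 => //; exact: mulr_ge0.
have A1 : 0 < A + 1 by lra.
(* The last bound gives [A r <= eps], also when [A = 0]. *)
exists (Num.min rho (Num.min r1 (eps / (A + 1)))); split; first by rewrite !lt_min rho0 r10 divr_gt0.
move=> r /andP[r0]; rewrite !lt_min => /and3P[rrho rr1 reps].
have rU : 0 < r < rho by rewrite r0.
have rsph y : enorm y = 1 -> enorm (r *: y) = r by move=> y1; rewrite enormZ y1 mulr1 gtr0_norm.
have cP : sphere_continuous (fun y => Q y * \sum_(k < K) P k (r *: y)).
  apply: sphere_continuousM => //; apply: (sphere_continuous_sum (F := fun k y => P k (r *: y))) => k.
  exact: hp_dilation_continuous (hP k).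
have cg : sphere_continuous (fun y => Q y * g (r *: y)).
  by apply: sphere_continuousM => //; exact: dilation_continuous sg rU.
have cf : sphere_continuous (fun y => f (r *: y)) := dilation_continuous sff rU.
rewrite (sph_meanE cf) (sum_exp_term (N := N.+1) r rho0 hP sg fE); last 2 first.
- by move=> n nN; rewrite ltnS leq_add2l leq_pmul2l.
- by rewrite mulnS addnCA add2n leqnSn.
have -> : wint (fun y => Q y * f (r *: y)) =
    wint (fun y => Q y * \sum_(k < K) P k (r *: y) + Q y * g (r *: y)).
  apply: wint_eq => [||y y1]; [exact: sphere_continuousM|exact: sphere_continuousD|].
  by rewrite fE ?rsph// mulrDr.
rewrite (wintD b0 mult cP cg) mulrDr addrC addKr normrM gtr0_norm ?invr_gt0//.
have wg : `|wint (fun y => Q y * g (r *: y))| <= `|B| * (C * r ^+ K) * S.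
  apply: int_sphere_bound => [|y y1]; first exact: sphere_continuousM.
  rewrite mulrAC normrM; apply: ler_pM => //.
    by apply: le_trans (HB y y1) _; exact: ler_norm.
  have ry : `|r *: y| <= r by rewrite -[leRHS](rsph y y1); exact: norm_le_enorm.
  apply: le_trans (gC _ (le_lt_trans ry rr1)) _; rewrite ler_wpM2l//.
  by apply: lerXn2r; rewrite ?nnegrE// ltW.
rewrite mulrC ler_pdivrMr//; apply: le_trans wg _.
have -> : `|B| * (C * r ^+ K) * S = A * r * r ^+ (deg + 2 * N) * W.
  by rewrite /A exprS; field; rewrite gt_eqF.
rewrite ler_wpM2r ?(ltW W_gt0)// ler_wpM2r ?exprn_ge0 ?(ltW r0)//.
move: reps; rewrite ltr_pdivlMr// mulrDr mulr1 [r * A]mulrC => reps.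
by have := ltW reps; move: (ltW r0); lra.
Qed.

Lemma mean_expansion_analytic f : analytic_on_ball f ->
  exists rho, 0 < rho < 1 /\ forall r, 0 < r < rho ->
    (fun N => \sum_(n < N) exp_term Rs b0 kappa deg q f r n) @ \oo --> sph_mean Rs b0 kappa q f r.
Proof.
move=> /analytic_majorant[s [u [N [s0 hu mN uf]]]].
(* The [2^-1] only keeps the radius below 1. *)
exists (Num.min s 2^-1); split.
  by rewrite lt_min s0 invr_gt0 ltr0n /= gt_min; apply/orP; right; lra.
move=> r /andP[r0]; rewrite lt_min => /andP[rs' _].
have rU : 0 < r < s by rewrite r0.
have rsph y : enorm y = 1 -> enorm (r *: y) = r by move=> y1; rewrite enormZ y1 mulr1 gtr0_norm.
have hP k : hp k (u k) by exists (N k); exact: hu.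
have tail K := sf_majorized s0 (majorized_tail K hu mN uf).
have cf : sphere_continuous (fun y => f (r *: y)).
  have := dilation_continuous (tail 0%N) rU; congr sphere_continuous.
  by apply/funext => y; rewrite big_ord0 subr0.
have cu k : sphere_continuous (fun y => u k (r *: y)) := hp_dilation_continuous (hP k).
have cS K : sphere_continuous (fun y => \sum_(k < K) u k (r *: y)).
  exact: (sphere_continuous_sum (F := fun k y => u k (r *: y))).
rewrite (sph_meanE cf).
(* The first [M] terms are the exact mean of the power series truncated below degree [deg + 2 M], so
   only the limit under the integral remains. *)
have E M : \sum_(n < M) exp_term Rs b0 kappa deg q f r n =
    W^-1 * wint (fun y => Q y * \sum_(k < deg + 2 * M) u k (r *: y)).
  apply: (sum_exp_term r s0 hP (tail (deg + 2 * M)%N)) => //.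
  - by move=> x _; rewrite addrC subrK.
  - by move=> n nM; rewrite ltn_add2l ltn_pmul2l.
under eq_fun do rewrite E.
apply: cvgMr.
have [B HB] := sphere_bounded (sphere_continuousM cQ cw).
have [|C HC] := mN.2 r; first by rewrite ltW.
pose F M y := Q y * (\sum_(k < deg + 2 * M) u k (r *: y)) * w y.
have cF M : sphere_continuous (F M) := sphere_continuousM (sphere_continuousM cQ (cS _)) cw.
have cG : sphere_continuous (fun y => Q y * f (r *: y) * w y).
  exact: sphere_continuousM (sphere_continuousM cQ cf) cw.
have bF M y : enorm y = 1 -> `|F M y| <= `|B| * C.
  move=> y1; rewrite /F mulrAC normrM; apply: ler_pM => //.
    by apply: le_trans (HB y y1) _; exact: ler_norm.
  apply: le_trans (ler_norm_sum _ _ _) _; apply: le_trans (HC (deg + 2 * M)%N).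
  apply: ler_sum => k _; apply: le_trans (hpb_le _ (hu k)) _.
  apply: ler_wpM2l; first exact: hpb_ge0 (hu k).
  have ry : `|r *: y| <= r by rewrite -[leRHS](rsph y y1); exact: norm_le_enorm.
  by apply: lerXn2r; rewrite ?nnegrE//; exact: ltW.
have lF y : enorm y = 1 -> F M y @[M --> \oo] --> Q y * f (r *: y) * w y.
  move=> y1; apply: cvgMl; apply: cvgMr.
  have Uy : enorm (r *: y) < s by rewrite rsph.
  have H : \sum_(k < n) u k (r *: y) @[n --> \oo] --> f (r *: y) := uf _ Uy.
  have D : (deg + 2 * M)%N @[M --> \oo] --> \oo.
    move=> A [n _ nA]; exists n => // m /= nm; apply: nA => /=.
    by apply: leq_trans nm _; rewrite -[leqLHS]mul1n (leq_trans _ (leq_addl _ _))// leq_mul2r orbT.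
  exact: cvg_comp D H.
exact: (int_sphere_dct cF cG bF lF).
Qed.

End SphericalMean.

Theorem theorem3p2 (R : realType) (d : nat) (Rs : seq 'rV[R]_d) (b0 : 'rV[R]_d)
    (kappa : 'rV[R]_d -> R) (deg : nat) (q : mpoly.mpoly d R) :
  (1 <= d)%N -> root_system Rs -> regular Rs b0 -> multiplicity Rs kappa ->
  harmonic_homog Rs b0 kappa deg q ->
  (* (i) *)
  (forall (f : 'rV[R]_d -> R) (U : set 'rV[R]_d),
      open U -> U 0 -> smooth_on U f ->
      forall N : nat, forall eps : R, 0 < eps -> exists delta : R, 0 < delta /\
        forall r : R, 0 < r < delta ->
          `| sph_mean Rs b0 kappa q f r
             - \sum_(n < N.+1) exp_term Rs b0 kappa deg q f r n |
          <= eps * r ^+ (deg + 2 * N)) /\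
  (* (ii) *)
  (forall f : 'rV[R]_d -> R, analytic_on_ball f ->
      exists rho : R, 0 < rho < 1 /\
        forall r : R, 0 < r < rho ->
          (fun N => \sum_(n < N) exp_term Rs b0 kappa deg q f r n) @ \oo
            --> sph_mean Rs b0 kappa q f r).
Proof.
move=> d_gt0 rs reg mult hq; split=> [f U oU U0 sf|f af].
  exact: (mean_expansion_smooth d_gt0 rs reg mult hq oU U0 sf).
exact: (mean_expansion_analytic d_gt0 rs reg mult hq af).
Qed.
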